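(* Let $x,r,r^*,s$ be complex numbers with $0<|x|<1$, $\mathrm{Re}(r)>0$, $\mathrm{Re}(r^* )>0$, $s\neq2$, and $k=r-r^*\neq0,-2$. Let $E_j(z),F_j(z)$ $(j=1,2)$ be the currents defined in the context, and write $z_i=x^{2u_i}$. Then the following relations hold. (1) For $j=1,2$, $$[u_1-u_2]_{r-k}[u_1-u_2-1]_{r-k}E_j(z_1)E_j(z_2)=[u_2-u_1]_{r-k}[u_2-u_1-1]_{r-k}E_j(z_2)E_j(z_1),$$ and $$\left[u_1-u_2+\tfrac s2\right]_{r-k}\left[u_1-u_2-\tfrac s2+1\right]_{r-k}E_1(z_1)E_2(z_2)=\left[u_2-u_1+\tfrac s2\right]_{r-k}\left[u_2-u_1-\tfrac s2+1\right]_{r-k}E_2(z_2)E_1(z_1).$$ (2) For $j=1,2$, $$[u_1-u_2]_{r}[u_1-u_2+1]_{r}F_j(z_1)F_j(z_2)=[u_2-u_1]_{r}[u_2-u_1+1]_{r}F_j(z_2)F_j(z_1),$$ and $$\left[u_1-u_2-\tfrac s2\right]_{r}\left[u_1-u_2+\tfrac s2-1\right]_{r}F_1(z_1)F_2(z_2)=\left[u_2-u_1-\tfrac s2\right]_{r}\left[u_2-u_1+\tfrac s2-1\right]_{r}F_2(z_2)F_1(z_1).$$ (3) For $j=1,2$, $$[E_j(z_1),F_j(z_2)]=\frac{x^{(-1)^{j}(s-2)}}{x-x^{-1}}\Big(:C_j(z_1)C_j^\dagger(z_2)\Psi_{j,I}(z_1)\Psi^\dagger_{j,I}(z_2):\,\delta\Big(\frac{x^kz_2}{z_1}\Big)-:C_j(z_1)C_j^\dagger(z_2)\Psi_{j,II}(z_1)\Psi^\dagger_{j,II}(z_2):\,\delta\Big(\frac{x^{-k}z_2}{z_1}\Big)\Big),$$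 where $\delta(z)=\sum_{n\in\mathbb Z}z^n$.
   Context: **Notation.** $[n]=\frac{x^n-x^{-n}}{x-x^{-1}}$, $[n]_+=x^n+x^{-n}$; $r^*=r-k$. Write $z=x^{2u}$. For $\rho\in\{r,r^*\}$, $[u]_\rho=x^{u^2/\rho-u}\,\Theta_{x^{2\rho}}(x^{2u})$, where $\Theta_p(z)=(z;p)_\infty(p/z;p)_\infty(p;p)_\infty$ and $(z;p)_\infty=\prod_{n\ge 0}(1-p^nz)$. Square roots are chosen so that $\sqrt{\tfrac{2r}{k(r-k)}}\sqrt{\tfrac{2(r-k)}{kr}}=\tfrac2k$. **Bosons** ($j=1,2$; $m,n\in\mathbb Z_{\ne0}$; commutators not listed and not implied by antisymmetry vanish): $$[\alpha_m^j,\alpha_n^j]=-\tfrac1m\tfrac{[2m][rm]}{[km][(r-k)m]}\delta_{m+n,0},\qquad [\widetilde\alpha_m^j,\widetilde\alpha_n^j]=-\tfrac1m\tfrac{[2m][(r-k)m]}{[km][rm]}\delta_{m+n,0},$$ $$[\alpha_m^1,\alpha_n^2]=\tfrac1m\Big(\tfrac{x^{(-r+k)m}([sm]-[(s-2)m])}{[(r-k)m]}+\tfrac{x^{km}([sm]+[(s-2)m])}{[km]}\Big)\delta_{m+n,0},$$ $$[\widetilde\alpha_m^1,\widetilde\alpha_n^2]=\tfrac1m\Big(\tfrac{x^{rm}(-[sm]+[(s-2)m])}{[rm]}+\tfrac{x^{km}([sm]+[(s-2)m])}{[km]}\Big)\delta_{m+n,0},$$ $$[\alpha_m^j,\widetilde\alpha_n^j]=-\tfrac1m\tfrac{[2m]}{[km]}\delta_{m+n,0},\qquad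 [\alpha_m^1,\widetilde\alpha_n^2]=[\widetilde\alpha_m^1,\alpha_n^2]=\tfrac1m\tfrac{[sm]+[(s-2)m]}{[km]}\delta_{m+n,0},$$ $$[\beta_m^j,\beta_n^j]=\tfrac{[2m][(k+2)m]}{m}\delta_{m+n,0},\qquad [\beta_m^1,\beta_n^2]=-\tfrac{[(k+2)m]([sm]+[(s-2)m])}{m}\delta_{m+n,0},$$ $$[\gamma_m^j,\gamma_n^j]=\tfrac1m\tfrac{[2m]}{[km]}\delta_{m+n,0},\qquad [\gamma_m^1,\gamma_n^2]=-\tfrac1m\tfrac{[sm]+[(s-2)m]}{[km]}\delta_{m+n,0}.$$ Zero modes: $[P_0,iQ_0]=1$, $[h,\alpha]=2$, $[h_0,\alpha_0]=[h_1,\alpha_2]=[h_2,\alpha_1]=2-s$, $[h_1,\alpha_1]=[h_2,\alpha_2]=0$; all other commutators among zero modes, and between zero modes and bosons, vanish. **Fock space.** For $K,L\in\mathbb Z$, $$\mathcal F_{K,L}=\bigoplus_{n,n_0,n_1,n_2\in\mathbb Z}\mathbb C[\alpha_{-m}^j,\widetilde\alpha_{-m}^j,\beta_{-m}^j,\gamma_{-m}^j\ (j=1,2;\ m\ge1)]\otimes|K,L\rangle_{n,n_0,n_1,n_2},$$ $$|K,L\rangle_{n,n_0,n_1,n_2}=e^{\left(L\sqrt{\frac{2r}{r-k}}-K\sqrt{\frac{2(r-k)}{r}}\right)iQ_0}\otimes e^{n\alpha}\otimes e^{n_0\alpha_0}\otimes e^{n_1\alpha_1}\otimes e^{n_2\alpha_2}.$$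 The operators below are regarded as acting on these Fock spaces. $:\ :$ denotes normal ordering (negative modes, $Q_0$, $\alpha$'s to the left; positive modes, $P_0$, $h$'s to the right). **Currents.** $$C_1(z)=e^{-\sqrt{\frac{2r}{k(r-k)}}iQ_0}e^{-\sqrt{\frac{2r}{k(r-k)}}P_0\log z}:e^{-\sum_{m\ne0}\alpha^1_mz^{-m}}:,\quad C_2(z)=e^{\sqrt{\frac{2r}{k(r-k)}}iQ_0}e^{\sqrt{\frac{2r}{k(r-k)}}P_0\log z}:e^{-\sum_{m\ne0}\alpha^2_mz^{-m}}:,$$ $$C_1^\dagger(z)=e^{\sqrt{\frac{2(r-k)}{kr}}iQ_0}e^{\sqrt{\frac{2(r-k)}{kr}}P_0\log z}:e^{\sum_{m\ne0}\widetilde\alpha^1_mz^{-m}}:,\quad C_2^\dagger(z)=e^{-\sqrt{\frac{2(r-k)}{kr}}iQ_0}e^{-\sqrt{\frac{2(r-k)}{kr}}P_0\log z}:e^{\sum_{m\ne0}\widetilde\alpha^2_mz^{-m}}:.$$ For $j=1,2$, with all sums over $m>0$ and $c_m=\frac{[(k+1)m]_+}{[m]_+}$: $$\widetilde\Psi_{j,I}(z)=e^{-(x-x^{-1})\sum\frac{x^{km/2}}{[m]_+}\beta^j_mz^{-m}}\,e^{-\sum x^{-km/2}\gamma^j_{-m}z^m}\,e^{-\sum x^{km/2}c_m\gamma^j_mz^{-m}},$$ $$\widetilde\Psi_{j,II}(z)=e^{(x-x^{-1})\sum\frac{x^{km/2}}{[m]_+}\beta^j_{-m}z^{m}}\,e^{-\sum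 x^{km/2}c_m\gamma^j_{-m}z^m}\,e^{-\sum x^{-km/2}\gamma^j_mz^{-m}},$$ $$\widetilde\Psi^\dagger_{j,I}(z)=e^{(x-x^{-1})\sum\frac{x^{-km/2}}{[m]_+}\beta^j_mz^{-m}}\,e^{\sum x^{km/2}\gamma^j_{-m}z^m}\,e^{\sum x^{-km/2}c_m\gamma^j_mz^{-m}},$$ $$\widetilde\Psi^\dagger_{j,II}(z)=e^{-(x-x^{-1})\sum\frac{x^{-km/2}}{[m]_+}\beta^j_{-m}z^{m}}\,e^{\sum x^{-km/2}c_m\gamma^j_{-m}z^m}\,e^{\sum x^{km/2}\gamma^j_mz^{-m}}.$$ Then $$\Psi_{1,I}=\widetilde\Psi_{1,I}e^{\alpha+\alpha_0+\alpha_1}x^{\frac h2+h_0+h_1}z^{-\frac hk},\quad \Psi_{1,II}=\widetilde\Psi_{1,II}e^{\alpha+\alpha_0+\alpha_1}x^{-\frac h2+h_0-h_1}z^{-\frac hk},$$ $$\Psi_{2,I}=\widetilde\Psi_{2,I}e^{-\alpha-\alpha_0+\alpha_2}x^{-\frac h2+h_0+h_2}z^{\frac hk},\quad \Psi_{2,II}=\widetilde\Psi_{2,II}e^{-\alpha-\alpha_0+\alpha_2}x^{\frac h2+h_0-h_2}z^{\frac hk},$$ $$\Psi^\dagger_{1,I}=\widetilde\Psi^\dagger_{1,I}e^{-\alpha-\alpha_0+\alpha_1}x^{\frac h2-h_0-h_1}z^{\frac hk},\quad \Psi^\dagger_{1,II}=\widetilde\Psi^\dagger_{1,II}e^{-\alpha-\alpha_0+\alpha_1}x^{-\frac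 h2-h_0+h_1}z^{\frac hk},$$ $$\Psi^\dagger_{2,I}=\widetilde\Psi^\dagger_{2,I}e^{\alpha+\alpha_0+\alpha_2}x^{-\frac h2-h_0-h_2}z^{-\frac hk},\quad \Psi^\dagger_{2,II}=\widetilde\Psi^\dagger_{2,II}e^{\alpha+\alpha_0+\alpha_2}x^{\frac h2-h_0+h_2}z^{-\frac hk}$$ (all at argument $z$), and $$E_j(z)=C_j(z)\tfrac{1}{x-x^{-1}}\big(\Psi_{j,I}(z)-\Psi_{j,II}(z)\big),\qquad F_j(z)=C_j^\dagger(z)\tfrac{-1}{x-x^{-1}}\big(\Psi^\dagger_{j,I}(z)-\Psi^\dagger_{j,II}(z)\big).$$ **Meaning of the relations.** In (1) and (2), products of currents are understood, as usual, as normally ordered operators times the meromorphic continuation of the scalar contraction functions. In (3), $E_j(z_1)F_j(z_2)$ and $F_j(z_2)E_j(z_1)$ are formal: their rational contraction functions are expanded in powers of $z_2/z_1$ and of $z_1/z_2$ respectively.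
   Formalization: In (3) the prefactor exponent is corrected to (-1)^{j-1}(s-2); the printed (-1)^j(s-2) fails, e.g. for x=1/2, r=2, r*=1, s=3. Also assumed, for well-definedness: |x^{2r}|<1, |x^{2r*}|<1 (theta products converge) and [km]≠0 for all m≥1. *)

(* Defs.v *)
From HB Require Import structures.
From mathcomp Require Import all_boot all_order all_algebra.
From mathcomp Require Import finmap monalg complex.
From mathcomp Require Import all_classical all_reals all_analysis.

Set Implicit Arguments.
Unset Strict Implicit.
Unset Printing Implicit Defensive.

Import Order.TTheory GRing.Theory Num.Theory.
Import numFieldNormedType.Exports.

Local Open Scope classical_set_scope.
Local Open Scope ring_scope.

Section ComplexAnalysis.
Variable R : realType.
Local Notation C := (complex R).

Definition cexp (z : C) : C :=
  Complex (expR (complex.Re z) * cos (complex.Im z))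
          (expR (complex.Re z) * sin (complex.Im z)).

(* [derivable] over the field [C^o] is complex differentiability. *)
Definition holomorphic_at (f : C -> C) (w : C) : Prop :=
  \forall y \near (w : C^o), derivable (f : C^o -> C^o) y 1.

Definition meromorphic (f : C -> C) : Prop :=
  forall w : C, exists (n : nat) (g : C -> C), holomorphic_at g w /\
    \forall y \near (w : C^o)^', f y = g y / (y - w) ^+ n.

(* [G] is the continuation to [C] of exp (\sum_(m > 0) c m * w ^+ m), given
   near w = 0.  Such a [G] is unique away from its (discrete) exceptional
   points, by the identity theorem. *)
Definition exp_continuation (c : nat -> C) (G : C -> C) : Prop :=
  meromorphic G /\
  \forall w \near (0 : C^o), exists S : C,
    (series (fun n => c n.+1 * w ^+ n.+1 : C^o) @ \oo --> (S : C^o)) /\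
    G w = cexp S.

Definition qpoch (z p : C) : C :=
  lim ((fun n => \prod_(i < n) (1 - p ^+ i * z) : C^o) @ \oo).

Definition Theta (p z : C) : C := qpoch z p * qpoch (p / z) p * qpoch p p.

End ComplexAnalysis.

Variant node := N1 | N2.
Variant branch := CI | CII.
Variant kind := Kalpha | Ktalpha | Kbeta | Kgamma.

Definition node_to_bool j := if j is N1 then true else false.
Definition node_of_bool (b : bool) := if b then N1 else N2.
Lemma node_to_boolK : cancel node_to_bool node_of_bool. Proof. by case. Qed.
HB.instance Definition _ := Finite.copy node (can_type node_to_boolK).

Definition node_nat (j : node) : nat := if j is N1 then 1%N else 2%N.

Definition branch_to_bool j := if j is CI then true else false.
Definition branch_of_bool (b : bool) := if b then CI else CII.
Lemma branch_to_boolK : cancel branch_to_bool branch_of_bool. Proof. by case. Qed.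
HB.instance Definition _ := Finite.copy branch (can_type branch_to_boolK).

Definition kind_to_bool2 a :=
  match a with
  | Kalpha => (true, true) | Ktalpha => (true, false)
  | Kbeta => (false, true) | Kgamma => (false, false)
  end.
Definition kind_of_bool2 (b : bool * bool) :=
  match b with
  | (true, true) => Kalpha | (true, false) => Ktalpha
  | (false, true) => Kbeta | (false, false) => Kgamma
  end.
Lemma kind_to_bool2K : cancel kind_to_bool2 kind_of_bool2. Proof. by case. Qed.
HB.instance Definition _ := Finite.copy kind (can_type kind_to_bool2K).

(* The variable [(a, n)] stands for the creation mode a_{-(n+1)}. *)
Definition boson := (kind * node)%type.
Definition bvar := (boson * nat)%type.
Definition bmono := {cmonom bvar}.

(* [logx] is a logarithm of x: it fixes the complex powers x^a.
   The square roots are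
     sqE = sqrt (2r / (k r^* )),  sqF = sqrt (2r^* / (k r)),
     sqL = sqrt (2r / r^* ),      sqK = sqrt (2r^* / r). *)
Record params (R : realType) := Params {
  logx : complex R;
  pr : complex R;
  prs : complex R;
  ps : complex R;
  sqE : complex R;
  sqF : complex R;
  sqL : complex R;
  sqK : complex R }.

Section Currents.
Variables (R : realType) (P : params R).
Local Notation C := (complex R).
Local Notation r := (pr P).
Local Notation rs := (prs P).
Local Notation s := (ps P).

Definition pk : C := r - rs.
Local Notation k := pk.

Definition xpow (a : C) : C := cexp (a * logx P).
Definition xx : C := xpow 1.
Definition qint (a : C) : C := (xpow a - xpow (- a)) / (xx - xx^-1).
Definition qplus (a : C) : C := xpow a + xpow (- a).

Definition bracket (rho u : C) : C :=
  xpow (u ^+ 2 / rho - u) * Theta (xpow (2 * rho)) (xpow (2 * u)).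

(* [bcomm a b m] is the scalar c with [a_m, b_n] = c delta_{m+n,0}.  Where the
   kinds or the nodes are swapped with respect to the given commutators, it is
   obtained by antisymmetry, [b_m, a_{-m}] = - [a_{-m}, b_m]; for all of them
   but f_alpha and f_talpha the given scalar is an odd function of m. *)
Definition f_alpha (m : C) : C :=
  m^-1 * (xpow ((- r + k) * m) * (qint (s * m) - qint ((s - 2) * m))
            / qint ((r - k) * m)
          + xpow (k * m) * (qint (s * m) + qint ((s - 2) * m)) / qint (k * m)).

Definition f_talpha (m : C) : C :=
  m^-1 * (xpow (r * m) * (- qint (s * m) + qint ((s - 2) * m)) / qint (r * m)
          + xpow (k * m) * (qint (s * m) + qint ((s - 2) * m)) / qint (k * m)).

Definition bcomm (a b : boson) (n : int) : C :=
  let m : C := n%:~R in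
  match a, b with
  | (Kalpha, i), (Kalpha, j) =>
    match i, j with
    | N1, N2 => f_alpha m
    | N2, N1 => - f_alpha (- m)
    | _, _ => - m^-1 * (qint (2 * m) * qint (r * m)
                        / (qint (k * m) * qint ((r - k) * m)))
    end
  | (Ktalpha, i), (Ktalpha, j) =>
    match i, j with
    | N1, N2 => f_talpha m
    | N2, N1 => - f_talpha (- m)
    | _, _ => - m^-1 * (qint (2 * m) * qint ((r - k) * m)
                        / (qint (k * m) * qint (r * m)))
    end
  | (Kalpha, i), (Ktalpha, j) | (Ktalpha, i), (Kalpha, j) =>
    if i == j then - m^-1 * (qint (2 * m) / qint (k * m))
    else m^-1 * ((qint (s * m) + qint ((s - 2) * m)) / qint (k * m))
  | (Kbeta, i), (Kbeta, j) =>
    if i == j then qint (2 * m) * qint ((k + 2) * m) / m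
    else - (qint ((k + 2) * m) * (qint (s * m) + qint ((s - 2) * m)) / m)
  | (Kgamma, i), (Kgamma, j) =>
    if i == j then m^-1 * (qint (2 * m) / qint (k * m))
    else - m^-1 * ((qint (s * m) + qint ((s - 2) * m)) / qint (k * m))
  | _, _ => 0
  end.

Definition bfock := {malg C[bmono]}.

Definition bderiv (i : bvar) (p : bfock) : bfock :=
  \sum_(mu <- msupp p) << mcoeff mu p * (mu i)%:R *g divcm mu (ucm i) >>.

(* Creation modes multiply, annihilation modes act as derivations; the index 0
   is not a mode.  Recall that [Negz n] is -(n+1). *)
Definition bosc (a : boson) (m : int) (p : bfock) : bfock :=
  match m with
  | Negz n => << ucm (a, n) >> * p
  | Posz n.+1 => \sum_b bcomm a b n.+1 *: bderiv (b, n) p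
  | Posz 0 => 0
  end.

(* A charge (l, (n, n_0, n_1, n_2)) labels the vector
   e^{l iQ_0} e^{n alpha} e^{n_0 alpha_0} e^{n_1 alpha_1} e^{n_2 alpha_2}. *)
Definition qcharge := (C * (int * int * int * int))%type.

Definition mkqcharge (l : C) (n n0 n1 n2 : int) : qcharge := (l, (n, n0, n1, n2)).

Definition zP0 (q : qcharge) : C := q.1.
Definition zh (q : qcharge) : C := 2 * q.2.1.1.1%:~R.
Definition zh0 (q : qcharge) : C := (2 - s) * q.2.1.1.2%:~R.
Definition zh1 (q : qcharge) : C := (2 - s) * q.2.2%:~R.
Definition zh2 (q : qcharge) : C := (2 - s) * q.2.1.2%:~R.

(* The components of a vector along the charges.  The momentum l ranges over
   all complex numbers since, unless k = 1, the currents do not map an F_{K,L}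
   into another one. *)
Definition fock := qcharge -> bfock.

Definition Fock (K L : int) : set fock :=
  [set v | finite_set [set q | v q != 0] /\
           forall q, v q != 0 -> q.1 = L%:~R * sqL P - K%:~R * sqK P].

(* The normally ordered operator
     :exp(\sum_(m > 0, a) vneg a m a_{-m} z^m)
      exp(\sum_(m > 0, a) vpos a m a_m z^{-m}): e^{vshift} x^{vx} z^{vz}
   where vx and vz are linear combinations of P_0, h, h_0, h_1, h_2, given by
   their eigenvalues. *)
Record vop := Vop {
  vshift : qcharge;
  vx : qcharge -> C;
  vz : qcharge -> C;
  vneg : boson -> nat -> C;
  vpos : boson -> nat -> C }.

(* Normally ordered product at the same point.  It is the operator product
   wherever it is used below, as the two factors commute. *)
Definition vmul (V W : vop) : vop := {|
  vshift := vshift V + vshift W;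
  vx := fun q => vx V q + vx W q;
  vz := fun q => vz V q + vz W q;
  vneg := fun a m => vneg V a m + vneg W a m;
  vpos := fun a m => vpos V a m + vpos W a m |}.

Definition zero_part (sh : qcharge) (ex ez : qcharge -> C) : vop :=
  Vop sh ex ez (fun _ _ => 0) (fun _ _ => 0).

Definition osc_part (cneg cpos : boson -> nat -> C) : vop :=
  Vop 0 (fun=> 0) (fun=> 0) cneg cpos.

Definition at_ (a b : boson) (c : C) : C := if b == a then c else 0.

Definition opC (j : node) : vop :=
  let e := if j is N1 then - sqE P else sqE P in
  let c b m := at_ (Kalpha, j) b (- 1) in
  vmul (zero_part (mkqcharge e 0 0 0 0) (fun=> 0) (fun q => e * zP0 q))
       (osc_part c c).

Definition opCd (j : node) : vop :=
  let e := if j is N1 then sqF P else - sqF P in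
  let c b m := at_ (Ktalpha, j) b 1 in
  vmul (zero_part (mkqcharge e 0 0 0 0) (fun=> 0) (fun q => e * zP0 q))
       (osc_part c c).

Definition cfac (m : C) : C := qplus ((k + 1) * m) / qplus m.

Definition tPsi (j : node) (c : branch) : vop :=
  let be := at_ (Kbeta, j) in
  let ga := at_ (Kgamma, j) in
  match c with
  | CI => osc_part
      (fun b n => let m : C := n%:R in ga b (- xpow (- (k * m / 2))))
      (fun b n => let m : C := n%:R in
         be b (- ((xx - xx^-1) * (xpow (k * m / 2) / qplus m)))
         + ga b (- (xpow (k * m / 2) * cfac m)))
  | CII => osc_part
      (fun b n => let m : C := n%:R in
         be b ((xx - xx^-1) * (xpow (k * m / 2) / qplus m))
         + ga b (- (xpow (k * m / 2) * cfac m)))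
      (fun b n => let m : C := n%:R in ga b (- xpow (- (k * m / 2))))
  end.

Definition tPsid (j : node) (c : branch) : vop :=
  let be := at_ (Kbeta, j) in
  let ga := at_ (Kgamma, j) in
  match c with
  | CI => osc_part
      (fun b n => let m : C := n%:R in ga b (xpow (k * m / 2)))
      (fun b n => let m : C := n%:R in
         be b ((xx - xx^-1) * (xpow (- (k * m / 2)) / qplus m))
         + ga b (xpow (- (k * m / 2)) * cfac m))
  | CII => osc_part
      (fun b n => let m : C := n%:R in
         be b (- ((xx - xx^-1) * (xpow (- (k * m / 2)) / qplus m)))
         + ga b (xpow (- (k * m / 2)) * cfac m))
      (fun b n => let m : C := n%:R in ga b (xpow (k * m / 2)))
  end.

Definition Psi (j : node) (c : branch) : vop :=
  vmul (tPsi j c)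
  match j, c with
  | N1, CI => zero_part (mkqcharge 0 1 1 1 0)
      (fun q => zh q / 2 + zh0 q + zh1 q) (fun q => - (zh q / k))
  | N1, CII => zero_part (mkqcharge 0 1 1 1 0)
      (fun q => - (zh q / 2) + zh0 q - zh1 q) (fun q => - (zh q / k))
  | N2, CI => zero_part (mkqcharge 0 (- 1) (- 1) 0 1)
      (fun q => - (zh q / 2) + zh0 q + zh2 q) (fun q => zh q / k)
  | N2, CII => zero_part (mkqcharge 0 (- 1) (- 1) 0 1)
      (fun q => zh q / 2 + zh0 q - zh2 q) (fun q => zh q / k)
  end.

Definition Psid (j : node) (c : branch) : vop :=
  vmul (tPsid j c)
  match j, c with
  | N1, CI => zero_part (mkqcharge 0 (- 1) (- 1) 1 0)
      (fun q => zh q / 2 - zh0 q - zh1 q) (fun q => zh q / k)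
  | N1, CII => zero_part (mkqcharge 0 (- 1) (- 1) 1 0)
      (fun q => - (zh q / 2) - zh0 q + zh1 q) (fun q => zh q / k)
  | N2, CI => zero_part (mkqcharge 0 1 1 0 1)
      (fun q => - (zh q / 2) - zh0 q - zh2 q) (fun q => - (zh q / k))
  | N2, CII => zero_part (mkqcharge 0 1 1 0 1)
      (fun q => zh q / 2 - zh0 q + zh2 q) (fun q => - (zh q / k))
  end.

Definition EV (j : node) (c : branch) : vop := vmul (opC j) (Psi j c).

Definition FV (j : node) (c : branch) : vop := vmul (opCd j) (Psid j c).

(* A current is a combination of two normally ordered operators. *)
Definition current := branch -> C * vop.

Definition curE (j : node) : current := fun c =>
  ((if c is CI then 1 else - 1) / (xx - xx^-1), EV j c).

Definition curF (j : node) : current := fun c =>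
  ((if c is CI then - 1 else 1) / (xx - xx^-1), FV j c).

(* [fexp A n] is the coefficient of t^n in exp (\sum_(m > 0) A m t^m). *)
Fixpoint fpow (A : nat -> bfock -> bfock) (j n : nat) (p : bfock) : bfock :=
  match j with
  | 0 => if n == 0 then p else 0
  | j'.+1 => \sum_(1 <= m < n.+1) A m (fpow A j' (n - m) p)
  end.

Definition fexp (A : nat -> bfock -> bfock) (n : nat) (p : bfock) : bfock :=
  \sum_(0 <= j < n.+1) (j`!%:R)^-1 *: fpow A j n p.

Definition creat (V : vop) : nat -> bfock -> bfock :=
  fexp (fun m p => \sum_a vneg V a m *: bosc a (- m%:Z) p).

Definition annih (V : vop) : nat -> bfock -> bfock :=
  fexp (fun m p => \sum_a vpos V a m *: bosc a m%:Z p).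

(* Coefficient of z^e in V(z); e is complex as V(z) contains z^{vz}.  All the
   sums [\sum_(_ \in _)] below have finite support. *)
Definition vcoef (V : vop) (e : C) (v : fock) : fock := fun q =>
  let q0 := q - vshift V in
  xpow (vx V q0) *:
  \sum_(t \in [set t : nat * nat | vz V q0 + t.1%:R - t.2%:R = e])
     creat V t.1 (annih V t.2 (v q0)).

Definition ccoef (X : current) (e : C) (v : fock) : fock := fun q =>
  \sum_c (X c).1 *: vcoef (X c).2 e v q.

(* Coefficient of z_1^e_1 z_2^e_2 in :V(z_1)W(z_2): *)
Definition ncoef (V W : vop) (e1 e2 : C) (v : fock) : fock := fun q =>
  let q0 := q - (vshift V + vshift W) in
  xpow (vx V q0 + vx W q0) *:
  \sum_(t \in [set t : (nat * nat) * (nat * nat) |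
                 vz V q0 + t.1.1%:R - t.1.2%:R = e1 /\
                 vz W q0 + t.2.1%:R - t.2.2%:R = e2])
     creat V t.1.1 (creat W t.2.1 (annih V t.1.2 (annih W t.2.2 (v q0)))).

(* :C_j(z_1) C_j^dagger(z_2) Psi_{j,c}(z_1) Psi_{j,c}^dagger(z_2): *)
Definition normEF (j : node) (c : branch) : C -> C -> fock -> fock :=
  ncoef (EV j c) (FV j c).

(* Formal commutator [X(z_1), Y(z_2)]; composing the coefficients amounts to
   expanding the contraction functions in powers of z_2 / z_1 in X(z_1) Y(z_2)
   and in powers of z_1 / z_2 in Y(z_2) X(z_1). *)
Definition fcommutator (X Y : current) (e1 e2 : C) (v : fock) : fock := fun q =>
  ccoef X e1 (ccoef Y e2 v) q - ccoef Y e2 (ccoef X e1 v) q.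

(* Coefficient of z_1^e_1 z_2^e_2 in X(z_1, z_2) delta(a z_2 / z_1). *)
Definition delta_mul (a : C) (X : C -> C -> fock -> fock)
    (e1 e2 : C) (v : fock) : fock := fun q =>
  \sum_(n \in [set: int]) (a ^ n) *: X (e1 + n%:~R) (e2 - n%:~R) v q.

(* The value of X(z_1, z_2) v at z_i = x^{2 u_i}, as an element of the
   completed Fock space, given by its coordinates. *)
Definition eval2 (X : C -> C -> fock -> fock) (u1 u2 : C) (v : fock)
    (q : qcharge) (mu : bmono) : C :=
  \sum_(e \in [set: C * C])
     xpow (2 * u1 * e.1 + 2 * u2 * e.2) * mcoeff mu (X e.1 e.2 v q).

(* The contraction of V(z_1) W(z_2) is
     zcontr V W u1 * exp (\sum_(m > 0) contr V W m (z_2 / z_1)^m),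
   the factors coming respectively from the zero modes and from the bosons. *)
Definition zcontr (V W : vop) (u1 : C) : C :=
  xpow (vx V (vshift W)) * xpow (2 * u1 * vz V (vshift W)).

Definition contr (V W : vop) (m : nat) : C :=
  \sum_a \sum_b vpos V a m * vneg W b m * bcomm a b m%:Z.

Definition contr_continuation (X Y : current) (G : branch -> branch -> C -> C) :=
  forall c d, exp_continuation (contr (X c).2 (Y d).2) (G c d).

(* X(z_1) Y(z_2) v, with z_i = x^{2 u_i}, for given continuations G of the
   contractions. *)
Definition cprod (X Y : current) (G : branch -> branch -> C -> C) (u1 u2 : C)
    (v : fock) (q : qcharge) (mu : bmono) : C :=
  \sum_c \sum_d (X c).1 * (Y d).1
     * (zcontr (X c).2 (Y d).2 u1 * G c d (xpow (2 * (u2 - u1))))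
     * eval2 (ncoef (X c).2 (Y d).2) u1 u2 v q mu.

(* t(u_1 - u_2) X(z_1) Y(z_2) = t(u_2 - u_1) Y(z_2) X(z_1) on the spaces
   F_{K,L}, as an equality of meromorphic functions of u_1, u_2, that is, at
   all the points where the contractions are holomorphic. *)
Definition exchange (t : C -> C) (X Y : current) : Prop :=
  exists G G' : branch -> branch -> C -> C,
  [/\ contr_continuation X Y G, contr_continuation Y X G' &
   forall (K L : int) (v : fock), Fock K L v ->
   forall u1 u2 : C,
   (forall c d, holomorphic_at (G c d) (xpow (2 * (u2 - u1)))) ->
   (forall c d, holomorphic_at (G' c d) (xpow (2 * (u1 - u2)))) ->
   forall (q : qcharge) (mu : bmono),
     t (u1 - u2) * cprod X Y G u1 u2 v q mu =
     t (u2 - u1) * cprod Y X G' u2 u1 v q mu].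

End Currents.

(* Main.v *)
(* Write w = z_2 / z_1.  For E E and F F the bosonic contraction exponent is that of
     (a w; p)_oo (b w; p)_oo / ((p w / a; p)_oo (p w / b; p)_oo),   p = x^{2 r^*} or x^{2 r},
   up to finitely many terms e^m / m, so the contraction is this quotient times a
   rational function of w.  The two brackets multiply it to a function that is
   symmetric under w -> 1 / w, up to a power of w which the zero modes absorb, and
   the exchange relations become identities of rational functions, one for each
   pair of branches.  For E F the exponent vanishes if the branches differ, and is
   ((x^k)^m - (x^{k+2})^m) / m or ((x^{-k})^m - (x^{-k-2})^m) / m if both are I or
   both are II: the contraction is 1 or has a single simple pole, and the difference
   of its expansions in w and in 1 / w is a delta function at that pole. *)
Require Import Defs.
From mathcomp Require Import all_boot all_order all_algebra.
From mathcomp Require Import finmap monalg complex ring lra zify.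
From mathcomp Require Import all_classical all_reals all_analysis.

Set Implicit Arguments.
Unset Strict Implicit.
Unset Printing Implicit Defensive.

Import Order.TTheory GRing.Theory Num.Theory.
Import numFieldNormedType.Exports.

Local Open Scope classical_set_scope.
Local Open Scope ring_scope.

(** * Complex power series *)

(** The continuations have to be exhibited, which calls for two descriptions of (w; p)_oo: Euler's
    power series shows that it is entire, a logarithmic series that near 0 it is the exponential
    required of a contraction. Both solve F(w) = (1 - w) F(p w) with F -> 1 along p^n w, and this
    forces them to agree with the defining limit.

    The operators are given only by their coefficients. An exponential of commuting modes is handled
    through its logarithmic derivative, k E_k = sum_m m A_m E_(k - m); in characteristic 0 this
    recursion determines all E_k, and commuting two exponentials becomes an induction on k.

    The coefficient c_m is tuned: c_m^2 - (x - x^-1)^2 [km] [(k+2)m] / [m]_+^2 = 1. As the beta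
    commutators are [km] [(k+2)m] times the gamma ones, every contraction is an alpha commutator
    plus a multiple of a gamma commutator. That multiple is, up to sign and a power of x^(km),
    either c_m or 1; for E F and different branches it is -1, which cancels the alphas. *)

Lemma is_derive_quadratic (K : numFieldType) (V : normedModType K)
    (f : K^o -> V) (x : K^o) (d : V) (M e : K) :
  0 <= M -> 0 < e ->
  (forall h : K, `|h| < e -> `|f (h + x) - f x - h *: d| <= M * `|h| ^+ 2) ->
  is_derive x 1 f d.
Proof.
move=> M0 e0 fM.
suff H : h^-1 *: (f (h *: 1 + x) - f x) @[h --> (0 : K^o)^'] --> d.
  by apply: DeriveDef; [apply: cvgP H | apply: cvg_lim H].
apply/cvgrPdist_lt => eps eps0.
have M1 : 0 < M + 1 by rewrite ltr_wpDl.
near=> h.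
have h0 : h != 0 by near: h; exact: nbhs_dnbhs_neq.
have he : `|h| < e.
  near: h; apply: nbhs_dnbhs.
  by apply/nbhs_ballP; exists e => //= y; rewrite /ball /= sub0r normrN.
have hM : `|h| < eps / (M + 1).
  near: h; apply: nbhs_dnbhs; apply/nbhs_ballP.
  by exists (eps / (M + 1)) => /=; [rewrite divr_gt0 | move=> y; rewrite /ball /= sub0r normrN].
have := fM h he.
have -> : h *: 1 = h by rewrite /GRing.scale /= mulr1.
have -> : f (h + x) - f x - h *: d = - (h *: (d - h^-1 *: (f (h + x) - f x))).
  by rewrite scalerBr scalerA mulfV// scale1r opprB.
rewrite normrN normrZ expr2 mulrCA.
rewrite ler_pM2l ?normr_gt0// => /le_lt_trans; apply.
rewrite ltr_pdivlMr // in hM.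
by apply: le_lt_trans hM; rewrite mulrC ler_wpM2l// lerDl.
Unshelve. all: by end_near.
Qed.

Section ComplexNorm.
Variable R : realType.
Local Notation C := (complex R).
Implicit Types (z w : C) (u v : nat -> C).

Local Notation Re := complex.Re.
Local Notation Im := complex.Im.
Local Notation normc := ComplexField.Normc.normc.

Lemma normr_normc z : `|z| = (normc z)%:C%C. Proof. by []. Qed.

Lemma normc_ge0 z : 0 <= normc z. Proof. by case: z => a b; exact: sqrtr_ge0. Qed.

Lemma normr_Re_le z : `|Re z| <= normc z.
Proof.
case: z => a b /=; rewrite -sqrtr_sqr ler_sqrt ?addr_ge0 ?sqr_ge0//.
by rewrite lerDl sqr_ge0.
Qed.

Lemma normr_Im_le z : `|Im z| <= normc z.
Proof.
case: z => a b /=; rewrite -sqrtr_sqr ler_sqrt ?addr_ge0 ?sqr_ge0//.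
by rewrite lerDr sqr_ge0.
Qed.

Lemma normc_le_ReIm z : normc z <= `|Re z| + `|Im z|.
Proof.
case: z => a b /=; rewrite -[leRHS]ger0_norm ?addr_ge0// -sqrtr_sqr.
rewrite ler_sqrt ?sqr_ge0// sqrrD !real_normK ?num_real//.
by rewrite -addrA lerD2l lerDr mulrn_wge0// mulr_ge0.
Qed.

Lemma ReD z w : Re (z + w) = Re z + Re w. Proof. by case: z w => ? ? []. Qed.
Lemma ImD z w : Im (z + w) = Im z + Im w. Proof. by case: z w => ? ? []. Qed.
Lemma ReB z w : Re (z - w) = Re z - Re w. Proof. by case: z w => ? ? []. Qed.
Lemma ImB z w : Im (z - w) = Im z - Im w. Proof. by case: z w => ? ? []. Qed.

Lemma cvg_complex (F : set_system nat) (FF : Filter F) u z :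
  (fun n => Re (u n)) @ F --> Re z -> (fun n => Im (u n)) @ F --> Im z ->
  (u : nat -> C^o) @ F --> (z : C^o).
Proof.
move=> ur ui; apply/cvgrPdist_lt => -[e e'] /= ; rewrite ltcE /= => /andP[/eqP e'0 e0].
near=> n.
rewrite normr_normc ltcE /= e'0 eqxx /=.
apply: le_lt_trans (normc_le_ReIm _) _.
rewrite (splitr e) ltrD//.
  rewrite ReB.
  by near: n; move/cvgrPdist_lt: ur; apply; rewrite divr_gt0.
by rewrite ImB; near: n; move/cvgrPdist_lt: ui; apply; rewrite divr_gt0.
Unshelve. all: by end_near.
Qed.

Lemma Re_sum (I : Type) (s : seq I) (P : pred I) (F : I -> C) :
  Re (\sum_(i <- s | P i) F i) = \sum_(i <- s | P i) Re (F i).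
Proof. by elim/big_rec2: _ => // i x y _ <-; rewrite ReD. Qed.

Lemma Im_sum (I : Type) (s : seq I) (P : pred I) (F : I -> C) :
  Im (\sum_(i <- s | P i) F i) = \sum_(i <- s | P i) Im (F i).
Proof. by elim/big_rec2: _ => // i x y _ <-; rewrite ImD. Qed.

(** The norm [|z|] of a complex number is itself an element of C; [normc] is its real value, so that
    absolute summability can use the comparison tests for real series. *)
Definition csummable u := cvgn (series (fun n => normc (u n))).

Definition csum u : C :=
  Complex (limn (series (fun n => Re (u n)))) (limn (series (fun n => Im (u n)))).

Lemma csummable_le u (v : nat -> R) :
  (forall n, normc (u n) <= v n) -> cvgn (series v) -> csummable u.
Proof.
move=> uv; apply: series_le_cvg (uv) => n; first exact: normc_ge0.
exact: le_trans (normc_ge0 _) (uv n).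
Qed.

Lemma csum_cvg u : csummable u -> (series u : nat -> C^o) @ \oo --> (csum u : C^o).
Proof.
move=> su; apply: cvg_complex => /=.
  have -> : (fun n => Re (series u n)) = series (fun n => Re (u n)).
    by apply/funext => n; rewrite /series /= Re_sum.
  apply: normed_cvg; apply: series_le_cvg su => n /=; rewrite ?normr_Re_le//.
  exact: normc_ge0.
have -> : (fun n => Im (series u n)) = series (fun n => Im (u n)).
  by apply/funext => n; rewrite /series /= Im_sum.
apply: normed_cvg; apply: series_le_cvg su => n /=; rewrite ?normr_Im_le//.
exact: normc_ge0.
Qed.

Lemma csumE u z : (series u : nat -> C^o) @ \oo --> (z : C^o) -> csummable u -> csum u = z.
Proof.
by move=> uz /csum_cvg uc; apply: cvg_unique uc uz; exact: norm_hausdorff.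
Qed.

Lemma csummableD u v : csummable u -> csummable v -> csummable (fun n => u n + v n).
Proof.
move=> su sv; apply: (@csummable_le _ (fun n => normc (u n) + normc (v n))).
  by move=> n; exact: le_normcD.
exact: is_cvg_seriesD.
Qed.
End ComplexNorm.

Section PowerSeries.
Variable R : realType.
Local Notation C := (complex R).
Implicit Types (z w h : C) (u v c : nat -> C).

Local Notation Re := complex.Re.
Local Notation Im := complex.Im.
Local Notation normc := ComplexField.Normc.normc.
Import ComplexField.Normc.

Local Arguments normc : simpl never.
Local Arguments csum : simpl never.

Lemma normcX z n : normc (z ^+ n) = normc z ^+ n.
Proof. by elim: n => [|n IH]; rewrite ?normc1// !exprS normcM IH. Qed.

Lemma normc_nat n : normc (n%:R : C) = n%:R.
Proof. by rewrite normcMn normc1. Qed.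

Lemma cvg_normc u z : (u : nat -> C^o) @ \oo --> (z : C^o) ->
  forall e : R, 0 < e -> \forall n \near \oo, normc (z - u n) < e.
Proof.
move=> /cvgrPdist_lt uz e e0.
have := uz e%:C%C; rewrite ltcR => /(_ e0); apply: filterS => n.
by rewrite normr_normc ltcR.
Qed.

Lemma csum_norm_le u (v : nat -> R) :
  (forall n, normc (u n) <= v n) -> cvgn (series v) ->
  normc (csum u) <= limn (series v).
Proof.
move=> uv cv; have su := csummable_le uv cv.
have v0 n : 0 <= v n := le_trans (normc_ge0 _) (uv n).
apply/ler_addgt0Pr => e e0.
have [n _ /(_ n (leqnn _)) /= un] := cvg_normc (csum_cvg su) e0.
have -> : csum u = csum u - series u n + series u n by rewrite subrK.
apply: le_trans (le_normcD _ _) _.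
rewrite addrC; apply: lerD _ (ltW un); apply: (@le_trans _ _ (series v n)).
  rewrite /series /=; elim/big_ind2: _ => //; first by rewrite normc0.
  by move=> ? ? ? ? ? ?; apply: le_trans (le_normcD _ _) _; exact: lerD.
apply: nondecreasing_cvgn_le => //; apply/nondecreasing_seqP => k.
by rewrite /series /= big_nat_recr//= lerDl.
Qed.

Lemma csumD u v : csummable u -> csummable v ->
  csum (fun n => u n + v n) = csum u + csum v.
Proof.
move=> su sv; apply: csumE; last exact: csummableD.
have -> : series (fun n => u n + v n) = (fun n => series u n + series v n).
  by apply/funext => n; rewrite /series /= big_split.
by apply: cvgD; exact: csum_cvg.
Qed.

Lemma csummableZ (a : C) u : csummable u -> csummable (fun n => a * u n).
Proof.
move=> su; apply: (@csummable_le _ _ (fun n => normc a * normc (u n))).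
  by move=> n; rewrite normcM.
have -> : series (fun n => normc a * normc (u n)) =
    (fun n => normc a * series (fun n => normc (u n)) n).
  by apply/funext => n; rewrite /series /= mulr_sumr.
by apply: is_cvgM => //; exact: is_cvg_cst.
Qed.

Lemma csumZ (a : C) u : csummable u -> csum (fun n => a * u n) = a * csum u.
Proof.
move=> su; apply: csumE; last exact: csummableZ.
have -> : series (fun n => a * u n) = (fun n => a * series u n).
  by apply/funext => n; rewrite /series /= mulr_sumr.
apply: (@cvgM C nat \oo _ (fun=> a) (series u)); first exact: cvg_cst.
exact: csum_cvg.
Qed.

Lemma csummableB u v : csummable u -> csummable v -> csummable (fun n => u n - v n).
Proof.
move=> su sv; have := csummableD su (@csummableZ (-1) v sv).
by congr csummable; apply/funext => n; rewrite mulN1r.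
Qed.

Lemma csumB u v : csummable u -> csummable v ->
  csum (fun n => u n - v n) = csum u - csum v.
Proof.
move=> su sv; rewrite -mulN1r -csumZ// -csumD//; last exact: csummableZ.
by congr csum; apply/funext => n; rewrite mulN1r.
Qed.

Lemma csummableS u : csummable u -> csummable (fun n => u n.+1).
Proof.
rewrite /csummable => su.
have -> : series (fun n => normc (u n.+1)) = (fun n => series (fun n => normc (u n)) n.+1 - normc (u 0%N)).
  by apply/funext => n; rewrite /series /= big_nat_recl//= addrAC subrr add0r.
apply: is_cvgB; last exact: is_cvg_cst.
by have := su; rewrite -cvg_shiftS => /cvgP.
Qed.

Lemma csum_recl u : csummable u -> csum u = u 0%N + csum (fun n => u n.+1).
Proof.
move=> su; apply: csumE => //.
rewrite -cvg_shiftS /=.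
have -> : (fun n => series u n.+1) = (fun n => u 0%N + series (fun n => u n.+1) n).
  by apply/funext => n; rewrite /series /= big_nat_recl.
apply: cvgD; first exact: cvg_cst.
exact: csum_cvg (csummableS su).
Qed.

(** Abel's condition: bounded terms at radius t give absolute convergence for |w| < t, and the
    condition survives multiplication of [c n] by n at the cost of a smaller radius. *)
Definition pbound c (t : R) := exists K : R, forall n, normc (c n) * t ^+ n <= K.

Definition pser c w := csum (fun n => c n * w ^+ n).

Definition dpser c n : C := n.+1%:R * c n.+1.

Lemma pbound_csummable c t w : pbound c t -> normc w < t ->
  csummable (fun n => c n * w ^+ n).
Proof.
move=> [K cK] wt; have t0 : 0 < t := le_lt_trans (normc_ge0 w) wt.
apply: (@csummable_le _ _ (geometric K (normc w / t))) => [n|]; last first.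
  apply: is_cvg_geometric_series.
  by rewrite ger0_norm ?divr_ge0 ?normc_ge0 ?ltW// ltr_pdivrMr// mul1r.
rewrite /= normcM normcX expr_div_n mulrA -mulrAC ler_wpM2r//.
  by rewrite exprn_ge0// normc_ge0.
by rewrite ler_pdivlMr ?exprn_gt0.
Qed.

(** Since 1 - q^n is 1 - q times the sum of the q^i with i < n, and each such q^i is at least q^n,
    one has (1 - q) n q^n <= 1 - q^n <= 1. *)
Lemma natr_expr_le (q : R) n : 0 <= q -> q < 1 -> n%:R * q ^+ n <= (1 - q)^-1.
Proof.
move=> q0 q1; have q1' : 0 < 1 - q by rewrite subr_gt0.
rewrite -[leRHS]mul1r ler_pdivlMr// mulrC.
apply: (@le_trans _ _ (1 - q ^+ n)); last by rewrite gerBl exprn_ge0.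
elim: n => [|n IH]; first by rewrite mul0r mulr0 expr0 subrr.
have qn1 : q ^+ n.+1 <= 1 by rewrite exprn_ile1// ltW.
apply: (@le_trans _ _ (q * (1 - q ^+ n) + q ^+ n.+1 * (1 - q))).
  have -> : (1 - q) * (n.+1%:R * q ^+ n.+1) =
      q * ((1 - q) * (n%:R * q ^+ n)) + q ^+ n.+1 * (1 - q).
    by rewrite -natr1 exprS; ring.
  by rewrite lerD2r ler_wpM2l.
have : 0 <= (1 - q) * (1 - q ^+ n.+1) by rewrite mulr_ge0// subr_ge0// ltW.
rewrite !exprS; nra.
Qed.

Lemma pbound_natM c t t' : 0 <= t' -> t' < t -> pbound c t ->
  pbound (fun n => n%:R * c n) t'.
Proof.
move=> t'0 t't [K cK]; have t0 : 0 < t := le_lt_trans t'0 t't.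
exists ((1 - t' / t)^-1 * K) => n.
have K0 : 0 <= K by apply: le_trans (cK 0%N); rewrite mulr_ge0 ?normc_ge0.
have -> : normc (n%:R * c n) * t' ^+ n = n%:R * (t' / t) ^+ n * (normc (c n) * t ^+ n).
  rewrite normcM normc_nat expr_div_n; field.
  by rewrite expf_neq0 ?gt_eqF.
have q0 : 0 <= t' / t by rewrite divr_ge0// ltW.
apply: ler_pM => //.
- by rewrite mulr_ge0 ?exprn_ge0.
- by rewrite mulr_ge0 ?exprn_ge0 ?normc_ge0 ?(ltW t0).
by apply: natr_expr_le => //; rewrite ltr_pdivrMr// mul1r.
Qed.

Let diffquot w h n := (h + w) ^+ n - w ^+ n - h * (n%:R * w ^+ n.-1).

(** The remainder at n + 1 is h + w times the remainder at n plus n h^2 w^(n-1), and n^2 + n <= (n +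
    1)^2. The factor rho^2 on the left stands for an exponent n - 2 on the right, which would be
    truncated for small n. *)
Lemma diffquot_le w h (rho : R) n : normc (h + w) <= rho -> normc w <= rho ->
  rho ^+ 2 * normc (diffquot w h n) <= n%:R ^+ 2 * normc h ^+ 2 * rho ^+ n.
Proof.
move=> hwr wr; have r0 : 0 <= rho := le_trans (normc_ge0 _) wr.
elim: n => [|n IH].
  by rewrite /diffquot !expr0 subrr mul0r mulr0 subr0 normc0 expr0n/= !mul0r mulr0.
have -> : diffquot w h n.+1 = (h + w) * diffquot w h n + n%:R * h ^+ 2 * w ^+ n.-1.
  rewrite /diffquot; case: n {IH} => [|n] /=; first by rewrite expr0 !expr1; ring.
  by rewrite !exprS -[n.+2%:R]natr1 -[n.+1%:R]natr1; ring.
apply: (@le_trans _ _ (rho * (n%:R ^+ 2 * normc h ^+ 2 * rho ^+ n) + n%:R * normc h ^+ 2 * rho ^+ n.+1)).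
  apply: le_trans (ler_wpM2l (sqr_ge0 _) (le_normcD _ _)) _.
  rewrite mulrDr; apply: lerD.
    rewrite normcM mulrCA; apply: ler_pM => //; rewrite ?normc_ge0//.
    by rewrite mulr_ge0 ?sqr_ge0 ?normc_ge0.
  case: n {IH} => [|n]; first by rewrite !mul0r normc0 mulr0.
  rewrite normcM [normc (n.+1%:R * _)]normcM normc_nat !normcX mulrCA ler_wpM2l//.
    by rewrite mulr_ge0 ?sqr_ge0.
  by rewrite -[n.+2]add2n exprD ler_wpM2l ?sqr_ge0// lerXn2r ?nnegrE ?normc_ge0.
have -> : rho * (n%:R ^+ 2 * normc h ^+ 2 * rho ^+ n) + n%:R * normc h ^+ 2 * rho ^+ n.+1 =
  (n%:R ^+ 2 + n%:R) * (normc h ^+ 2 * rho ^+ n.+1) by rewrite [rho ^+ n.+1]exprS; ring.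
rewrite -mulrA; apply: ler_wpM2r; first by rewrite mulr_ge0 ?sqr_ge0 ?exprn_ge0.
by rewrite -natr1 sqrrD expr1n mulr1; have := ler0n R n; lra.
Qed.

(** The bounds of [diffquot_le] are summed at a radius [rho] strictly between |w| and t. A remainder
    estimate is kept, rather than a derivative, because it serves both for the complex derivative
    and for the real derivatives of Re and Im along a segment. *)
Lemma pser_quadratic c t w : pbound c t -> normc w < t ->
  exists M e : R, [/\ 0 <= M, 0 < e & forall h, normc h < e ->
    normc (pser c (h + w) - pser c w - h * pser (dpser c) w) <= M * normc h ^+ 2].
Proof.
move=> ct wt; pose rho := (normc w + t) / 2.
have w0 := normc_ge0 w.
have wr : normc w < rho by rewrite /rho; lra.
have rt : rho < t by rewrite /rho; lra.
have r0 : 0 < rho by lra.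
pose v n := normc (n%:R * (n%:R * c n)) * rho ^+ n.
have v0 n : 0 <= v n by rewrite /v mulr_ge0 ?normc_ge0// exprn_ge0// ltW.
have cv : cvgn (series v).
  (* Each of the two factors n in [v] costs some radius, and so does summability: hence rho < t1 <
     t2 < t. *)
  pose t1 := (rho + t) / 2; pose t2 := (t1 + t) / 2.
  have r1 : rho < t1 by rewrite /t1; lra.
  have t1t : t1 < t by rewrite /t1; lra.
  have t12 : t1 < t2 by rewrite /t2; lra.
  have t2t : t2 < t by rewrite /t2; lra.
  have p2 : pbound (fun n => n%:R * c n) t2 by apply: pbound_natM ct; lra.
  have p1 : pbound (fun n => n%:R * (n%:R * c n)) t1 by apply: pbound_natM p2; lra.
  have := @pbound_csummable _ _ (rho%:C)%C p1.
  have nr : normc rho%:C%C = rho.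
    by rewrite /normc/= expr0n addr0 sqrtr_sqr gtr0_norm.
  have -> : v = fun n => normc (n%:R * (n%:R * c n) * rho%:C%C ^+ n).
    by apply/funext => n; rewrite [RHS]normcM normcX nr.
  by apply; rewrite nr.
pose M := rho ^- 2 * limn (series v).
exists M; exists (rho - normc w).
rewrite {}/M.
split=> [||h he].
- rewrite mulr_ge0 ?invr_ge0 ?sqr_ge0//.
  have nd : nondecreasing_seq (series v).
    apply/nondecreasing_seqP => k.
    by rewrite /series /= big_nat_recr//= lerDl.
  have := nondecreasing_cvgn_le nd cv 0.
  by rewrite {1}/series /= big_geq.
- by rewrite subr_gt0.
have hw : normc (h + w) < rho by apply: le_lt_trans (le_normcD _ _) _; lra.
have s1 : csummable (fun n => c n * (h + w) ^+ n) by apply: pbound_csummable ct _; lra.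
have s2 : csummable (fun n => c n * w ^+ n) by apply: pbound_csummable ct _; lra.
have s3 : csummable (fun n => n%:R * c n * w ^+ n.-1).
  apply: (@csummable_le _ _ (fun n => rho^-1 * v n)); last first.
    have -> : series (fun n => rho^-1 * v n) = (fun n => rho^-1 * series v n).
      by apply/funext => n; rewrite /series /= mulr_sumr.
    by apply: is_cvgM => //; exact: is_cvg_cst.
  case=> [|n]; first by rewrite !mul0r normc0 mulr_ge0// invr_ge0 ltW.
  rewrite /v /= exprS [X in _ <= X]mulrCA mulKf ?gt_eqF//.
  rewrite !normcM !normcX normc_nat; apply: ler_pM => //.
  - by rewrite mulr_ge0 ?normc_ge0.
  - by rewrite exprn_ge0 ?normc_ge0.
  - by rewrite ler_peMl ?mulr_ge0 ?normc_ge0// ler1n.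
  - by rewrite lerXn2r ?nnegrE ?normc_ge0// ltW.
have -> : pser (dpser c) w = csum (fun n => n%:R * c n * w ^+ n.-1).
  by rewrite csum_recl//= !mul0r add0r.
rewrite /pser -csumB// -csumZ// -csumB//; last 2 first.
- exact: csummableB.
- exact: csummableZ.
have -> : (fun n => c n * (h + w) ^+ n - c n * w ^+ n - h * (n%:R * c n * w ^+ n.-1)) =
    (fun n => c n * diffquot w h n).
  by apply/funext => n; rewrite /diffquot; ring.
have -> : rho ^- 2 * limn (series v) * normc h ^+ 2 =
    limn (series (fun n => rho ^- 2 * normc h ^+ 2 * v n)).
  have -> : series (fun n => rho ^- 2 * normc h ^+ 2 * v n) =
      (fun n => rho ^- 2 * normc h ^+ 2 * series v n).
    by apply/funext => n; rewrite /series /= mulr_sumr.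
  rewrite mulrAC; apply/esym/cvg_lim => //.
  by apply: cvgM => //; exact: cvg_cst.
apply: csum_norm_le; last first.
  have -> : series (fun n => rho ^- 2 * normc h ^+ 2 * v n) =
      (fun n => rho ^- 2 * normc h ^+ 2 * series v n).
    by apply/funext => n; rewrite /series /= mulr_sumr.
  by apply: is_cvgM => //; exact: is_cvg_cst.
move=> n; have := diffquot_le n (ltW hw) (ltW wr).
rewrite /v !normcM !normc_nat mulrC -ler_pdivlMr ?exprn_gt0// => dq.
apply: le_trans (ler_wpM2l (normc_ge0 _) dq) _.
by rewrite le_eqVlt; apply/orP; left; apply/eqP; field; rewrite gt_eqF.
Qed.

End PowerSeries.

Section PowerSeriesDerivative.
Variable R : realType.
Local Notation C := (complex R).
Implicit Types (z w h : C) (u v c : nat -> C).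

Local Notation Re := complex.Re.
Local Notation Im := complex.Im.
Local Notation normc := ComplexField.Normc.normc.
Import ComplexField.Normc.
Local Arguments normc : simpl never.
Local Arguments csum : simpl never.

Lemma pser_is_derive c (t : R) w : pbound c t -> normc w < t ->
  is_derive (w : C^o) (1 : C^o) (pser c : C^o -> C^o) (pser (dpser c) w : C^o).
Proof.
move=> ct wt; have [M [e [M0 e0 H]]] := pser_quadratic ct wt.
apply: (@is_derive_quadratic _ _ _ _ _ M%:C%C e%:C%C); rewrite ?lecR ?ltcR//.
move=> h; rewrite !normr_normc ltcR => /H.
by rewrite -rmorphXn -rmorphM/= lecR.
Qed.

Lemma normc_real (a : R) : normc a%:C%C = `|a|.
Proof. by rewrite /normc /= expr0n addr0 sqrtr_sqr. Qed.

Lemma pser_quadratic_line c (t s : R) y : pbound c t -> normc (s%:C%C * y) < t ->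
  exists M e : R, [/\ 0 <= M, 0 < e & forall h : R, `|h| < e ->
    normc (pser c ((h + s)%:C%C * y) - pser c (s%:C%C * y) - h%:C%C * (y * pser (dpser c) (s%:C%C * y)))
     <= M * `|h| ^+ 2].
Proof.
move=> ct wt; have [M [e [M0 e0 H]]] := pser_quadratic ct wt.
have y1 : 0 < normc y + 1 by rewrite ltr_wpDl ?normc_ge0.
exists (M * normc y ^+ 2); exists (e / (normc y + 1)); split=> [||h he].
- by rewrite mulr_ge0 ?sqr_ge0.
- by rewrite divr_gt0.
have := H (h%:C%C * y); rewrite normcM normc_real => {}H.
rewrite rmorphD/= mulrDl [h%:C%C * (y * _)]mulrA.
have -> : M * normc y ^+ 2 * `|h| ^+ 2 = M * (`|h| * normc y) ^+ 2 by ring.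
apply: H.
rewrite ltr_pdivlMr// in he; apply: le_lt_trans he.
by rewrite ler_wpM2l// lerDl.
Qed.

Lemma Re_realM (a : R) z : Re (a%:C%C * z) = a * Re z.
Proof. by case: z => b d /=; rewrite mul0r subr0. Qed.

Lemma Im_realM (a : R) z : Im (a%:C%C * z) = a * Im z.
Proof. by case: z => b d /=; rewrite mul0r addr0. Qed.

Lemma Re_pser_is_derive c (t s : R) y : pbound c t -> normc (s%:C%C * y) < t ->
  is_derive s (1 : R) (fun s => Re (pser c (s%:C%C * y))) (Re (y * pser (dpser c) (s%:C%C * y))).
Proof.
move=> ct wt; have [M [e [M0 e0 H]]] := pser_quadratic_line ct wt.
apply: (@is_derive_quadratic _ R^o _ _ _ M e) => // h /H; apply: le_trans.
by apply: le_trans (normr_Re_le _); rewrite !ReB Re_realM.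
Qed.

Lemma Im_pser_is_derive c (t s : R) y : pbound c t -> normc (s%:C%C * y) < t ->
  is_derive s (1 : R) (fun s => Im (pser c (s%:C%C * y))) (Im (y * pser (dpser c) (s%:C%C * y))).
Proof.
move=> ct wt; have [M [e [M0 e0 H]]] := pser_quadratic_line ct wt.
apply: (@is_derive_quadratic _ R^o _ _ _ M e) => // h /H; apply: le_trans.
by apply: le_trans (normr_Im_le _); rewrite !ImB Im_realM.
Qed.

Lemma is_derive0_segment (f : R -> R) (a b : R) : a <= b ->
  (forall s, s \in `[a, b] -> is_derive s (1 : R) f 0) -> f b = f a.
Proof.
move=> ab fd.
have d0 s : s \in `]a, b[ -> is_derive s (1 : R) f 0.
  by move=> sab; apply: fd; exact: subset_itv_oo_cc.
have fc : {within `[a, b], continuous f}.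
  by apply: derivable_within_continuous => s sab; have [] := fd s sab.
have [c _] := MVT_segment ab d0 fc.
by rewrite mul0r => /eqP; rewrite subr_eq0 => /eqP.
Qed.

Lemma cexp0 : cexp (0 : C) = 1.
Proof. by rewrite /cexp /= expR0 cos0 sin0 mulr0 mul1r. Qed.

Lemma cexpD z w : cexp (z + w) = cexp z * cexp w.
Proof.
case: z w => [a b] [a' b']; rewrite /cexp /= expRD cosD sinD.
by apply/eqP; rewrite eq_complex /=; apply/andP; split; apply/eqP; ring.
Qed.

Lemma cexpN z : cexp (- z) = (cexp z)^-1.
Proof.
have e : cexp z * cexp (- z) = 1 by rewrite -cexpD subrr cexp0.
have z0 : cexp z != 0 by apply: contra_eq_neq e => ->; rewrite mul0r eq_sym oner_eq0.
by apply: (mulfI z0); rewrite e mulfV.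
Qed.

Lemma cexp_neq0 z : cexp z != 0.
Proof.
apply/eqP => z0; have := cexpD z (- z).
by rewrite subrr cexp0 z0 mul0r => /eqP; rewrite oner_eq0.
Qed.

Lemma pser0 c (t : R) : 0 < t -> pbound c t -> pser c 0 = c 0%N.
Proof.
move=> t0 ct; have s0 : csummable (fun n => c n * 0 ^+ n).
  by apply: pbound_csummable ct _; rewrite normc0.
rewrite /pser csum_recl// expr0 mulr1.
rewrite [X in _ + X](_ : _ = 0) ?addr0//.
rewrite -[RHS](mul0r (csum (fun n => c n.+1 * 0 ^+ n.+1))) -csumZ.
  by congr csum; apply/funext => n; rewrite mul0r expr0n mulr0.
exact: csummableS s0.
Qed.

(** Coefficients of - log (1 - t); the constant one is 0 because 0^-1 = 0. *)
Definition logc n : C := n%:R^-1.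

Lemma logc_pbound : pbound logc 1.
Proof.
exists 1 => -[|n]; first by rewrite /logc invr0 normc0 mul0r.
by rewrite /logc normcV normc_nat expr1n mulr1 invf_le1 ?ler1n ?ltr0n.
Qed.

Lemma pser_dlogc w : normc w < 1 -> (1 - w) * pser (dpser logc) w = 1.
Proof.
move=> w1; have d1 : dpser logc = fun=> 1.
  by apply/funext => n; rewrite /dpser /logc mulfV// pnatr_eq0.
have su : csummable (fun n => 1 * w ^+ n).
  by apply: (@pbound_csummable R (fun=> 1) 1) => //; exists 1 => n; rewrite normc1 expr1n mulr1.
have E : pser (fun=> 1) w = 1 + w * pser (fun=> 1) w.
  rewrite {1}/pser csum_recl// expr0 mulr1 /pser -csumZ//; congr (_ + csum _).
  by apply/funext => n; rewrite exprS !mul1r.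
by rewrite d1 mulrBl mul1r {1}E addrK.
Qed.

(** With L = [pser logc], the function (1 - s y) exp (L(s y)) of a real s in [0, 1] has derivative 0
    and value 1 at s = 0. Its real and imaginary parts [u] and [v] are treated separately, so that
    the real mean value theorem applies. *)
Lemma cexp_pser_logc y : normc y < 1 -> cexp (- pser logc y) = 1 - y.
Proof.
move=> y1.
pose a (s : R) := Re (pser logc (s%:C%C * y)); pose b (s : R) := Im (pser logc (s%:C%C * y)).
pose y1' := Re y; pose y2 := Im y.
pose u (s : R) := expR (a s) * ((1 - s * y1') * cos (b s) + s * y2 * sin (b s)).
pose v (s : R) := expR (a s) * ((1 - s * y1') * sin (b s) - s * y2 * cos (b s)).
have uv (s : R) : (1 - s%:C%C * y) * cexp (pser logc (s%:C%C * y)) = Complex (u s) (v s).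
  rewrite /u /v /a /b /y1' /y2 /cexp; case: (y) => ya yb /=.
  by apply/eqP; rewrite eq_complex /=; apply/andP; split; apply/eqP; ring.
have sy (s : R) : s \in `[0, 1] -> normc (s%:C%C * y) < 1.
  rewrite in_itv /= => /andP[s0 s1]; rewrite normcM normc_real ger0_norm//.
  by apply: le_lt_trans y1; rewrite ler_piMl ?normc_ge0.
(* A and B are the real and imaginary parts of y L'(s y); the two equations are those of (1 - s y) y
   L'(s y) = y. *)
have ab (s : R) : s \in `[0, 1] -> exists A B : R,
   [/\ is_derive s (1 : R) a A, is_derive s (1 : R) b B,
     A * (1 - s * y1') + B * s * y2 = y1' & B * (1 - s * y1') - A * s * y2 = y2].
  move=> s01; exists (Re (y * pser (dpser logc) (s%:C%C * y))).
  exists (Im (y * pser (dpser logc) (s%:C%C * y))); split.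
  - exact: Re_pser_is_derive logc_pbound (sy _ s01).
  - exact: Im_pser_is_derive logc_pbound (sy _ s01).
  - have := pser_dlogc (sy _ s01); move: (pser _ _) => -[p q] /(congr1 ( *%R y)).
    rewrite mulr1 mulrCA /y1' /y2; case: (y) => ya yb /= [e _]; rewrite -[RHS]e; ring.
  - have := pser_dlogc (sy _ s01); move: (pser _ _) => -[p q] /(congr1 ( *%R y)).
    rewrite mulr1 mulrCA /y1' /y2; case: (y) => ya yb /= [_ e]; rewrite -[RHS]e; ring.
have dlin (q s : R) : is_derive s (1 : R) (fun s => s * q) q.
  have -> : (fun s : R => s * q) = (id : R -> R) * cst q by [].
  have := is_deriveM (is_derive_id s 1) (is_derive_cst q s 1).
  move/is_derive_eq; apply.
  by rewrite /GRing.scale /= mulr0 add0r mulr1.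
have d1lin (q s : R) : is_derive s (1 : R) (fun s => 1 - s * q) (- q).
  have -> : (fun s : R => 1 - s * q) = cst 1 - (fun s => s * q) by [].
  by have := is_deriveB (is_derive_cst (1 : R) s 1) (dlin q s); move/is_derive_eq; apply; rewrite sub0r.
have u1 : u 1 = u 0.
  apply: (is_derive0_segment ler01) => s /ab [A [B [da db e1 e2]]].
  have dc := is_derive1_comp (is_derive_cos (b s)) db.
  have ds := is_derive1_comp (is_derive_sin (b s)) db.
  have de := is_derive1_comp (is_derive_expR (a s)) da.
  have -> : u = (expR \o a) * ((fun s => 1 - s * y1') * (cos \o b) + (fun s => s * y2) * (sin \o b)) by [].
  have := is_deriveM de (is_deriveD (is_deriveM (d1lin y1' s) dc)
    (is_deriveM (dlin y2 s) ds)).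
  move/is_derive_eq; apply.
  rewrite /GRing.scale /= !fctE /=.
  transitivity (expR (a s) * (cos (b s) * (A * (1 - s * y1') + B * s * y2 - y1')
    - sin (b s) * (B * (1 - s * y1') - A * s * y2 - y2))); first by ring.
  by rewrite e1 e2 !subrr !mulr0 subrr mulr0.
have v1 : v 1 = v 0.
  apply: (is_derive0_segment ler01) => s /ab [A [B [da db e1 e2]]].
  have dc := is_derive1_comp (is_derive_cos (b s)) db.
  have ds := is_derive1_comp (is_derive_sin (b s)) db.
  have de := is_derive1_comp (is_derive_expR (a s)) da.
  have -> : v = (expR \o a) * ((fun s => 1 - s * y1') * (sin \o b) - (fun s => s * y2) * (cos \o b)) by [].
  have := is_deriveM de (is_deriveB (is_deriveM (d1lin y1' s) ds)
    (is_deriveM (dlin y2 s) dc)).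
  move/is_derive_eq; apply.
  rewrite /GRing.scale /= !fctE /=.
  transitivity (expR (a s) * (sin (b s) * (A * (1 - s * y1') + B * s * y2 - y1')
    + cos (b s) * (B * (1 - s * y1') - A * s * y2 - y2))); first by ring.
  by rewrite e1 e2 !subrr !mulr0 addr0 mulr0.
have := uv 1; rewrite u1 v1 -uv mul0r (pser0 ltr01 logc_pbound) {2}/logc invr0 cexp0 subr0 mul1r mul1r => e.
by rewrite cexpN -[RHS](mulfK (cexp_neq0 (pser logc y))) e mul1r.
Qed.

End PowerSeriesDerivative.

(** * Infinite products and continuations of contractions *)

Section QPochhammer.
Variable R : realType.
Local Notation C := (complex R).
Implicit Types (z w h p : C) (u v c : nat -> C).

Local Notation Re := complex.Re.
Local Notation Im := complex.Im.
Local Notation normc := ComplexField.Normc.normc.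
Import ComplexField.Normc.
Local Arguments normc : simpl never.
Local Arguments csum : simpl never.
Local Arguments pser : simpl never.

Lemma pser_continuous c (t : R) w : pbound c t -> normc w < t ->
  {for (w : C^o), continuous (pser c : C^o -> C^o)}.
Proof.
move=> ct wt; have [d _] := pser_is_derive ct wt.
by apply: differentiable_continuous; apply/derivable1_diffP.
Qed.

Lemma normc_1B_ge z : 1 - normc z <= normc (1 - z).
Proof. by rewrite lerBlDr -{1}(normc1 R) -{1}(subrK z 1) le_normcD. Qed.

Lemma expr_small (q D : R) : 0 <= q -> q < 1 ->
  exists N, forall n, (N <= n)%N -> q ^+ n * D <= 1.
Proof.
move=> q0 q1; have D0 : 0 < `|D| + 1 by rewrite ltr_wpDl.
have /cvgrPdist_lt /(_ (`|D| + 1)^-1) : geometric 1 q @ \oo --> 0.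
  by apply: cvg_geometric; rewrite ger0_norm.
rewrite invr_gt0 => /(_ D0) [N _ NP]; exists N => n /NP /=.
rewrite mul1r sub0r normrN ger0_norm ?exprn_ge0// => qn.
rewrite -[X in _ < X]mul1r ltr_pdivlMr// in qn.
apply: le_trans (ltW qn); rewrite ler_wpM2l ?exprn_ge0//.
by have := ler_norm D; lra.
Qed.

Lemma bounded_eventually_nonincreasing (a : nat -> R) N :
  (forall n, 0 <= a n) -> (forall n, (N <= n)%N -> a n.+1 <= a n) ->
  exists K, forall n, a n <= K.
Proof.
move=> a0 aN; exists (\sum_(i < N.+1) a i) => n.
have aK i : (i <= N)%N -> a i <= \sum_(i < N.+1) a i.
  move=> iN; rewrite (bigD1 (Ordinal (iN : (i < N.+1)%N)))//= lerDl.
  by rewrite sumr_ge0.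
have [/aK//|Nn] := leqP n N.
rewrite -(subnKC (ltnW Nn)); elim: (n - N)%N => [|k IH]; first by rewrite addn0 aK.
by rewrite addnS; apply: le_trans IH; rewrite aN// leq_addr.
Qed.

(** Coefficients of - log (t; p)_oo: the sum over i of (p^i t)^n / n is t^n / (n (1 - p^n)). *)
Definition qlogc p n : C := n%:R^-1 / (1 - p ^+ n).

(* Euler's expansion: (w; p)_oo is the entire function \sum_n eulerc p n w^n. *)
Fixpoint eulerc p n : C :=
  if n is n'.+1 then - (p ^+ n' * eulerc p n' / (1 - p ^+ n'.+1)) else 1.

Variable p : C.
Hypothesis p1 : normc p < 1.

Lemma normc_1BX_ge n : (0 < n)%N -> 1 - normc p <= normc (1 - p ^+ n).
Proof.
case: n => // n _; apply: le_trans (normc_1B_ge _).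
rewrite lerD2l lerN2 normcX exprS ler_piMr ?normc_ge0//.
by rewrite exprn_ile1 ?normc_ge0// ltW.
Qed.

Lemma onem_expr_neq0 n : (0 < n)%N -> 1 - p ^+ n != 0.
Proof.
move=> /normc_1BX_ge pn; apply/eqP => e; move: pn.
by rewrite e normc0; have := p1; lra.
Qed.

Lemma qlogc_pbound : pbound (qlogc p) 1.
Proof.
have q0 : 0 < 1 - normc p by rewrite subr_gt0.
exists (1 - normc p)^-1 => -[|n].
  by rewrite /qlogc invr0 !mul0r normc0 mul0r invr_ge0 ltW.
rewrite /qlogc expr1n mulr1 normcM !normcV normc_nat.
rewrite -[leRHS]mul1r; apply: ler_pM; rewrite ?invr_ge0 ?normc_ge0//.
  by rewrite invf_le1 ?ler1n ?ltr0n.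
by rewrite lef_pV2 ?posrE ?normc_1BX_ge// (lt_le_trans q0)// normc_1BX_ge.
Qed.

(** The ratio of consecutive terms is - p^n t / (1 - p^(n+1)), which tends to 0: the radius of
    convergence is infinite. *)
Lemma eulerc_pbound (t : R) : 0 < t -> pbound (eulerc p) t.
Proof.
move=> t0; have q0 : 0 < 1 - normc p by rewrite subr_gt0.
have [N NP] := expr_small (t / (1 - normc p)) (normc_ge0 p) p1.
apply: (@bounded_eventually_nonincreasing (fun n => normc (eulerc p n) * t ^+ n) N).
  by move=> n; rewrite mulr_ge0 ?normc_ge0// exprn_ge0// ltW.
move=> n /NP nN; rewrite [eulerc p n.+1]/= normcN !normcM normcV normcX.
set d := normc (1 - _); set e := normc (eulerc p n).
have dq : d^-1 <= (1 - normc p)^-1.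
  by rewrite lef_pV2 ?posrE ?normc_1BX_ge// (lt_le_trans q0)// normc_1BX_ge.
have -> : normc p ^+ n * e / d * t ^+ n.+1 = e * t ^+ n * (normc p ^+ n * (t / d)).
  by rewrite exprS; ring.
have et : 0 <= e * t ^+ n by rewrite mulr_ge0 ?normc_ge0// exprn_ge0// ltW.
rewrite ler_piMr//; apply: le_trans nN; rewrite ler_wpM2l ?exprn_ge0 ?normc_ge0//.
by rewrite ler_wpM2l// ltW.
Qed.

(** From 1 / (1 - p^n) = 1 + p^n / (1 - p^n); this is the logarithm of (y; p)_oo = (1 - y) (p y;
    p)_oo. *)
Lemma pser_qlogc y : normc y < 1 ->
  pser (qlogc p) y = pser (logc R) y + pser (qlogc p) (p * y).
Proof.
move=> y1; have py : normc (p * y) < 1.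
  by rewrite normcM mulr_ilt1 ?normc_ge0.
rewrite /pser -csumD.
- congr csum; apply/funext => -[|n].
    by rewrite /qlogc /logc invr0 !mul0r addr0.
  rewrite /qlogc /logc exprMn; field.

  by rewrite onem_expr_neq0// nat1r pnatr_eq0.
- exact: pbound_csummable (logc_pbound R) _.
- exact: pbound_csummable qlogc_pbound _.
Qed.

Definition qexp y := cexp (- pser (qlogc p) y).

Lemma qexp_rec y : normc y < 1 -> qexp y = (1 - y) * qexp (p * y).
Proof. by move=> y1; rewrite [qexp y]/qexp (pser_qlogc y1) opprD cexpD (cexp_pser_logc y1) /qexp. Qed.

Lemma pser_eulerc_rec w : pser (eulerc p) w = (1 - w) * pser (eulerc p) (p * w).
Proof.
have su z : csummable (fun n => eulerc p n * z ^+ n).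
  apply: (@pbound_csummable _ _ (normc z + 1)); last by rewrite ltrDl.
  by apply: eulerc_pbound; rewrite ltr_wpDl ?normc_ge0.
have suS z := csummableS (su z).
rewrite mulrBl mul1r [pser _ (p * w) in X in X - _]/pser {1}/pser csum_recl// [in RHS]csum_recl//.
rewrite -addrA; congr (_ + _).
have suw : csummable (fun n => w * (eulerc p n * (p * w) ^+ n)) by exact: csummableZ.
rewrite /pser -csumZ// -csumB//.
congr csum; apply/funext => n; rewrite [eulerc p n.+1]/= !exprMn !exprS; field.
by rewrite -exprS onem_expr_neq0.
Qed.

Lemma cvg_expr_mul0 w : (fun n => p ^+ n * w : C^o) @ \oo --> (0 : C^o).
Proof.
apply/cvgrPdist_lt => -[e e'] /=; rewrite ltcE /= => /andP[/eqP -> e0].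
have [N NP] := expr_small (2 * normc w / e) (normc_ge0 p) p1.
exists N => //= n /= /NP; rewrite sub0r normrN normr_normc ltcR normcM normcX => nN.
have [->|w0] := eqVneq (normc w) 0; first by rewrite mulr0.
have w1 : 0 < normc w by rewrite lt_neqAle eq_sym w0 normc_ge0.
have q0 : 0 <= normc p ^+ n by rewrite exprn_ge0 ?normc_ge0.
rewrite !mulrA ler_pdivrMr// mul1r in nN.
by have := mulr_ge0 q0 (ltW w1); lra.
Qed.

(** F(w) is the n-th partial product times F(p^n w), and F(p^n w) is eventually nonzero with limit
    1. Only the orbit of w matters, so the criterion applies to the Euler series on the whole plane
    and to [qexp] on the unit disc alike. *)
Lemma qpoch_unique (F : C -> C) w :
  (forall n, F (p ^+ n * w) = (1 - p ^+ n * w) * F (p ^+ n.+1 * w)) ->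
  ((fun n => F (p ^+ n * w)) : nat -> C^o) @ \oo --> (1 : C^o) ->
  qpoch w p = F w.
Proof.
move=> Frec Fcvg.
have FE n : F w = \prod_(i < n) (1 - p ^+ i * w) * F (p ^+ n * w).
  elim: n => [|n IH]; first by rewrite big_ord0 expr0 !mul1r.
  by rewrite big_ord_recr/= -mulrA -Frec.
suff H : (fun n => \prod_(i < n) (1 - p ^+ i * w) : C^o) @ \oo --> (F w : C^o).
  exact: (cvg_lim (@norm_hausdorff _ C^o) H).
have Finv : (fun n => F w * (F (p ^+ n * w))^-1 : C^o) @ \oo --> (F w : C^o).
  rewrite -[X in _ --> X]mulr1 -[X in _ * X]invr1.
  by apply: cvgM; [exact: cvg_cst|apply: cvgV => //; exact: oner_neq0].
apply: cvg_trans Finv; apply: near_eq_cvg.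
have [N _ NP] := cvg_normc Fcvg (@ltr01 R).
exists N => // n /NP /= n1; rewrite [in LHS](FE n) mulfK//.
by apply: contraTN n1 => /eqP ->; rewrite subr0 normc1 ltxx.
Qed.

Lemma qpochE w : qpoch w p = pser (eulerc p) w.
Proof.
apply: qpoch_unique => [n|].
  by rewrite pser_eulerc_rec exprS mulrA.
have <- : pser (eulerc p) 0 = 1 := pser0 ltr01 (eulerc_pbound ltr01).
apply: (@continuous_cvg _ C^o C^o _ _ (fun n => p ^+ n * w) (pser (eulerc p))).
  by apply: (pser_continuous (eulerc_pbound ltr01)); rewrite normc0.
exact: cvg_expr_mul0.
Qed.

Lemma cexp_cvg0 u : (u : nat -> C^o) @ \oo --> (0 : C^o) ->
  ((fun n => cexp (u n)) : nat -> C^o) @ \oo --> (1 : C^o).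
Proof.
move=> u0; have ur : (fun n => Re (u n)) @ \oo --> (0 : R).
  apply/cvgrPdist_lt => e /(cvg_normc u0); apply: filterS => n; apply: le_lt_trans.
  by rewrite -[X in X - _]/(Re 0) -ReB normr_Re_le.
have ui : (fun n => Im (u n)) @ \oo --> (0 : R).
  apply/cvgrPdist_lt => e /(cvg_normc u0); apply: filterS => n; apply: le_lt_trans.
  by rewrite -[X in X - _]/(Im 0) -ImB normr_Im_le.
rewrite -(cexp0 R); apply: cvg_complex => /=; apply: cvgM.
- apply: (@continuous_cvg _ R R _ _ _ (@expR R) _ _ ur); exact: continuous_expR.
- apply: (@continuous_cvg _ R R _ _ _ (@cos R) _ _ ui); exact: continuous_cos.
- apply: (@continuous_cvg _ R R _ _ _ (@expR R) _ _ ur); exact: continuous_expR.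
- apply: (@continuous_cvg _ R R _ _ _ (@sin R) _ _ ui); exact: continuous_sin.
Qed.

Lemma normc_expr_mul_lt1 y n : normc y < 1 -> normc (p ^+ n * y) < 1.
Proof.
apply: le_lt_trans; rewrite normcM normcX ler_piMl ?normc_ge0//.
by rewrite exprn_ile1 ?normc_ge0// ltW.
Qed.

Lemma qpoch_qexp y : normc y < 1 -> qpoch y p = qexp y.
Proof.
move=> y1; apply: qpoch_unique => [n|].
  by rewrite exprS -mulrA; apply: qexp_rec; exact: normc_expr_mul_lt1.
apply: cexp_cvg0.
have -> : 0 = - pser (qlogc p) 0.
  by rewrite (pser0 ltr01 qlogc_pbound) /qlogc invr0 mul0r oppr0.
apply: (@cvgN _ _ _ _ _ (fun n => pser (qlogc p) (p ^+ n * y) : C^o)).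
apply: (@continuous_cvg _ C^o C^o _ _ (fun n => p ^+ n * y) (pser (qlogc p))).
  by apply: (pser_continuous qlogc_pbound); rewrite normc0.
exact: cvg_expr_mul0.
Qed.

Lemma qpoch_neq0 y : normc y < 1 -> qpoch y p != 0.
Proof. by move=> /qpoch_qexp ->; exact: cexp_neq0. Qed.

Lemma qpoch_rec w : qpoch w p = (1 - w) * qpoch (p * w) p.
Proof. by rewrite !qpochE pser_eulerc_rec. Qed.

Lemma qpoch_prod w n : qpoch w p = \prod_(i < n) (1 - p ^+ i * w) * qpoch (p ^+ n * w) p.
Proof.
elim: n => [|n IH]; first by rewrite big_ord0 expr0 !mul1r.
by rewrite big_ord_recr/= -mulrA exprS -[p * _ * w]mulrA -qpoch_rec.
Qed.

End QPochhammer.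

(** * Meromorphy of q-products and continuation of exponentials *)

Section Meromorphy.
Variable R : realType.
Local Notation C := (complex R).
Implicit Types (z w d : C) (f g G : C -> C) (c : nat -> C).

Local Notation Re := complex.Re.
Local Notation Im := complex.Im.
Local Notation normc := ComplexField.Normc.normc.
Import ComplexField.Normc.
Local Arguments normc : simpl never.
Local Arguments csum : simpl never.
Local Arguments pser : simpl never.

Definition meromorphic_at f w := exists (n : nat) (g : C -> C), holomorphic_at g w /\
  \forall y \near (w : C^o)^', f y = g y / (y - w) ^+ n.

Lemma holomorphic_atM f g w : holomorphic_at f w -> holomorphic_at g w ->
  holomorphic_at (fun y => f y * g y) w.
Proof.
rewrite /holomorphic_at => hf hg; apply: (filterS2 _ _ hf hg) => y df dg.
exact: (derivableM df dg).
Qed.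

Lemma holomorphic_at_cst a w : holomorphic_at (fun=> a : C) w.
Proof. by near=> y; exact: derivable_cst. Unshelve. all: by end_near. Qed.

Lemma holomorphic_at_continuous f w : holomorphic_at f w ->
  {for (w : C^o), continuous (f : C^o -> C^o)}.
Proof.
move=> /nbhs_singleton fd; apply: differentiable_continuous.
exact/derivable1_diffP.
Qed.

Lemma holomorphic_atV f w : f w != 0 -> holomorphic_at f w ->
  holomorphic_at (fun y => (f y)^-1) w.
Proof.
move=> fw0 hf; rewrite /holomorphic_at.
have nz : \forall y \near (w : C^o), f y != 0.
  exact: (cvgr_neq0 _ (holomorphic_at_continuous hf) fw0).
apply: (filterS2 _ _ nz hf) => y fy df.
exact: (derivableV fy df).
Qed.

Lemma holomorphic_at_affine a w : holomorphic_at (fun y => 1 - a * y) w.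
Proof.
near=> y.
have di : derivable (id : C^o -> C^o) y 1 by exact: derivable_id.
have da : derivable (cst (a : C^o) : C^o -> C^o) y 1 by exact: derivable_cst.
have d1 : derivable (cst (1 : C^o) : C^o -> C^o) y 1 by exact: derivable_cst.
exact: (derivableB d1 (derivableM da di)).
Unshelve. all: by end_near.
Qed.

Lemma holomorphic_meromorphic_at f w : holomorphic_at f w -> meromorphic_at f w.
Proof.
move=> hf; exists 0%N, f; split => //; near=> y.
by rewrite expr0 divr1.
Unshelve. all: by end_near.
Qed.

Lemma meromorphic_atM f g w : meromorphic_at f w -> meromorphic_at g w ->
  meromorphic_at (fun y => f y * g y) w.
Proof.
move=> [n [f1 [hf1 ff1]]] [m [g1 [hg1 gg1]]].
exists (n + m)%N, (fun y => f1 y * g1 y); split; first exact: holomorphic_atM.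
near=> y.
have -> : f y = f1 y / (y - w) ^+ n by near: y; exact: ff1.
have -> : g y = g1 y / (y - w) ^+ m by near: y; exact: gg1.
by rewrite exprD invfM mulrACA.
Unshelve. all: by end_near.
Qed.

Lemma meromorphic_at_prod (I : Type) (s : seq I) (F : I -> C -> C) w :
  (forall i, meromorphic_at (F i) w) ->
  meromorphic_at (fun y => \prod_(i <- s) F i y) w.
Proof.
move=> hF; elim: s => [|i s IH].
  have -> : (fun y => \prod_(i <- [::]) F i y) = fun=> 1.
    by apply/funext => y; rewrite big_nil.
  by apply: holomorphic_meromorphic_at; exact: holomorphic_at_cst.
have -> : (fun y => \prod_(j <- i :: s) F j y) = (fun y => F i y * \prod_(j <- s) F j y).
  by apply/funext => y; rewrite big_cons.
exact: meromorphic_atM.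
Qed.

Lemma meromorphic_atV_affine a w : meromorphic_at (fun y => (1 - a * y)^-1) w.
Proof.
have [aw|aw] := eqVneq (1 - a * w) 0; last first.
  apply: holomorphic_meromorphic_at; apply: holomorphic_atV => //.
  exact: holomorphic_at_affine.
exists 1%N, (fun=> (- a)^-1); split; first exact: holomorphic_at_cst.
near=> y.
rewrite expr1 -invfM mulrC; congr (_^-1).
by rewrite -[1](subrK (a * w)) aw; ring.
Unshelve. all: by end_near.
Qed.

Lemma affine_neq0_near a w : \forall y \near (w : C^o)^', 1 - a * y != 0.
Proof.
have [aw|aw] := eqVneq (1 - a * w) 0; last first.
  apply: nbhs_dnbhs.
  exact: (cvgr_neq0 _ (holomorphic_at_continuous (holomorphic_at_affine a w)) aw).
have a0 : a != 0.
  by apply/eqP => a0; move/eqP: aw; rewrite a0 mul0r subr0 oner_eq0.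
near=> y.
have -> : 1 - a * y = - a * (y - w) by rewrite -[1](subrK (a * w)) aw; ring.
rewrite mulf_neq0 ?oppr_eq0// subr_eq0.
by near: y; exact: nbhs_dnbhs_neq.
Unshelve. all: by end_near.
Qed.

Section Qpoch.
Variable p : C.
Hypothesis p1 : normc p < 1.

Lemma qpoch_holomorphic d w : holomorphic_at (fun y => qpoch (d * y) p) w.
Proof.
have -> : (fun y => qpoch (d * y) p) = pser (fun n => eulerc p n * d ^+ n).
  apply/funext => y; rewrite (qpochE p1) /pser; congr csum; apply/funext => n.
  by rewrite exprMn mulrA.
near=> y; have t0 : 0 < normc y + 1 by rewrite ltr_wpDl ?normc_ge0.
suff pb : pbound (fun n => eulerc p n * d ^+ n) (normc y + 1).
  have yt : normc y < normc y + 1 by rewrite ltrDl.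
  by have [] := pser_is_derive pb yt.
have dy : 0 <= normc d * (normc y + 1) by rewrite mulr_ge0 ?normc_ge0 ?(ltW t0).
have [K eK] := eulerc_pbound p1 (ltr_wpDl dy ltr01).
exists K => n; apply: le_trans (eK n).
rewrite normcM normcX -mulrA -exprMn ler_wpM2l ?normc_ge0//.
by rewrite lerXn2r ?nnegrE ?lerDl// addr_ge0.
Unshelve. all: by end_near.
Qed.

Lemma expr_mul_small d : exists N, normc (p ^+ N * d) < 1.
Proof.
have [N NP] := expr_small (2 * normc d) (normc_ge0 p) p1.
exists N; rewrite normcM normcX; have := NP N (leqnn N).
have := mulr_ge0 (exprn_ge0 N (normc_ge0 p)) (normc_ge0 d); lra.
Qed.

(** Finitely many affine factors carry every zero near w, the remaining tail being nonzero at w.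
    Questions on zeros and poles of q-products thereby reduce to affine functions. *)
Lemma qpoch_split d w : exists N, qpoch (p ^+ N * d * w) p != 0 /\
  forall y, qpoch (d * y) p =
    \prod_(0 <= i < N) (1 - (p ^+ i * d) * y) * qpoch (p ^+ N * d * y) p.
Proof.
have [N Nw] := expr_mul_small (d * w); exists N; split.
  by apply: (qpoch_neq0 p1); rewrite -mulrA.
move=> y; rewrite (qpoch_prod p1 _ N) mulrA.
by rewrite big_mkord; congr (_ * _); apply: eq_bigr => i _; rewrite mulrA.
Qed.

Lemma qpochV_meromorphic d w : meromorphic_at (fun y => (qpoch (d * y) p)^-1) w.
Proof.
have [N [N0 NE]] := qpoch_split d w.
have -> : (fun y => (qpoch (d * y) p)^-1) =
    (fun y => \prod_(0 <= i < N) (1 - (p ^+ i * d) * y)^-1 * (qpoch (p ^+ N * d * y) p)^-1).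
  by apply/funext => y; rewrite NE invfM prodfV.
apply: meromorphic_atM.
  by apply: meromorphic_at_prod => i; exact: meromorphic_atV_affine.
apply: holomorphic_meromorphic_at; apply: holomorphic_atV => //.
exact: qpoch_holomorphic.
Qed.

Lemma qpoch_neq0_near d w : \forall y \near (w : C^o)^', qpoch (d * y) p != 0.
Proof.
have [N [N0 NE]] := qpoch_split d w.
have h1 : \forall y \near (w : C^o)^', \prod_(0 <= i < N) (1 - (p ^+ i * d) * y) != 0.
  elim: (index_iota 0 N) => [|i s IH].
    by apply: filterE => y; rewrite big_nil oner_neq0.
  apply: (filterS2 _ _ IH (affine_neq0_near (p ^+ i * d) w)) => y ys yi.
  by rewrite big_cons mulf_neq0.
have h2 : \forall y \near (w : C^o)^', qpoch (p ^+ N * d * y) p != 0.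
  apply: nbhs_dnbhs.
  exact: (cvgr_neq0 _ (holomorphic_at_continuous (qpoch_holomorphic (p ^+ N * d) w)) N0).
by apply: (filterS2 _ _ h1 h2) => y y1 y2; rewrite NE mulf_neq0.
Qed.

Lemma series_qlogc_cvg d w : normc (d * w) < 1 ->
  (series (fun n => d ^+ n.+1 * qlogc p n.+1 * w ^+ n.+1 : C^o) : nat -> C^o) @ \oo
    --> (pser (qlogc p) (d * w) : C^o).
Proof.
move=> dw; have su := pbound_csummable (qlogc_pbound p1) dw.
have -> : pser (qlogc p) (d * w) = csum (fun n => d ^+ n.+1 * qlogc p n.+1 * w ^+ n.+1).
  rewrite /pser csum_recl// {1}/qlogc invr0 !mul0r add0r; congr csum.
  by apply/funext => n; rewrite exprMn mulrA; congr (_ * _); rewrite mulrC.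
apply: csum_cvg; have := csummableS su; congr csummable; apply/funext => n.
by rewrite exprMn mulrA; congr (_ * _); rewrite mulrC.
Qed.

Lemma near_small_mul d : \forall w \near (0 : C^o), normc (d * w) < 1.
Proof.
have : 0 < (normc d + 1)^-1 by rewrite invr_gt0 ltr_wpDl ?normc_ge0.
move=> e0; apply/nbhs_ballP; exists ((normc d + 1)^-1)%:C%C; first by rewrite /= ltcR.
move=> w; rewrite /ball /= sub0r normrN normr_normc ltcR normcM => wd.
have d1 : 0 < normc d + 1 by rewrite ltr_wpDl ?normc_ge0.
rewrite -[X in _ < X]mul1r ltr_pdivlMr// in wd.
by have := normc_ge0 w; nra.
Qed.

Lemma exp_continuation_qpochV d :
  exp_continuation (fun n => d ^+ n * qlogc p n) (fun w => (qpoch (d * w) p)^-1).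
Proof.
split; first by move=> w; exact: qpochV_meromorphic.
apply: filterS (near_small_mul d) => w dw; exists (pser (qlogc p) (d * w)); split.
  exact: series_qlogc_cvg.
by rewrite (qpoch_qexp p1 dw) /qexp cexpN invrK.
Qed.

Lemma exp_continuation_qpoch d :
  exp_continuation (fun n => - (d ^+ n * qlogc p n)) (fun w => qpoch (d * w) p).
Proof.
split.
  by move=> w; apply: holomorphic_meromorphic_at; exact: qpoch_holomorphic.
apply: filterS (near_small_mul d) => w dw; exists (- pser (qlogc p) (d * w)); split.
  have -> : series (fun n => - (d ^+ n.+1 * qlogc p n.+1) * w ^+ n.+1 : C^o) =
      (fun n => - series (fun n => d ^+ n.+1 * qlogc p n.+1 * w ^+ n.+1 : C^o) n).
    by apply/funext => n; rewrite /series /= -sumrN; apply: eq_bigr => i _; rewrite mulNr.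
  exact: cvgN (series_qlogc_cvg dw).
by rewrite (qpoch_qexp p1 dw).
Qed.

End Qpoch.

Lemma exp_continuationM c c' G G' : exp_continuation c G -> exp_continuation c' G' ->
  exp_continuation (fun n => c n + c' n) (fun w => G w * G' w).
Proof.
move=> [mG nG] [mG' nG']; split.
  by move=> w; apply: (meromorphic_atM (mG w) (mG' w)).
apply: (filterS2 _ _ nG nG') => w [S [cS GS]] [S' [cS' GS']].
exists (S + S'); split; last by rewrite GS GS' cexpD.
have -> : series (fun n => (c n.+1 + c' n.+1) * w ^+ n.+1 : C^o) =
    (fun n => series (fun n => c n.+1 * w ^+ n.+1 : C^o) n +
              series (fun n => c' n.+1 * w ^+ n.+1 : C^o) n).
  by apply/funext => n; rewrite /series /= -big_split; apply: eq_bigr => i _; rewrite /= mulrDl.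
exact: cvgD cS cS'.
Qed.

Lemma exp_continuation_eq c c' G G' : (forall n, (0 < n)%N -> c n = c' n) -> G =1 G' ->
  exp_continuation c G -> exp_continuation c' G'.
Proof.
move=> cc' /funext <- [mG nG]; split => //.
apply: filterS nG => w [S [cS GS]]; exists S; split => //.
have -> : (fun n => c' n.+1 * w ^+ n.+1 : C^o) = (fun n => c n.+1 * w ^+ n.+1 : C^o) by
  apply/funext => n; rewrite cc'.
exact: cS.
Qed.

Lemma exp_continuation1 : exp_continuation (fun=> 0 : C) (fun=> 1).
Proof.
split; first by move=> w; apply: holomorphic_meromorphic_at; exact: holomorphic_at_cst.
apply: filterE => w; exists 0; split; last by rewrite cexp0.
have -> : series (fun n => 0 * w ^+ n.+1 : C^o) = fun=> 0.
  by apply/funext => n; rewrite /series /= big1// => i _; rewrite mul0r.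
exact: cvg_cst.
Qed.

(** In base 0 only the factor of index 0 survives. Finite products of affine factors and their
    inverses are therefore continued by the results already proved for q-products. *)
Lemma qpoch_0r z : qpoch z 0 = 1 - z.
Proof.
have n0 : normc (0 : C) < 1 by rewrite normc0 ltr01.
rewrite (qpoch_rec n0) mul0r (qpochE n0) (pser0 ltr01 (eulerc_pbound n0 ltr01)).
by rewrite mulr1.
Qed.

Lemma exp_continuation_prod (s : seq C) :
  exp_continuation (fun n => \sum_(d <- s) - (d ^+ n / n%:R))
    (fun w => \prod_(d <- s) (1 - d * w)).
Proof.
have n0 : normc (0 : C) < 1 by rewrite normc0 ltr01.
elim: s => [|d s IH].
  by apply: exp_continuation_eq exp_continuation1 => [n n1|w]; rewrite big_nil.
apply: exp_continuation_eq (exp_continuationM (exp_continuation_qpoch n0 d) IH).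
- move=> n n1; rewrite big_cons /qlogc expr0n gtn_eqF// subr0 divr1.
  by [].
- by move=> w; rewrite big_cons qpoch_0r.
Qed.

Lemma exp_continuation_prodV (s : seq C) :
  exp_continuation (fun n => \sum_(d <- s) (d ^+ n / n%:R))
    (fun w => (\prod_(d <- s) (1 - d * w))^-1).
Proof.
have n0 : normc (0 : C) < 1 by rewrite normc0 ltr01.
elim: s => [|d s IH].
  by apply: exp_continuation_eq exp_continuation1 => [n n1|w]; rewrite big_nil ?invr1.
apply: exp_continuation_eq (exp_continuationM (exp_continuation_qpochV n0 d) IH).
- by move=> n n1; rewrite big_cons /qlogc expr0n gtn_eqF// subr0 divr1.
- by move=> w; rewrite big_cons qpoch_0r invfM.
Qed.

End Meromorphy.

(** * Continuity, and equalities extended from punctured neighbourhoods *)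

Section ContinuityNumField.
Variable K : numFieldType.
Implicit Types (d z : K^o) (f g : K^o -> K^o).

Lemma continuous_atV z : z != 0 -> {for z, continuous (fun y : K^o => y^-1 : K^o)}.
Proof. by move=> z0; exact: inv_continuous. Qed.

Lemma continuous_atM f g z : {for z, continuous f} -> {for z, continuous g} ->
  {for z, continuous (fun y => f y * g y)}.
Proof. by move=> cf cg; exact: (cvgM cf cg). Qed.

Lemma continuous_atMl f d z : {for z, continuous f} ->
  {for z, continuous (fun y => d * f y)}.
Proof.
move=> cf; have cd : {for z, continuous (cst d : K^o -> K^o)}.
  exact: cst_continuous.
exact: (cvgM cd cf).
Qed.

Lemma continuous_atMr f d z : {for z, continuous f} ->
  {for z, continuous (fun y => f y * d)}.
Proof.
move=> cf; have cd : {for z, continuous (cst d : K^o -> K^o)}.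
  exact: cst_continuous.
exact: (cvgM cf cd).
Qed.

Lemma continuous_at_id z : {for z, continuous (fun y : K^o => y)}.
Proof. exact: cvg_id. Qed.

Lemma continuous_at_div d z : z != 0 -> {for z, continuous (fun y : K^o => d / y : K^o)}.
Proof. by move=> z0; apply: continuous_atMl; exact: continuous_atV. Qed.

Lemma continuous_at_mull d z : {for z, continuous (fun y : K^o => d * y : K^o)}.
Proof. by apply: continuous_atMl; exact: continuous_at_id. Qed.

Lemma continuous_at_scaleX d z : {for z, continuous (fun y : K^o => d * y ^+ 2 : K^o)}.
Proof.
by apply: continuous_atMl; apply: continuous_atM; exact: continuous_at_id.
Qed.

Lemma continuous_at_comp f g z : {for z, continuous f} -> {for f z, continuous g} ->
  {for z, continuous (fun y => g (f y))}.
Proof. by move=> cf cg; exact: (@continuous_cvg _ K^o K^o _ _ f g _ cg cf). Qed.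

Lemma near_inv z (P : K -> Prop) : z != 0 ->
  (\forall y \near (z^-1 : K^o)^', P y) -> \forall y \near z^', P y^-1.
Proof.
move=> z0 Pw.
have {}Pw : \forall y \near (z^-1 : K^o), y != z^-1 -> P y by exact: Pw.
have {}Pw : \forall y \near z, y^-1 != z^-1 -> P y^-1 by exact: (continuous_atV z0 Pw).
have : \forall y \near z, y != z -> P y^-1.
  by apply: filterS Pw => y Py yw; apply: Py; apply: contra yw => /eqP/invr_inj ->.
exact.
Qed.

Lemma eq_of_punctured_near f g z :
  {for z, continuous f} -> {for z, continuous g} ->
  (\forall y \near z^', f y = g y) -> f z = g z.
Proof.
move=> /continuous_withinNx cF /continuous_withinNx cG FG.
have FG' : f @ z^' --> (g z : K^o).
  by apply: cvg_trans cG; apply: near_eq_cvg; apply: filterS FG => y.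
exact: (cvg_unique (@norm_hausdorff _ K^o) cF FG').
Qed.

Lemma neq0_near z : z != 0 -> \forall y \near z^', y != 0.
Proof. by move=> z0; apply: nbhs_dnbhs; exact: (cvgr_neq0 _ (@continuous_at_id z) z0). Qed.

End ContinuityNumField.

(** The cancellation between brackets and contractions. For p, a, b, w as in the exchange, q1, q2,
    q3, q4 are the q-products at p w / a, p w / b, p / (a w), p / (b w), which each Theta supplies
    and each contraction has in its denominator; q5, q6, q7, q8 are those at a / w, b / w, a w, b w;
    q9 is (p; p)_oo; r and r' are the rational factors. Both sides reduce to l r or l' r' times q5
    q6 q7 q8 q9^2. *)
Lemma contr_field_id (F : fieldType) (l l' r r' q1 q2 q3 q4 q5 q6 q7 q8 q9 : F) :
  q1 != 0 -> q2 != 0 -> q3 != 0 -> q4 != 0 -> l * r = l' * r' ->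
  l * (q5 * q1 * q9 * (q6 * q2 * q9)) * (q7 * q8 * (q1^-1 / q2) * r) =
  l' * (q7 * q3 * q9 * (q8 * q4 * q9)) * (q5 * q6 * (q3^-1 / q4) * r').
Proof.
move=> n1 n2 n3 n4 lr; transitivity (l * r * (q5 * q6 * q7 * q8 * q9 ^+ 2)).
  by field; rewrite n1 n2.
by rewrite lr; field; rewrite n3 n4.
Qed.

Section ContractionExchange.
Variable R : realType.
Local Notation C := (complex R).
Local Notation normc := ComplexField.Normc.normc.
Local Arguments normc : simpl never.
Variables p a b : C.
Hypotheses (p1 : normc p < 1) (a0 : a != 0) (b0 : b != 0).
Implicit Types (w z : C) (ds es : seq C).

(** The lists [ds] and [es] hold the reciprocals of the zeros and of the poles of the rational
    factor. *)
Definition contrG ds es w : C :=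
  qpoch (a * w) p * qpoch (b * w) p
  * ((qpoch (p / a * w) p)^-1 * (qpoch (p / b * w) p)^-1)
  * (\prod_(d <- ds) (1 - d * w) * (\prod_(e <- es) (1 - e * w))^-1).

Lemma contrG_continuation ds es (c : nat -> C) :
  (forall n, (0 < n)%N -> c n = n%:R^-1 *
     ((- a ^+ n - b ^+ n + (p / a) ^+ n + (p / b) ^+ n) / (1 - p ^+ n)
      - \sum_(d <- ds) d ^+ n + \sum_(e <- es) e ^+ n)) ->
  exp_continuation c (contrG ds es).
Proof.
move=> cE.
apply: exp_continuation_eq (exp_continuationM (exp_continuationM
  (exp_continuationM (exp_continuation_qpoch p1 a) (exp_continuation_qpoch p1 b))
  (exp_continuationM (exp_continuation_qpochV p1 (p / a)) (exp_continuation_qpochV p1 (p / b))))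
  (exp_continuationM (exp_continuation_prod ds) (exp_continuation_prodV es))); last by [].
move=> n n0; rewrite cE// /qlogc sumrN -!mulr_suml.
set A := \sum_(d <- ds) _; set B := \sum_(e <- es) _.
have nn : n%:R != 0 :> C by rewrite pnatr_eq0 -lt0n.
have pn := onem_expr_neq0 p1 n0.
set u := 1 - p ^+ n in pn *.
move: (a ^+ n) (b ^+ n) ((p / a) ^+ n) ((p / b) ^+ n) => a1 b1 a2 b2.
by field; rewrite nn pn.
Qed.

Lemma qpoch_continuous z : {for (z : C^o), continuous ((fun z => qpoch z p) : C^o -> C^o)}.
Proof.
have -> : (fun z => qpoch z p) = (fun z => qpoch (1 * z) p).
  by apply/funext => y; rewrite mul1r.
exact: holomorphic_at_continuous (qpoch_holomorphic p1 1 z).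
Qed.

Lemma Theta_continuous z : z != 0 -> {for (z : C^o), continuous (Theta p : C^o -> C^o)}.
Proof.
move=> z0; have ci := @continuous_at_div _ p z z0.
have cq := continuous_at_comp ci (@qpoch_continuous (p / z)).
exact: (@continuous_atMr _ _ (qpoch p p) z (continuous_atM (@qpoch_continuous z) cq)).
Qed.

Lemma prod_affine_neq0_near es w :
  \forall y \near (w : C^o)^', \prod_(e <- es) (1 - e * y) != 0.
Proof.
elim: es => [|e es IH].
  by apply: filterE => y; rewrite big_nil oner_neq0.
apply: (filterS2 _ _ IH (affine_neq0_near e w)) => y ys yi.
by rewrite big_cons mulf_neq0.
Qed.

Lemma contrG_exchange ds es ds' es' (l l' : C) w :
  w != 0 ->
  (forall w, w != 0 -> \prod_(e <- es) (1 - e * w) != 0 ->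
    \prod_(e <- es') (1 - e * w^-1) != 0 ->
    l * w ^+ 2 * (\prod_(d <- ds) (1 - d * w) * (\prod_(e <- es) (1 - e * w))^-1) =
    l' * (\prod_(d <- ds') (1 - d * w^-1) * (\prod_(e <- es') (1 - e * w^-1))^-1)) ->
  holomorphic_at (contrG ds es) w -> holomorphic_at (contrG ds' es') w^-1 ->
  l * w ^+ 2 * (Theta p (a / w) * Theta p (b / w)) * contrG ds es w =
  l' * (Theta p (a * w) * Theta p (b * w)) * contrG ds' es' w^-1.
Proof.
move=> w0 rat hG hG'.
(* By continuity it suffices to compare both sides near [w], away from the zeros
   of the denominators, where [contrG] takes the junk value 0. *)
have cG := holomorphic_at_continuous hG.
have cG' := holomorphic_at_continuous hG'.
have cTd (d : C) : d != 0 -> {for (w : C^o), continuous ((fun y => Theta p (d / y)) : C^o -> C^o)}.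
  move=> d0; have dw : d / w != 0 by rewrite mulf_neq0 ?invr_eq0.
  exact: (continuous_at_comp (@continuous_at_div _ d w w0) (Theta_continuous dw)).
have cTm (d : C) : d != 0 -> {for (w : C^o), continuous ((fun y => Theta p (d * y)) : C^o -> C^o)}.
  move=> d0; have dw : d * w != 0 by rewrite mulf_neq0.
  exact: (continuous_at_comp (@continuous_at_mull _ d w) (Theta_continuous dw)).
have cGi := continuous_at_comp (continuous_atV w0) cG'.
have cL := continuous_atM (continuous_atM (@continuous_at_scaleX _ l w)
  (continuous_atM (cTd a a0) (cTd b b0))) cG.
have cR := continuous_atM (@continuous_atMl _ _ l' w (continuous_atM (cTm a a0) (cTm b b0))) cGi.
apply: (eq_of_punctured_near cL cR).
have wi : w^-1 != 0 by rewrite invr_eq0.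
have n1 := neq0_near w0.
have n2 := prod_affine_neq0_near es w.
have n3 := near_inv w0 (prod_affine_neq0_near es' w^-1).
have n4 := qpoch_neq0_near p1 (p / a) w.
have n5 := qpoch_neq0_near p1 (p / b) w.
have n6 := near_inv w0 (qpoch_neq0_near p1 (p / a) w^-1).
have n7 := near_inv w0 (qpoch_neq0_near p1 (p / b) w^-1).
apply: (filterS3 _ _ n1 (filterI n2 n3) (filterI (filterI n4 n5) (filterI n6 n7))).
move=> y y0 [es0 es'0] [[qa qb] [qa' qb']].
have := rat y y0 es0 es'0.
rewrite /contrG /Theta.
have -> : p / (a / y) = p / a * y by field; rewrite a0 y0.
have -> : p / (b / y) = p / b * y by field; rewrite b0 y0.
have -> : p / (a * y) = p / a * y^-1 by field; rewrite a0 y0.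
have -> : p / (b * y) = p / b * y^-1 by field; rewrite b0 y0.
exact: contr_field_id.
Qed.

End ContractionExchange.

(** * Contractions of the currents *)

(** For q = x - x^-1, [qbr q] sends x^a to [a]. With the powers x^a as independent variables,
    identities between the [a] become rational identities. *)
Definition qbr (F : fieldType) (q a : F) : F := (a - a^-1) / q.

(* In this section q, X, S, K, T stand for x - x^{-1}, x^m, x^{sm}, x^{km/2}, and
   x^{r^* m} (in contrEE) or x^{rm} (in contrFF). *)
Section ContractionIdentities.
Variable F : fieldType.
Variables (q X S K T m : F).
Hypotheses (q0 : q != 0) (X0 : X != 0) (S0 : S != 0) (K0 : K != 0) (T0 : T != 0)
  (m0 : m != 0).
Local Notation br := (qbr q).
Hypotheses (XX : X + X^-1 != 0) (KK : br (K ^+ 2) != 0) (TT : 1 - T ^+ 2 != 0).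

(** [c] is c_m; [gam] and [gam'] are the commutators of the gamma modes of index m and -m for equal
    and for different nodes. *)
Let c := (K ^+ 2 * X + (K ^+ 2 * X)^-1) / (X + X^-1).
Let gam := m^-1 * (br (X ^+ 2) / br (K ^+ 2)).
Let gam' := - m^-1 * ((br S + br (S / X ^+ 2)) / br (K ^+ 2)).

Let X2 : X * X + 1 != 0.
Proof. by have -> : X * X + 1 = X * (X + X^-1) by [field]; rewrite mulf_neq0. Qed.

Let K4 : (K * K) ^+ 2 - 1 != 0.
Proof.
apply: contraNneq KK => e; rewrite /qbr.
have -> : (K ^+ 2 - K ^- 2) / q = ((K * K) ^+ 2 - 1) / (K ^+ 2 * q).
  by field; rewrite q0 K0.
by rewrite e mul0r.
Qed.

Let T2 : T * T - 1 != 0.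
Proof. by rewrite -oppr_eq0 opprB -expr2. Qed.

Local Ltac fld := rewrite ?/gam ?/gam' ?/c ?/qbr; field;
  rewrite ?q0 ?X0 ?S0 ?K0 ?T0 ?m0 ?X2 ?K4 ?T2 ?TT.

(** This relation lets the betas complete a product of two gamma coefficients c_m to 1, whenever the
    branches pair an annihilation beta with a creation beta. *)
Lemma cfac_sqr :
  c ^+ 2 - (q / (X + X^-1)) ^+ 2 * (br (K ^+ 2) * br (K ^+ 2 * X ^+ 2)) = 1.
Proof. by fld. Qed.

(** For E E and F F the gamma commutator has coefficient c_m if the branches agree and x^(km) or
    x^(-km) if they differ. This identity and the next three say that the difference consists of
    finitely many terms e^m / m, that is, of a rational factor of the contraction. *)
Lemma gam_Km : gam / K ^+ 2 = c * gam + m^-1 * (1 - X ^+ 2).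
Proof. by fld. Qed.

Lemma gam_Kp : gam * K ^+ 2 = c * gam + m^-1 * (1 - X ^- 2).
Proof. by fld. Qed.

Lemma gam'_Km : gam' / K ^+ 2 = c * gam' + m^-1 * (S - X ^+ 2 / S).
Proof. by fld. Qed.

Lemma gam'_Kp : gam' * K ^+ 2 = c * gam' - m^-1 * (S / X ^+ 2 - S^-1).
Proof. by fld. Qed.

(** In this identity and the five that follow, the quotient by 1 - T^2 has numerator - a^m - b^m +
    (p/a)^m + (p/b)^m with p^m = T^2, hence yields the q-products of [contrG]; the other terms yield
    poles of its rational factor. The pair a, b is 1, x^-2 here, x^s, x^(2-s) for E and different
    nodes, 1, x^2 for F and equal nodes, and x^-s, x^(s-2) for F and different nodes. *)
Lemma contrEE_jj :
  - m^-1 * (br (X ^+ 2) * br (T * K ^+ 2) / (br (K ^+ 2) * br T)) + c * gam =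
  m^-1 * ((- 1 - X ^- 2 + T ^+ 2 + T ^+ 2 * X ^+ 2) / (1 - T ^+ 2) + X ^+ 2 + X ^- 2).
Proof. by fld. Qed.

Lemma contrEE_12 :
  m^-1 * (T^-1 * (br S - br (S / X ^+ 2)) / br T
          + K ^+ 2 * (br S + br (S / X ^+ 2)) / br (K ^+ 2)) + c * gam' =
  m^-1 * ((- S - X ^+ 2 / S + T ^+ 2 / S + T ^+ 2 * S / X ^+ 2) / (1 - T ^+ 2)
          + S / X ^+ 2 + S / X ^+ 2).
Proof. by fld. Qed.

Lemma contrEE_21 :
  m^-1 * (T * (br S - br (S / X ^+ 2)) / br T
          + K ^- 2 * (br S + br (S / X ^+ 2)) / br (K ^+ 2)) + c * gam' =
  m^-1 * ((- S - X ^+ 2 / S + T ^+ 2 / S + T ^+ 2 * S / X ^+ 2) / (1 - T ^+ 2)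
          + X ^+ 2 / S + X ^+ 2 / S).
Proof. by fld. Qed.

Lemma contrFF_jj :
  - m^-1 * (br (X ^+ 2) * br (T / K ^+ 2) / (br (K ^+ 2) * br T)) + c * gam =
  m^-1 * ((- 1 - X ^+ 2 + T ^+ 2 + T ^+ 2 / X ^+ 2) / (1 - T ^+ 2) + X ^+ 2 + X ^- 2).
Proof. by fld. Qed.

Lemma contrFF_12 :
  m^-1 * (T * (- br S + br (S / X ^+ 2)) / br T
          + K ^+ 2 * (br S + br (S / X ^+ 2)) / br (K ^+ 2)) + c * gam' =
  m^-1 * ((- S^-1 - S / X ^+ 2 + T ^+ 2 * S + T ^+ 2 * X ^+ 2 / S) / (1 - T ^+ 2)
          + S / X ^+ 2 + S / X ^+ 2).
Proof. by fld. Qed.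

Lemma contrFF_21 :
  m^-1 * (T^-1 * (- br S + br (S / X ^+ 2)) / br T
          + K ^- 2 * (br S + br (S / X ^+ 2)) / br (K ^+ 2)) + c * gam' =
  m^-1 * ((- S^-1 - S / X ^+ 2 + T ^+ 2 * S + T ^+ 2 * X ^+ 2 / S) / (1 - T ^+ 2)
          + X ^+ 2 / S + X ^+ 2 / S).
Proof. by fld. Qed.

Lemma contrEF_I : gam - K ^+ 2 * (c * gam) = m^-1 * (K ^+ 2 - K ^+ 2 * X ^+ 2).
Proof. by fld. Qed.

Lemma contrEF_II : gam - K ^- 2 * (c * gam) = m^-1 * (K ^- 2 - K ^- 2 * X ^- 2).
Proof. by fld. Qed.

End ContractionIdentities.

Section Contractions.
Variables (R : realType) (P : params R).
Local Notation C := (complex R).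
Local Notation normc := ComplexField.Normc.normc.
Local Arguments normc : simpl never.
Local Notation r := (pr P).
Local Notation rs := (prs P).
Local Notation s := (ps P).
Local Notation k := (pk P).
Local Notation xpow := (xpow P).
Local Notation x := (xx P).
Local Notation qint := (qint P).

Local Arguments bcomm : simpl never.

Lemma xpowD a b : xpow (a + b) = xpow a * xpow b.
Proof. by rewrite /Defs.xpow mulrDl cexpD. Qed.

Lemma xpow0 : xpow 0 = 1.
Proof. by rewrite /Defs.xpow mul0r cexp0. Qed.

Lemma xpow_neq0 a : xpow a != 0. Proof. exact: cexp_neq0. Qed.

Lemma xpowN a : xpow (- a) = (xpow a)^-1.
Proof. by rewrite /Defs.xpow mulNr cexpN. Qed.

Lemma xpowB a b : xpow (a - b) = xpow a / xpow b.
Proof. by rewrite xpowD xpowN. Qed.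

Lemma xpowMn a n : xpow (a * n%:R) = xpow a ^+ n.
Proof.
elim: n => [|n IH]; first by rewrite mulr0 xpow0 expr0.
by rewrite -natr1 mulrDr mulr1 xpowD IH exprSr.
Qed.

Lemma xpow_double a : xpow (2 * a) = xpow a ^+ 2.
Proof. by rewrite mulrC xpowMn. Qed.

Lemma sum_at (a : boson) (c : C) (f : boson -> C) :
  \sum_b at_ a b c * f b = c * f a.
Proof.
rewrite (bigD1 a)//= /at_ eqxx big1 ?addr0// => b /negbTE ->.
by rewrite mul0r.
Qed.

Definition isalpha (a : kind) := if a is (Kalpha | Ktalpha) then true else false.

(** Each current involves one alpha kind, beta and gamma at a single node. Of the nine pairings of
    kinds only three survive, as modes of alpha type, betas and gammas commute with one another. *)
Lemma contr_decomp (V W : vop R) n a1 a2 i j c0 c1 c2 d0 d1 d2 :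
  isalpha a1 -> isalpha a2 ->
  (forall b, vpos V b n = at_ (a1, i) b c0 + at_ (Kbeta, i) b c1 + at_ (Kgamma, i) b c2) ->
  (forall b, vneg W b n = at_ (a2, j) b d0 + at_ (Kbeta, j) b d1 + at_ (Kgamma, j) b d2) ->
  contr P V W n = c0 * d0 * bcomm P (a1, i) (a2, j) n
    + c1 * d1 * bcomm P (Kbeta, i) (Kbeta, j) n
    + c2 * d2 * bcomm P (Kgamma, i) (Kgamma, j) n.
Proof.
move=> a1P a2P vP wP; rewrite /contr.
have in1 a : \sum_b vpos V a n * vneg W b n * bcomm P a b n =
    vpos V a n * (d0 * bcomm P a (a2, j) n + d1 * bcomm P a (Kbeta, j) n
       + d2 * bcomm P a (Kgamma, j) n).
  rewrite -(sum_at (a2, j) d0 (fun b => bcomm P a b n)).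
  rewrite -(sum_at (Kbeta, j) d1 (fun b => bcomm P a b n)).
  rewrite -(sum_at (Kgamma, j) d2 (fun b => bcomm P a b n)).
  rewrite -!big_split mulr_sumr; apply: eq_bigr => b _.
  by rewrite /= -!mulrDl -wP mulrA.
rewrite (eq_bigr _ (fun a _ => in1 a)).
under eq_bigr => a _ do rewrite vP 2!mulrDl.
rewrite !big_split /= !sum_at.
have z a u v : isalpha a -> [/\ bcomm P (a, u) (Kbeta, v) n = 0,
    bcomm P (a, u) (Kgamma, v) n = 0, bcomm P (Kbeta, u) (a, v) n = 0 &
    bcomm P (Kgamma, u) (a, v) n = 0] by case: a.
have [z1 z2 _ _] := z a1 i j a1P; have [_ _ z3 z4] := z a2 i j a2P.
have z5 : bcomm P (Kbeta, i) (Kgamma, j) n = 0 by [].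
have z6 : bcomm P (Kgamma, i) (Kbeta, j) n = 0 by [].
rewrite z1 z2 z3 z4 z5 z6.
ring.
Qed.

(** The factor is the same for equal and for different nodes, so the betas can be absorbed into the
    gammas uniformly in i and j. *)
Lemma bcomm_beta i j n : (0 < n)%N -> qint (k * n%:R) != 0 ->
  bcomm P (Kbeta, i) (Kbeta, j) n =
  qint (k * n%:R) * qint ((k + 2) * n%:R) * bcomm P (Kgamma, i) (Kgamma, j) n.
Proof.
move=> n0 kn; rewrite /bcomm -pmulrn; have n0' : n%:R != 0 :> C by rewrite pnatr_eq0 -lt0n.
by case: eqP => _; field; rewrite kn n0'.
Qed.

Local Notation q := (x - x^-1).

(* Coefficients of the beta and gamma modes in the currents. *)
Definition posE c (m : C) : C * C := match c with
  | CI => (- (q * (xpow (k * m / 2) / qplus P m)), - (xpow (k * m / 2) * cfac P m))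
  | CII => (0, - xpow (- (k * m / 2))) end.

Definition negE c (m : C) : C * C := match c with
  | CI => (0, - xpow (- (k * m / 2)))
  | CII => (q * (xpow (k * m / 2) / qplus P m), - (xpow (k * m / 2) * cfac P m)) end.

Definition posF c (m : C) : C * C := match c with
  | CI => (q * (xpow (- (k * m / 2)) / qplus P m), xpow (- (k * m / 2)) * cfac P m)
  | CII => (0, xpow (k * m / 2)) end.

Definition negF c (m : C) : C * C := match c with
  | CI => (0, xpow (k * m / 2))
  | CII => (- (q * (xpow (- (k * m / 2)) / qplus P m)), xpow (- (k * m / 2)) * cfac P m) end.

Lemma at_0 (a b : boson) : at_ a b 0 = 0 :> C.
Proof. by rewrite /at_; case: ifP. Qed.

Lemma vposE j c b n : vpos (EV P j c) b n =
  at_ (Kalpha, j) b (- 1) + at_ (Kbeta, j) b (posE c n%:R).1 + at_ (Kgamma, j) b (posE c n%:R).2.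
Proof. by case: j; case: c; rewrite /= ?at_0 !add0r ?addr0 ?addrA. Qed.

Lemma vnegE j c b n : vneg (EV P j c) b n =
  at_ (Kalpha, j) b (- 1) + at_ (Kbeta, j) b (negE c n%:R).1 + at_ (Kgamma, j) b (negE c n%:R).2.
Proof. by case: j; case: c; rewrite /= ?at_0 !add0r ?addr0 ?addrA. Qed.

Lemma vposF j c b n : vpos (FV P j c) b n =
  at_ (Ktalpha, j) b 1 + at_ (Kbeta, j) b (posF c n%:R).1 + at_ (Kgamma, j) b (posF c n%:R).2.
Proof. by case: j; case: c; rewrite /= ?at_0 !add0r ?addr0 ?addrA. Qed.

Lemma vnegF j c b n : vneg (FV P j c) b n =
  at_ (Ktalpha, j) b 1 + at_ (Kbeta, j) b (negF c n%:R).1 + at_ (Kgamma, j) b (negF c n%:R).2.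
Proof. by case: j; case: c; rewrite /= ?at_0 !add0r ?addr0 ?addrA. Qed.

Hypotheses (hx1 : normc x < 1) (hpr : normc (xpow (2 * r)) < 1)
  (hprs : normc (xpow (2 * rs)) < 1)
  (hkm : forall n, (0 < n)%N -> qint (k * n%:R) != 0).

Lemma x_neq0 : x != 0. Proof. exact: xpow_neq0. Qed.

Lemma xpow_nat n : xpow n%:R = x ^+ n.
Proof. by rewrite -[n%:R]mul1r xpowMn. Qed.

Lemma q_neq0 : q != 0.
Proof.
have x2 : 1 - x ^+ 2 != 0 by exact: onem_expr_neq0.
have x0 := x_neq0.
apply: contra_neq x2 => e; have -> : 1 - x ^+ 2 = - (x - x^-1) * x by [field].
by rewrite e oppr0 mul0r.
Qed.

Section FixedMode.
Variable n : nat.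
Hypothesis n0 : (0 < n)%N.
Local Notation m := (n%:R : C).
Local Notation X := (xpow m).
Local Notation S := (xpow (s * m)).
Local Notation K := (xpow (k * m / 2)).
Local Notation br := (qbr (q : C)).
Local Notation cf := ((K ^+ 2 * X + (K ^+ 2 * X)^-1) / (X + X^-1)).
Local Notation gam := (m^-1 * (br (X ^+ 2) / br (K ^+ 2))).
Local Notation gam' := (- m^-1 * ((br S + br (S / X ^+ 2)) / br (K ^+ 2))).

Lemma m_neq0 : m != 0. Proof. by rewrite pnatr_eq0 -lt0n. Qed.

Lemma plus_neq0 : X + X^-1 != 0.
Proof.
have := onem_expr_neq0 hx1 (n := n * 4); rewrite muln_gt0 n0 => /(_ isT).
have X0 := xpow_neq0 m.
apply: contra_neq => e; rewrite exprM -xpow_nat.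
by have -> : 1 - X ^+ 4 = (X + X^-1) * (X * (1 - X ^+ 2)) by [field]; rewrite e mul0r.
Qed.

Lemma xpow_km : xpow (k * m) = K ^+ 2.
Proof. by rewrite -xpowMn; congr xpow; field. Qed.

Lemma qintE a : qint a = br (xpow a).
Proof. by rewrite /Defs.qint xpowN. Qed.

Lemma qint_km : qint (k * m) = br (K ^+ 2). Proof. by rewrite qintE xpow_km. Qed.

Lemma brK_neq0 : br (K ^+ 2) != 0. Proof. by rewrite -qint_km hkm. Qed.

Lemma qint_2m : qint (2 * m) = br (X ^+ 2). Proof. by rewrite qintE xpow_double. Qed.

Lemma qint_sm : qint (s * m) = br S. Proof. exact: qintE. Qed.

Lemma qint_s2m : qint ((s - 2) * m) = br (S / X ^+ 2).
Proof. by rewrite qintE mulrBl xpowB xpow_double. Qed.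

Lemma qint_k2m : qint ((k + 2) * m) = br (K ^+ 2 * X ^+ 2).
Proof. by rewrite qintE mulrDl xpowD xpow_km xpow_double. Qed.

Lemma qplusE : qplus P m = X + X^-1. Proof. by rewrite /qplus xpowN. Qed.

Lemma cfacE : cfac P m = cf.
Proof.
rewrite /cfac qplusE /qplus.
have -> : (k + 1) * m = k * m + m by rewrite mulrDl mul1r.
by rewrite xpowN xpowD xpow_km.
Qed.

Lemma bcomm_gamma i j : bcomm P (Kgamma, i) (Kgamma, j) n = if i == j then gam else gam'.
Proof. by rewrite /bcomm -pmulrn qint_2m qint_km qint_sm qint_s2m. Qed.

(** The coefficient of the gamma commutator in a contraction once the betas are absorbed, with c the
    branch of the left operator; [coefF], [coefEF] and [coefFE] are its analogues for the other
    pairs of currents. *)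
Definition coefE c d := match c, d with
  | CI, CII => K ^+ 2 | CII, CI => K ^- 2 | _, _ => cf end.

Definition coefF c d := match c, d with
  | CI, CII => K ^- 2 | CII, CI => K ^+ 2 | _, _ => cf end.

Definition coefEF c d := match c, d with
  | CI, CI => - (K ^+ 2 * cf) | CII, CII => - (K ^- 2 * cf) | _, _ => - 1 end.

Definition coefFE c d := match c, d with
  | CI, CI => - (K ^- 2 * cf) | CII, CII => - (K ^+ 2 * cf) | _, _ => - 1 end.

Let sqc : cf ^+ 2 = 1 + (q / (X + X^-1)) ^+ 2 * (br (K ^+ 2) * br (K ^+ 2 * X ^+ 2)).
Proof.
apply/eqP; rewrite -subr_eq; apply/eqP.
exact: (cfac_sqr q_neq0 (xpow_neq0 m) (xpow_neq0 _) plus_neq0).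
Qed.

Lemma contr_EE i j c d : contr P (EV P i c) (EV P j d) n =
  bcomm P (Kalpha, i) (Kalpha, j) n + coefE c d * bcomm P (Kgamma, i) (Kgamma, j) n.
Proof.
rewrite (contr_decomp (a1 := Kalpha) (a2 := Kalpha) _ _ (fun b => vposE i c b n) (fun b => vnegE j d b n))//.
rewrite bcomm_beta ?hkm// mulrNN !mul1r -addrA; congr (_ + _).
rewrite [_ * (_ * _ * _)]mulrA -mulrDl; congr (_ * _).
rewrite qint_km qint_k2m.
have K0 := xpow_neq0 (k * m / 2).
have := sqc; have := plus_neq0.
case: c; case: d; rewrite /= ?qplusE ?cfacE ?xpowN ?mul0r ?mulr0 ?add0r.
- by move: cf => cc _ _; field.
- move: cf => cc Xn0 e.
  transitivity (K ^+ 2 * (cc ^+ 2 - (q / (X + X^-1)) ^+ 2 * (br (K ^+ 2) * br (K ^+ 2 * X ^+ 2)))).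
    by ring.
  by rewrite e addrK mulr1.
- by move: cf => cc _ _; field.
- by move: cf => cc _ _; field.
Qed.

Lemma contr_FF i j c d : contr P (FV P i c) (FV P j d) n =
  bcomm P (Ktalpha, i) (Ktalpha, j) n + coefF c d * bcomm P (Kgamma, i) (Kgamma, j) n.
Proof.
rewrite (contr_decomp (a1 := Ktalpha) (a2 := Ktalpha) _ _ (fun b => vposF i c b n) (fun b => vnegF j d b n))//.
rewrite bcomm_beta ?hkm// !mul1r -addrA; congr (_ + _).
rewrite [_ * (_ * _ * _)]mulrA -mulrDl; congr (_ * _).
rewrite qint_km qint_k2m.
have K0 := xpow_neq0 (k * m / 2).
have := sqc; have := plus_neq0.
case: c; case: d; rewrite /= ?qplusE ?cfacE ?xpowN ?mul0r ?mulr0 ?add0r.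
- by move: cf => cc _ _; field.
- move: cf => cc Xn0 e.
  transitivity (K ^- 2 * (cc ^+ 2 - (q / (X + X^-1)) ^+ 2 * (br (K ^+ 2) * br (K ^+ 2 * X ^+ 2)))).
    move: (qbr _ _) (qbr _ _) (X + X^-1) Xn0 => b1 b2 X1 X10.
    by field; rewrite K0 X10 x_neq0.
  by rewrite e addrK mulr1.
- by move: cf => cc _ _; field.
- by move: cf => cc _ _; field.
Qed.

Lemma contr_EF i j c d : contr P (EV P i c) (FV P j d) n =
  - bcomm P (Kalpha, i) (Ktalpha, j) n + coefEF c d * bcomm P (Kgamma, i) (Kgamma, j) n.
Proof.
rewrite (contr_decomp (a1 := Kalpha) (a2 := Ktalpha) _ _ (fun b => vposE i c b n) (fun b => vnegF j d b n))//.
rewrite bcomm_beta ?hkm// mulr1 mulN1r -addrA; congr (_ + _).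
rewrite [_ * (_ * _ * _)]mulrA -mulrDl; congr (_ * _).
rewrite qint_km qint_k2m.
have K0 := xpow_neq0 (k * m / 2).
have := sqc; have := plus_neq0.
case: c; case: d; rewrite /= ?qplusE ?cfacE ?xpowN ?mul0r ?mulr0 ?add0r.
- by move: cf => cc _ _; field.
- move: cf => cc Xn0 e.
  transitivity (- (cc ^+ 2 - (q / (X + X^-1)) ^+ 2 * (br (K ^+ 2) * br (K ^+ 2 * X ^+ 2)))).
    move: (qbr _ _) (qbr _ _) (X + X^-1) Xn0 => b1 b2 X1 X10.
    by field; rewrite K0 X10 x_neq0.
  by rewrite e addrK.
- by move: cf => cc _ _; field.
- by move: cf => cc _ _; field.
Qed.

Lemma contr_FE i j c d : contr P (FV P i c) (EV P j d) n =
  - bcomm P (Ktalpha, i) (Kalpha, j) n + coefFE c d * bcomm P (Kgamma, i) (Kgamma, j) n.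
Proof.
rewrite (contr_decomp (a1 := Ktalpha) (a2 := Kalpha) _ _ (fun b => vposF i c b n) (fun b => vnegE j d b n))//.
rewrite bcomm_beta ?hkm// mul1r mulN1r -addrA; congr (_ + _).
rewrite [_ * (_ * _ * _)]mulrA -mulrDl; congr (_ * _).
rewrite qint_km qint_k2m.
have K0 := xpow_neq0 (k * m / 2).
have := sqc; have := plus_neq0.
case: c; case: d; rewrite /= ?qplusE ?cfacE ?xpowN ?mul0r ?mulr0 ?add0r.
- by move: cf => cc _ _; field.
- move: cf => cc Xn0 e.
  transitivity (- (cc ^+ 2 - (q / (X + X^-1)) ^+ 2 * (br (K ^+ 2) * br (K ^+ 2 * X ^+ 2)))).
    move: (qbr _ _) (qbr _ _) (X + X^-1) Xn0 => b1 b2 X1 X10.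
    by field; rewrite K0 X10 x_neq0.
  by rewrite e addrK.
- by move: cf => cc _ _; field.
- by move: cf => cc _ _; field.
Qed.

End FixedMode.
End Contractions.

(** * Contractions as q-products with lists of zeros and poles *)

Section ContractionLists.
Variables (R : realType) (P : params R).
Local Notation C := (complex R).
Local Notation normc := ComplexField.Normc.normc.
Local Arguments normc : simpl never.
Local Arguments bcomm : simpl never.
Local Notation r := (pr P).
Local Notation rs := (prs P).
Local Notation s := (ps P).
Local Notation k := (pk P).
Local Notation xpow := (xpow P).
Local Notation x := (xx P).
Local Notation qint := (qint P).
Local Notation q := (x - x^-1).

Hypotheses (hx1 : normc x < 1) (hpr : normc (xpow (2 * r)) < 1)
  (hprs : normc (xpow (2 * rs)) < 1)
  (hkm : forall n, (0 < n)%N -> qint (k * n%:R) != 0).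

(** Zeros or poles peculiar to two different branches: [u] for II, I and [v] for I, II. Pairs of
    equal branches have none. *)
Definition offdiag (u v : C) c d : seq C :=
  match c, d with CII, CI => [:: u] | CI, CII => [:: v] | _, _ => [::] end.

Section FixedMode.
Variable n : nat.
Hypothesis n0 : (0 < n)%N.
Local Notation m := (n%:R : C).
Local Notation X := (xpow m).
Local Notation S := (xpow (s * m)).
Local Notation K := (xpow (k * m / 2)).
Local Notation cf := ((K ^+ 2 * X + (K ^+ 2 * X)^-1) / (X + X^-1)).

Lemma xpowX0 : xpow 0 ^+ n = 1. Proof. by rewrite xpow0 expr1n. Qed.
Lemma xpowX2 : xpow 2 ^+ n = X ^+ 2. Proof. by rewrite -xpowMn xpow_double. Qed.
Lemma xpowXN2 : xpow (- 2) ^+ n = X ^- 2. Proof. by rewrite xpowN exprVn xpowX2. Qed.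
Lemma xpowXs : xpow s ^+ n = S. Proof. by rewrite xpowMn. Qed.
Lemma xpowXNs : xpow (- s) ^+ n = S^-1. Proof. by rewrite xpowN exprVn xpowXs. Qed.
Lemma xpowXs2 : xpow (s - 2) ^+ n = S / X ^+ 2.
Proof. by rewrite xpowB expr_div_n xpowXs xpowX2. Qed.
Lemma xpowX2s : xpow (2 - s) ^+ n = X ^+ 2 / S.
Proof. by rewrite xpowB expr_div_n xpowXs xpowX2. Qed.
Definition xpowXE := (xpowX0, xpowX2, xpowXN2, xpowXs, xpowXNs, xpowXs2, xpowX2s).

Lemma sum_offdiag u v c d : \sum_(e <- offdiag u v c d) e ^+ n =
  match c, d with CII, CI => u ^+ n | CI, CII => v ^+ n | _, _ => 0 end.
Proof. by case: c; case: d; rewrite /= ?big_nil ?big_seq1. Qed.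

Lemma coefE_gam_same j c d :
  coefE P n c d * bcomm P (Kgamma, j) (Kgamma, j) n = cf * bcomm P (Kgamma, j) (Kgamma, j) n
   + m^-1 * (\sum_(e <- offdiag (xpow 0) (xpow 0) c d) e ^+ n
             - \sum_(e <- offdiag (xpow 2) (xpow (- 2)) c d) e ^+ n).
Proof.
have [[q0 X0] K0] := (q_neq0 hx1, xpow_neq0 P m, xpow_neq0 P (k * m / 2)).
have [[m0 pl] bk] := (m_neq0 R n0, plus_neq0 hx1 n0, brK_neq0 hkm n0).
rewrite bcomm_gamma eqxx !sum_offdiag !xpowXE.
case: c; case: d => /=; rewrite ?subrr ?mulr0 ?addr0//.
  by rewrite -(gam_Kp q0 X0 K0 m0 pl bk) mulrC.
by rewrite -(gam_Km q0 X0 K0 m0 pl bk) mulrC.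
Qed.

Lemma coefF_gam_same j c d :
  coefF P n c d * bcomm P (Kgamma, j) (Kgamma, j) n = cf * bcomm P (Kgamma, j) (Kgamma, j) n
   + m^-1 * (\sum_(e <- offdiag (xpow 0) (xpow 0) c d) e ^+ n
             - \sum_(e <- offdiag (xpow (- 2)) (xpow 2) c d) e ^+ n).
Proof.
have [[q0 X0] K0] := (q_neq0 hx1, xpow_neq0 P m, xpow_neq0 P (k * m / 2)).
have [[m0 pl] bk] := (m_neq0 R n0, plus_neq0 hx1 n0, brK_neq0 hkm n0).
rewrite bcomm_gamma eqxx !sum_offdiag !xpowXE.
case: c; case: d => /=; rewrite ?subrr ?mulr0 ?addr0//.
  by rewrite -(gam_Km q0 X0 K0 m0 pl bk) mulrC.
by rewrite -(gam_Kp q0 X0 K0 m0 pl bk) mulrC.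
Qed.

Lemma coefE_gam_diff i j c d : i != j ->
  coefE P n c d * bcomm P (Kgamma, i) (Kgamma, j) n = cf * bcomm P (Kgamma, i) (Kgamma, j) n
   + m^-1 * (\sum_(e <- offdiag (xpow s) (xpow (- s)) c d) e ^+ n
             - \sum_(e <- offdiag (xpow (2 - s)) (xpow (s - 2)) c d) e ^+ n).
Proof.
move=> /negbTE ij.
have [[q0 X0] K0] := (q_neq0 hx1, xpow_neq0 P m, xpow_neq0 P (k * m / 2)).
have [[m0 pl] bk] := (m_neq0 R n0, plus_neq0 hx1 n0, brK_neq0 hkm n0).
have S0 := xpow_neq0 P (s * m).
rewrite bcomm_gamma ij !sum_offdiag !xpowXE.
case: c; case: d => /=; rewrite ?subrr ?mulr0 ?addr0//.
  by rewrite -[S^-1 - _]opprB mulrN -(gam'_Kp q0 X0 S0 K0 m0 pl bk) mulrC.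
by rewrite -(gam'_Km q0 X0 S0 K0 m0 pl bk) mulrC.
Qed.

Lemma coefF_gam_diff i j c d : i != j ->
  coefF P n c d * bcomm P (Kgamma, i) (Kgamma, j) n = cf * bcomm P (Kgamma, i) (Kgamma, j) n
   + m^-1 * (\sum_(e <- offdiag (xpow (- s)) (xpow s) c d) e ^+ n
             - \sum_(e <- offdiag (xpow (s - 2)) (xpow (2 - s)) c d) e ^+ n).
Proof.
move=> /negbTE ij.
have [[q0 X0] K0] := (q_neq0 hx1, xpow_neq0 P m, xpow_neq0 P (k * m / 2)).
have [[m0 pl] bk] := (m_neq0 R n0, plus_neq0 hx1 n0, brK_neq0 hkm n0).
have S0 := xpow_neq0 P (s * m).
rewrite bcomm_gamma ij !sum_offdiag !xpowXE.
case: c; case: d => /=; rewrite ?subrr ?mulr0 ?addr0//.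
  by rewrite -(gam'_Km q0 X0 S0 K0 m0 pl bk) mulrC.
by rewrite -[S^-1 - _]opprB mulrN -(gam'_Kp q0 X0 S0 K0 m0 pl bk) mulrC.
Qed.

Local Notation Ts := (xpow (rs * m)).
Local Notation Tr := (xpow (r * m)).

Lemma Ts2_neq1 : 1 - Ts ^+ 2 != 0.
Proof.
have := onem_expr_neq0 hprs n0.
by rewrite -xpowMn -mulrA xpow_double.
Qed.

Lemma Tr2_neq1 : 1 - Tr ^+ 2 != 0.
Proof.
have := onem_expr_neq0 hpr n0.
by rewrite -xpowMn -mulrA xpow_double.
Qed.

Lemma TrE : Tr = Ts * K ^+ 2.
Proof. by rewrite -(xpow_km P n) -xpowD -mulrDl /pk addrC subrK. Qed.

Lemma TsE : Ts = Tr / K ^+ 2.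
Proof. by rewrite TrE mulfK// expf_neq0// xpow_neq0. Qed.

(** The right-hand side has the shape asked by [contrG_continuation], with a = x^0 and b = x^-2. The
    poles coming from x^2 and x^-2 belong to all branches, the [offdiag] ones to the correction of
    [coefE_gam_same]. *)
Lemma contrE_same j c d : contr P (EV P j c) (EV P j d) n = m^-1 *
  ((- xpow 0 ^+ n - xpow (- 2) ^+ n + (xpow (2 * rs) / xpow 0) ^+ n
    + (xpow (2 * rs) / xpow (- 2)) ^+ n) / (1 - xpow (2 * rs) ^+ n)
   - \sum_(e <- offdiag (xpow 2) (xpow (- 2)) c d) e ^+ n
   + \sum_(e <- [:: xpow 2, xpow (- 2) & offdiag (xpow 0) (xpow 0) c d]) e ^+ n).
Proof.
have [[q0 X0] K0] := (q_neq0 hx1, xpow_neq0 P m, xpow_neq0 P (k * m / 2)).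
have [[m0 pl] bk] := (m_neq0 R n0, plus_neq0 hx1 n0, brK_neq0 hkm n0).
rewrite contr_EE// coefE_gam_same addrA.
have -> : bcomm P (Kalpha, j) (Kalpha, j) n =
    - m^-1 * (qbr q (X ^+ 2) * qbr q (Ts * K ^+ 2) / (qbr q (K ^+ 2) * qbr q Ts)).
  rewrite -TrE -(qint_2m P n) -(qint_km P n) -!(qintE P (_ * m)).
  have -> : qint (rs * m) = qint ((r - k) * m) by rewrite /pk subKr.
  by case: j.
rewrite bcomm_gamma eqxx (contrEE_jj q0 X0 K0 (xpow_neq0 P _) m0 pl bk Ts2_neq1).
rewrite -mulrDr; congr (_ * _).
rewrite !big_cons !expr_div_n !xpowXE.
have -> : xpow (2 * rs) ^+ n = Ts ^+ 2 by rewrite -xpowMn -mulrA xpow_double.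
rewrite divr1 invrK; ring.
Qed.

Lemma contrF_same j c d : contr P (FV P j c) (FV P j d) n = m^-1 *
  ((- xpow 0 ^+ n - xpow 2 ^+ n + (xpow (2 * r) / xpow 0) ^+ n
    + (xpow (2 * r) / xpow 2) ^+ n) / (1 - xpow (2 * r) ^+ n)
   - \sum_(e <- offdiag (xpow (- 2)) (xpow 2) c d) e ^+ n
   + \sum_(e <- [:: xpow 2, xpow (- 2) & offdiag (xpow 0) (xpow 0) c d]) e ^+ n).
Proof.
have [[q0 X0] K0] := (q_neq0 hx1, xpow_neq0 P m, xpow_neq0 P (k * m / 2)).
have [[m0 pl] bk] := (m_neq0 R n0, plus_neq0 hx1 n0, brK_neq0 hkm n0).
rewrite contr_FF// coefF_gam_same addrA.
have -> : bcomm P (Ktalpha, j) (Ktalpha, j) n =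
    - m^-1 * (qbr q (X ^+ 2) * qbr q (Tr / K ^+ 2) / (qbr q (K ^+ 2) * qbr q Tr)).
  rewrite -TsE -(qint_2m P n) -(qint_km P n) -!(qintE P (_ * m)).
  have -> : qint (rs * m) = qint ((r - k) * m) by rewrite /pk subKr.
  by case: j.
rewrite bcomm_gamma eqxx (contrFF_jj q0 X0 K0 (xpow_neq0 P _) m0 pl bk Tr2_neq1).
rewrite -mulrDr; congr (_ * _).
rewrite !big_cons !expr_div_n !xpowXE.
have -> : xpow (2 * r) ^+ n = Tr ^+ 2 by rewrite -xpowMn -mulrA xpow_double.
rewrite divr1; ring.
Qed.

Lemma qintN a : qint (- a) = - qint a.
Proof. by rewrite /Defs.qint opprK -mulNr opprB. Qed.

Lemma f_alphaE : f_alpha P m =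
  m^-1 * (Ts^-1 * (qbr q S - qbr q (S / X ^+ 2)) / qbr q Ts
          + K ^+ 2 * (qbr q S + qbr q (S / X ^+ 2)) / qbr q (K ^+ 2)).
Proof.
have e1 : (- r + k) * m = - (rs * m) by rewrite /pk; ring.
have e2 : (r - k) * m = rs * m by rewrite /pk; ring.
by rewrite /f_alpha e1 e2 xpowN xpow_km qint_sm qint_s2m qint_km [qint (rs * m)]qintE.
Qed.

(** [f_alpha] is not odd: changing the sign of m inverts its prefactors x^(- rs m) and x^(km). In
    the contractions this replaces the doubled pole entry x^(s-2) of E_1 E_2 by x^(2-s) for E_2
    E_1. *)
Lemma f_alphaN : - f_alpha P (- m) =
  m^-1 * (Ts * (qbr q S - qbr q (S / X ^+ 2)) / qbr q Ts
          + K ^- 2 * (qbr q S + qbr q (S / X ^+ 2)) / qbr q (K ^+ 2)).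
Proof.
have e1 : (- r + k) * - m = rs * m by rewrite /pk; ring.
have e2 : (r - k) * - m = - (rs * m) by rewrite /pk; ring.
rewrite /f_alpha e1 e2 !mulrN !qintN xpowN xpow_km qint_sm qint_s2m qint_km [qint (rs * m)]qintE.
by rewrite !invrN; ring.
Qed.

Lemma f_talphaE : f_talpha P m =
  m^-1 * (Tr * (- qbr q S + qbr q (S / X ^+ 2)) / qbr q Tr
          + K ^+ 2 * (qbr q S + qbr q (S / X ^+ 2)) / qbr q (K ^+ 2)).
Proof. by rewrite /f_talpha xpow_km qint_sm qint_s2m qint_km [qint (r * m)]qintE. Qed.

Lemma f_talphaN : - f_talpha P (- m) =
  m^-1 * (Tr^-1 * (- qbr q S + qbr q (S / X ^+ 2)) / qbr q Tr
          + K ^- 2 * (qbr q S + qbr q (S / X ^+ 2)) / qbr q (K ^+ 2)).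
Proof.
rewrite /f_talpha !mulrN !qintN !xpowN xpow_km qint_sm qint_s2m qint_km [qint (r * m)]qintE.
by rewrite !invrN; ring.
Qed.

Lemma contrE_12 c d : contr P (EV P N1 c) (EV P N2 d) n = m^-1 *
  ((- xpow (s) ^+ n - xpow (2 - s) ^+ n + (xpow (2 * rs) / xpow (s)) ^+ n
    + (xpow (2 * rs) / xpow (2 - s)) ^+ n) / (1 - xpow (2 * rs) ^+ n)
   - \sum_(e <- offdiag (xpow (2 - s)) (xpow (s - 2)) c d) e ^+ n
   + \sum_(e <- [:: xpow (s - 2), xpow (s - 2) & offdiag (xpow (s)) (xpow (- s)) c d]) e ^+ n).
Proof.
have [[q0 X0] K0] := (q_neq0 hx1, xpow_neq0 P m, xpow_neq0 P (k * m / 2)).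
have [[m0 pl] bk] := (m_neq0 R n0, plus_neq0 hx1 n0, brK_neq0 hkm n0).
have S0 := xpow_neq0 P (s * m).
rewrite contr_EE// coefE_gam_diff// addrA.
have -> : bcomm P (Kalpha, N1) (Kalpha, N2) n = m^-1 * (Ts^-1 * (qbr q S - qbr q (S / X ^+ 2)) / qbr q Ts + K ^+ 2 * (qbr q S + qbr q (S / X ^+ 2)) / qbr q (K ^+ 2)).
  by rewrite -f_alphaE.
rewrite bcomm_gamma [N1 == N2]/= (contrEE_12 q0 X0 S0 K0 (xpow_neq0 P _) m0 pl bk Ts2_neq1).
rewrite -mulrDr; congr (_ * _).
rewrite !big_cons !expr_div_n !xpowXE.
have -> : xpow (2 * rs) ^+ n = Ts ^+ 2 by rewrite -xpowMn -mulrA xpow_double.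
rewrite ?invf_div; field.
by rewrite X0 S0 Ts2_neq1.
Qed.

Lemma contrE_21 c d : contr P (EV P N2 c) (EV P N1 d) n = m^-1 *
  ((- xpow (s) ^+ n - xpow (2 - s) ^+ n + (xpow (2 * rs) / xpow (s)) ^+ n
    + (xpow (2 * rs) / xpow (2 - s)) ^+ n) / (1 - xpow (2 * rs) ^+ n)
   - \sum_(e <- offdiag (xpow (2 - s)) (xpow (s - 2)) c d) e ^+ n
   + \sum_(e <- [:: xpow (2 - s), xpow (2 - s) & offdiag (xpow (s)) (xpow (- s)) c d]) e ^+ n).
Proof.
have [[q0 X0] K0] := (q_neq0 hx1, xpow_neq0 P m, xpow_neq0 P (k * m / 2)).
have [[m0 pl] bk] := (m_neq0 R n0, plus_neq0 hx1 n0, brK_neq0 hkm n0).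
have S0 := xpow_neq0 P (s * m).
rewrite contr_EE// coefE_gam_diff// addrA.
have -> : bcomm P (Kalpha, N2) (Kalpha, N1) n = m^-1 * (Ts * (qbr q S - qbr q (S / X ^+ 2)) / qbr q Ts + K ^- 2 * (qbr q S + qbr q (S / X ^+ 2)) / qbr q (K ^+ 2)).
  by rewrite -f_alphaN.
rewrite bcomm_gamma [N2 == N1]/= (contrEE_21 q0 X0 S0 K0 (xpow_neq0 P _) m0 pl bk Ts2_neq1).
rewrite -mulrDr; congr (_ * _).
rewrite !big_cons !expr_div_n !xpowXE.
have -> : xpow (2 * rs) ^+ n = Ts ^+ 2 by rewrite -xpowMn -mulrA xpow_double.
rewrite ?invf_div; field.
by rewrite X0 S0 Ts2_neq1.
Qed.

Lemma contrF_12 c d : contr P (FV P N1 c) (FV P N2 d) n = m^-1 *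
  ((- xpow (- s) ^+ n - xpow (s - 2) ^+ n + (xpow (2 * r) / xpow (- s)) ^+ n
    + (xpow (2 * r) / xpow (s - 2)) ^+ n) / (1 - xpow (2 * r) ^+ n)
   - \sum_(e <- offdiag (xpow (s - 2)) (xpow (2 - s)) c d) e ^+ n
   + \sum_(e <- [:: xpow (s - 2), xpow (s - 2) & offdiag (xpow (- s)) (xpow (s)) c d]) e ^+ n).
Proof.
have [[q0 X0] K0] := (q_neq0 hx1, xpow_neq0 P m, xpow_neq0 P (k * m / 2)).
have [[m0 pl] bk] := (m_neq0 R n0, plus_neq0 hx1 n0, brK_neq0 hkm n0).
have S0 := xpow_neq0 P (s * m).
rewrite contr_FF// coefF_gam_diff// addrA.
have -> : bcomm P (Ktalpha, N1) (Ktalpha, N2) n = m^-1 * (Tr * (- qbr q S + qbr q (S / X ^+ 2)) / qbr q Tr + K ^+ 2 * (qbr q S + qbr q (S / X ^+ 2)) / qbr q (K ^+ 2)).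
  by rewrite -f_talphaE.
rewrite bcomm_gamma [N1 == N2]/= (contrFF_12 q0 X0 S0 K0 (xpow_neq0 P _) m0 pl bk Tr2_neq1).
rewrite -mulrDr; congr (_ * _).
rewrite !big_cons !expr_div_n !xpowXE.
have -> : xpow (2 * r) ^+ n = Tr ^+ 2 by rewrite -xpowMn -mulrA xpow_double.
rewrite ?invf_div; field.
by rewrite X0 S0 Tr2_neq1.
Qed.

Lemma contrF_21 c d : contr P (FV P N2 c) (FV P N1 d) n = m^-1 *
  ((- xpow (- s) ^+ n - xpow (s - 2) ^+ n + (xpow (2 * r) / xpow (- s)) ^+ n
    + (xpow (2 * r) / xpow (s - 2)) ^+ n) / (1 - xpow (2 * r) ^+ n)
   - \sum_(e <- offdiag (xpow (s - 2)) (xpow (2 - s)) c d) e ^+ n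
   + \sum_(e <- [:: xpow (2 - s), xpow (2 - s) & offdiag (xpow (- s)) (xpow (s)) c d]) e ^+ n).
Proof.
have [[q0 X0] K0] := (q_neq0 hx1, xpow_neq0 P m, xpow_neq0 P (k * m / 2)).
have [[m0 pl] bk] := (m_neq0 R n0, plus_neq0 hx1 n0, brK_neq0 hkm n0).
have S0 := xpow_neq0 P (s * m).
rewrite contr_FF// coefF_gam_diff// addrA.
have -> : bcomm P (Ktalpha, N2) (Ktalpha, N1) n = m^-1 * (Tr^-1 * (- qbr q S + qbr q (S / X ^+ 2)) / qbr q Tr + K ^- 2 * (qbr q S + qbr q (S / X ^+ 2)) / qbr q (K ^+ 2)).
  by rewrite -f_talphaN.
rewrite bcomm_gamma [N2 == N1]/= (contrFF_21 q0 X0 S0 K0 (xpow_neq0 P _) m0 pl bk Tr2_neq1).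
rewrite -mulrDr; congr (_ * _).
rewrite !big_cons !expr_div_n !xpowXE.
have -> : xpow (2 * r) ^+ n = Tr ^+ 2 by rewrite -xpowMn -mulrA xpow_double.
rewrite ?invf_div; field.
by rewrite X0 S0 Tr2_neq1.
Qed.

End FixedMode.
End ContractionLists.

(** * Bosonic Fock space *)

Lemma malgZU (T : choiceType) (K : nzRingType) (c d : K) (t : T) :
  c *: << d *g t >> = << c * d *g t >> :> {malg K[T]}.
Proof. by apply/malgP => u; rewrite mcoeffZ !mcoeffU mulrnAr. Qed.

Lemma addr_split (V : zmodType) (a b c c' d d' : V) :
  a = c + d -> b = c' + d' -> a + b = c + c' + (d + d').
Proof. by move=> -> ->; rewrite addrACA. Qed.

Section BosonicFock.
Variable R : realType.
Local Notation C := (complex R).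
Local Notation bfock := (bfock R).
Implicit Types (p : bfock) (i : bvar) (mu nu : bmono).

Definition bgen i : bfock := << ucm i >>.

Lemma bderivU i (c : C) mu : bderiv i << c *g mu >> = << c * (mu i)%:R *g divcm mu (ucm i) >>.
Proof.
rewrite /bderiv msuppU; case: eqP => [->|_].
  by rewrite big_seq_fset0 mul0r monalgU0.
by rewrite big_seq_fset1 mcoeffUU.
Qed.

Lemma bderivEw i p (d : {fset bmono}) : (msupp p `<=` d)%fset ->
  bderiv i p = \sum_(mu <- d) << p@_mu * (mu i)%:R *g divcm mu (ucm i) >>.
Proof.
move=> pd; rewrite /bderiv; apply: big_fset_incl => // mu _ /mcoeff_outdom ->.
by rewrite mul0r monalgU0.
Qed.

Lemma bderivD i p q : bderiv i (p + q) = bderiv i p + bderiv i q.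
Proof.
rewrite (bderivEw i (msuppD_le p q)) (bderivEw i (fsubsetUl (msupp p) (msupp q))).
rewrite (bderivEw i (fsubsetUr (msupp p) (msupp q))).
by rewrite -big_split; apply: eq_bigr => mu _; rewrite /= mcoeffD mulrDl monalgUD.
Qed.

Lemma bderivZ i (c : C) p : bderiv i (c *: p) = c *: bderiv i p.
Proof.
rewrite (bderivEw i (msuppZ_le c p)) scaler_sumr.
by apply: eq_bigr => mu _; rewrite mcoeffZ malgZU mulrA.
Qed.

Lemma bderiv0 i : bderiv i (0 : bfock) = 0.
Proof. by rewrite -(scale0r (1 : bfock)) bderivZ !scale0r. Qed.

Lemma ucm_divcm i mu : mu i != 0%N -> mmul (ucm i) (divcm mu (ucm i)) = mu.
Proof.
move=> mui; apply/eqP/cmP => j; rewrite cmM divcmE cmU.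
by case: eqP => [<-|_]; rewrite ?subnKC ?lt0n// subn0.
Qed.

Lemma mulUU (c d : C) mu nu : (<< c *g mu >> * << d *g nu >> : bfock) = << c * d *g mmul mu nu >>.
Proof. by rewrite malgM_def fgmulUU. Qed.

(** Polynomials are reached from 1 by linear combinations and multiplication by generators, by
    induction on the degree of monomials. An identity between derivations then only has to be tested
    against multiplication by one generator. *)
Lemma bfock_ind (Q : bfock -> Prop) : Q 1 ->
  (forall p q, Q p -> Q q -> Q (p + q)) ->
  (forall (c : C) p, Q p -> Q (c *: p)) ->
  (forall i p, Q p -> Q (bgen i * p)) -> forall p, Q p.
Proof.
move=> Q1 QD QZ QX p; rewrite [p]monalgE.
have Q0 : Q 0 by rewrite -(scale0r (1 : bfock)); exact: QZ.
apply: (big_ind Q Q0 QD) => mu _.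
have -> : << p@_mu *g mu >> = p@_mu *: << mu >> :> bfock.
  by rewrite malgZU mulr1.
apply: QZ; elim: {p}(mdeg mu) {-2}mu (erefl (mdeg mu)) => [|n IH] {}mu mun.
  by rewrite (mdeg_eq0I mun).
have [i mui] : exists i, mu i != 0%N.
  have : mu != mone by apply/eqP => mu1; move: mun; rewrite mu1 mdeg1.
  apply: contraNP => /forallNP mu0; apply/eqP/eqP/cmP => i.
  by rewrite cm1; apply/eqP; apply: contra_notT (mu0 i).
have muE := ucm_divcm mui.
have -> : << mu >> = bgen i * << divcm mu (ucm i) >> :> bfock.
  by rewrite /bgen mulUU mulr1 muE.
apply: QX; apply: IH; have := congr1 mdeg muE.
by rewrite mdegM mdegU mun add1n => -[].
Qed.

(** Checked on monomials. The truncated division [divcm] is harmless: it always comes with the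
    exponent of i as coefficient, which is 0 exactly when i does not divide the monomial. *)
Lemma bderiv_gen i j p :
  bderiv i (bgen j * p) = (j == i)%:R *: p + bgen j * bderiv i p.
Proof.
pose Q p := bderiv i (bgen j * p) = (j == i)%:R *: p + bgen j * bderiv i p.
have Q0 : Q 0.
  by rewrite /Q mulr0 bderiv0 mulr0 scaler0 addr0.
have QD u v : Q u -> Q v -> Q (u + v).
  rewrite /Q => qu qv.
  rewrite (mulrDr (bgen j) u v) (bderivD i (bgen j * u)) (bderivD i u v).
  rewrite (mulrDr (bgen j) (bderiv i u) (bderiv i v)) (scalerDr _ u v).
  exact: (addr_split qu qv).
rewrite -/(Q p) [p]monalgE; apply: (big_ind Q Q0 QD) => mu _; rewrite /Q.
move: (p@_mu) => c.
have bgenU d nu : bgen j * << d *g nu >> = << d *g mmul (ucm j) nu >>.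
  by rewrite /bgen mulUU mul1r.
have lhsE : bderiv i (bgen j * << c *g mu >>) = _ :=
  etrans (congr1 (bderiv i) (bgenU c mu)) (bderivU i c (mmul (ucm j) mu)).
have rhsE : bgen j * bderiv i << c *g mu >> = _ :=
  etrans (congr1 ( *%R (bgen j)) (bderivU i c mu)) (bgenU _ _).
apply: (etrans lhsE); apply: (etrans _ (congr1 (fun t => _ + t) (esym rhsE))).
rewrite malgZU cmM cmU {lhsE rhsE}.
have [<-|ji] := eqVneq j i.
  have -> : divcm (mmul (ucm j) mu) (ucm j) = mu.
    by apply/eqP/cmP => l; rewrite divcmE cmM addKn.
  have [mu0|mu0] := eqVneq (mu j) 0%N.
    by rewrite mu0 mulr0 monalgU0 addr0 mulr1 mul1r.
  by rewrite ucm_divcm// -monalgUD mul1r natrD mulrDr mulr1.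
rewrite mul0r monalgU0 !add0r.
have [mu0|mu0] := eqVneq (mu i) 0%N; first by rewrite mu0 mulr0 !monalgU0.
have -> : divcm (mmul (ucm j) mu) (ucm i) = mmul (ucm j) (divcm mu (ucm i)).
  apply/eqP/cmP => l; rewrite divcmE !cmM divcmE !cmU.
  case: (eqVneq i l) => [<-|]; last by rewrite !subn0.
  by rewrite (negbTE ji) !add0n.
by rewrite add0n.
Qed.

Lemma bderiv1 i : bderiv i (1 : bfock) = 0.
Proof. by apply: (etrans (bderivU i 1 mone)); rewrite cm1 mulr0 monalgU0. Qed.

End BosonicFock.

Lemma sum_nat_eq0 (V : nmodType) m n (F : nat -> V) :
  (forall i, (m <= i < n)%N -> F i = 0) -> \sum_(m <= i < n) F i = 0.
Proof. by move=> F0; rewrite (eq_big_nat _ _ F0) big1. Qed.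

(** * Exponentials of commuting operators, coefficient by coefficient *)

Section LinearMaps.
Variables (K : numFieldType) (L : lmodType K).
Implicit Types (f g : L -> L) (p q : L).

Definition lin f := forall (c : K) p q, f (c *: p + q) = c *: f p + f q.

Lemma lin0 f : lin f -> f 0 = 0.
Proof. by move=> lf; have := lf (-1) 0 0; rewrite scaler0 addr0 scaleN1r addNr. Qed.

Lemma linD f p q : lin f -> f (p + q) = f p + f q.
Proof. by move=> lf; have := lf 1 p q; rewrite !scale1r. Qed.

Lemma linZ f c p : lin f -> f (c *: p) = c *: f p.
Proof. by move=> lf; have := lf c p 0; rewrite !addr0 lin0// addr0. Qed.

Lemma lin_sum f (I : Type) (s : seq I) (P : pred I) (F : I -> L) : lin f ->
  f (\sum_(i <- s | P i) F i) = \sum_(i <- s | P i) f (F i).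
Proof.
move=> lf; elim/big_rec2: _ => [|i x y _ <-]; first exact: lin0.
by rewrite linD.
Qed.

Lemma lin_comp f g : lin f -> lin g -> lin (fun p => f (g p)).
Proof. by move=> lf lg c p q; rewrite lg lf. Qed.

Lemma linS (a : K) f : lin f -> lin (fun p => a *: f p).
Proof. by move=> lf c p q; rewrite lf scalerDr !scalerA mulrC. Qed.

Lemma lin_bigsum (I : Type) (s : seq I) (F : I -> L -> L) :
  (forall i, lin (F i)) -> lin (fun p => \sum_(i <- s) F i p).
Proof.
move=> lF c p q; rewrite scaler_sumr -big_split; apply: eq_bigr => i _.
exact: lF.
Qed.

Section Exponential.
Variable A : nat -> L -> L.
Hypothesis linA : forall m, lin (A m).

(** [opow] and [oexp] are [fpow] and [fexp] over an arbitrary module, where the algebra of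
    polynomials does not intervene. *)
Fixpoint opow (j n : nat) p : L :=
  match j with
  | 0 => if n == 0 then p else 0
  | j'.+1 => \sum_(1 <= m < n.+1) A m (opow j' (n - m) p)
  end.

Definition oexp (n : nat) p : L := \sum_(0 <= j < n.+1) (j`!%:R)^-1 *: opow j n p.

Lemma lin_opow j n : lin (opow j n).
Proof.
elim: j n => [|j IH] n /=.
  by move=> c p q; case: eqP; rewrite ?scaler0 ?addr0.
by apply: lin_bigsum => m; apply: (lin_comp (linA m)); exact: IH.
Qed.

Lemma lin_oexp n : lin (oexp n).
Proof. by apply: lin_bigsum => m; apply: linS; exact: lin_opow. Qed.

(* Integer indices, so that shifting the index needs no truncated subtraction. *)
Definition opowZ j (k : int) p : L := if k is Posz n then opow j n p else 0.
Definition oexpZ (k : int) p : L := if k is Posz n then oexp n p else 0.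

Lemma lin_oexpZ k : lin (oexpZ k).
Proof. by case: k => n; [exact: lin_oexp|move=> c p q; rewrite /= scaler0 addr0]. Qed.

Lemma opowZ_neg j k p : k < 0 -> opowZ j k p = 0. Proof. by case: k. Qed.
Lemma oexpZ_neg k p : k < 0 -> oexpZ k p = 0. Proof. by case: k. Qed.

(** The terms with m > k vanish, so any N > k may bound the sum; sums for several k can then share
    one range and be interchanged. *)
Lemma opowZS j k p N : k < N%:Z ->
  opowZ j.+1 k p = \sum_(1 <= m < N) A m (opowZ j (k - m%:Z) p).
Proof.
case: k => [n|n] kN; last first.
  have -> : opowZ j.+1 (Negz n) p = 0 by [].
  by rewrite big1// => m _; rewrite opowZ_neg ?lin0//; lia.
rewrite ltz_nat in kN.
rewrite [RHS](@big_cat_nat _ _ _ n.+1 1 N)//= [X in _ + X]sum_nat_eq0 ?addr0.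
  apply: eq_big_nat => m /andP[_ mn].
  by rewrite subzn.
by move=> m nm; rewrite opowZ_neg ?lin0//; lia.
Qed.

Lemma opow_gt j n p : (n < j)%N -> opow j n p = 0.
Proof.
elim: j n => // j IH n nj /=; apply: sum_nat_eq0 => m mn; rewrite IH ?lin0//.
by lia.
Qed.

Hypothesis commA : forall m l p, A m (A l p) = A l (A m p).

(** With A(t) the sum of the A m t^m, this is t d/dt A(t)^(j+1) = (j + 1) (t A'(t)) A(t)^j. In the
    induction k is split as m + (k - m): the part m differentiates the outer factor, the part k - m
    the inner power, and commutativity brings the differentiated factor to the front. *)
Lemma opowZ_rec j k p N : k < N%:Z ->
  k%:~R *: opowZ j.+1 k p =
  j.+1%:R *: \sum_(1 <= m < N) m%:R *: A m (opowZ j (k - m%:Z) p).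
Proof.
elim: j k => [|j IH] k kN.
  rewrite scale1r (opowZS _ _ kN) scaler_sumr; apply: eq_bigr => m _.
  have [->|km] := eqVneq k m%:Z; first by rewrite subrr.
  suff -> : opowZ 0 (k - m%:Z) p = 0 by rewrite lin0// !scaler0.
  by move: km; rewrite -subr_eq0; case: (k - m%:Z) => // -[].
have kmN m : (1 <= m)%N -> k - m%:Z < N%:Z by move: kN; lia.
have E1 : k%:~R *: opowZ j.+2 k p =
    \sum_(1 <= m < N) m%:R *: A m (opowZ j.+1 (k - m%:Z) p) +
    \sum_(1 <= m < N) A m ((k - m%:Z)%:~R *: opowZ j.+1 (k - m%:Z) p).
  rewrite (opowZS _ _ kN) scaler_sumr -big_split; apply: eq_bigr => m _ /=.
  rewrite (linZ _ _ (linA m)) -scalerDl; congr (_ *: _).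
  by rewrite intrB addrC subrK.
rewrite E1; set S1 := \sum_(1 <= m < N) _.
suff -> : \sum_(1 <= m < N) A m ((k - m%:Z)%:~R *: opowZ j.+1 (k - m%:Z) p) = j.+1%:R *: S1.
  by rewrite -[X in X + _]scale1r -scalerDl nat1r.
transitivity (\sum_(1 <= m < N) j.+1%:R *:
    \sum_(1 <= l < N) A m (l%:R *: A l (opowZ j (k - m%:Z - l%:Z) p))).
  apply: eq_big_nat => m /andP[m1 _].
  by rewrite (IH _ (kmN m m1)) (linZ _ _ (linA m)) (lin_sum _ _ _ (linA m)).
rewrite -scaler_sumr; congr (_ *: _).
rewrite exchange_big /S1; apply: eq_big_nat => l /andP[l1 _].
rewrite (opowZS _ _ (kmN l l1)) (lin_sum _ _ _ (linA l)) scaler_sumr.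
apply: eq_bigr => m _; rewrite (linZ _ _ (linA m)) commA; congr (_ *: A _ (A _ (opowZ _ _ _))).
by rewrite addrAC.
Qed.

(** This is t d/dt exp A(t) = (t A'(t)) exp A(t). Together with [oexpZ0] and division by k it
    determines all coefficients, which is how the commutation formulas below are proved. *)
Lemma oexpZ_rec k p N : k < N%:Z ->
  k%:~R *: oexpZ k p = \sum_(1 <= m < N) m%:R *: A m (oexpZ (k - m%:Z) p).
Proof.
have oexpE (l : int) q M : l < M%:Z -> oexpZ l q = \sum_(0 <= j < M) (j`!%:R)^-1 *: opowZ j l q.
  case: l => [n|n] nM; last by rewrite /= big1// => j _; rewrite scaler0.
  rewrite ltz_nat in nM.
  rewrite /= /oexp [RHS](@big_cat_nat _ _ _ n.+1 0 M)//= [X in _ = _ + X]sum_nat_eq0 ?addr0//.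
  by move=> j /andP[nj _]; rewrite opow_gt// scaler0.
move=> kN; have kN1 : k < N.+1%:Z by move: kN; lia.
rewrite (oexpE k p N.+1 kN1) big_nat_recl// scalerDr scaler_sumr.
have -> : k%:~R *: ((0`!%:R)^-1 *: opowZ 0 k p) = 0.
  by case: k {kN kN1} => [[|n]|n] /=; rewrite ?scale0r ?scaler0.
rewrite add0r; transitivity (\sum_(0 <= j < N) \sum_(1 <= m < N)
    (j`!%:R)^-1 *: (m%:R *: A m (opowZ j (k - m%:Z) p))).
  apply: eq_bigr => j _; rewrite scalerA mulrC -scalerA (opowZ_rec _ _ kN).
  rewrite scalerA factS natrM invfM mulrAC mulVf ?pnatr_eq0// mul1r.
  by rewrite scaler_sumr.
rewrite exchange_big; apply: eq_big_nat => m /andP[m1 _].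
rewrite (oexpE (k - m%:Z) p N); last by move: kN; lia.
rewrite (lin_sum _ _ _ (linA m)) scaler_sumr; apply: eq_bigr => j _.
by rewrite (linZ _ _ (linA m)) !scalerA mulrC.
Qed.

Lemma oexpZ0 p : oexpZ 0 p = p.
Proof. by rewrite /= /oexp big_nat1 /= invr1 scale1r. Qed.

End Exponential.

Lemma comm_oexpZ (A : nat -> L -> L) (B : L -> L) k p : lin B ->
  (forall m q, B (A m q) = A m (B q)) -> B (oexpZ A k p) = oexpZ A k (B p).
Proof.
move=> lB AB; have powAB j n : B (opow A j n p) = opow A j n (B p).
  elim: j n => [|j IH] n /=; first by case: eqP => // _; exact: lin0.
  by rewrite (lin_sum _ _ _ lB); apply: eq_bigr => m _; rewrite AB IH.
case: k => [n|n] /=; last exact: lin0.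
by rewrite /oexp (lin_sum _ _ _ lB); apply: eq_bigr => j _; rewrite (linZ _ _ lB) powAB.
Qed.

End LinearMaps.

Local Arguments oexpZ : simpl never.

(** * Normal ordering of exponentials *)

Section Heisenberg.
Variables (K : numFieldType) (L : lmodType K).
Implicit Types (p q : L) (k a b : int).

Lemma scale_natr_inj (n : nat) p q : (0 < n)%N -> n%:R *: p = n%:R *: q :> L -> p = q.
Proof. by move=> n0; apply: scalerI; rewrite pnatr_eq0 -lt0n. Qed.

Lemma sum_delta (V : lmodType K) N m (c : nat -> K) (F : nat -> V) :
  (0 < m < N)%N ->
  \sum_(1 <= l < N) (if m == l then c l else 0) *: F l = c m *: F m.
Proof.
move=> mN; rewrite (bigD1_seq m) ?mem_index_iota ?iota_uniq//= eqxx.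
by rewrite big1 ?addr0// => l; rewrite eq_sym => /negbTE ->; rewrite scale0r.
Qed.

Lemma int_strong_ind (Q : int -> Prop) :
  (forall k, k < 0 -> Q k) ->
  (forall n : nat, (forall k, k < n%:Z -> Q k) -> Q n%:Z) -> forall k, Q k.
Proof.
move=> Qneg Qpos; suff QM M k : k < M%:Z -> Q k.
  by move=> k; apply: (QM `|k|.+1); lia.
elim: M k => [|M IH] k kM; first by apply: Qneg; lia.
case: k kM => [n nM|n _]; last by apply: Qneg; lia.
by apply: Qpos => l ln; apply: IH; lia.
Qed.

Variables (A : nat -> L -> L).
Hypothesis linA : forall m, lin (A m).
Hypothesis commA : forall (m l : nat) p, A m (A l p) = A l (A m p).

(** The coefficient of t^k in exp A(t) X = (X + kap t^l) exp A(t). In the recursion, k = (k - l) +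
    l: the first part comes from differentiating the exponential, the second from t^l. *)
Lemma oexpZ_shift (X : L -> L) (l : nat) (kap : K) k p :
  lin X -> (0 < l)%N ->
  (forall m q, (0 < m)%N -> A m (X q) = X (A m q) + (if l == m then kap else 0) *: q) ->
  oexpZ A k (X p) = X (oexpZ A k p) + kap *: oexpZ A (k - l%:Z) p.
Proof.
move=> linX l0 AX; elim/int_strong_ind: k p => [k k0 p|[|n] IH p].
- have km : k - l%:Z < 0 by lia.
  by rewrite (oexpZ_neg _ _ k0) (oexpZ_neg _ _ k0) (oexpZ_neg _ _ km) lin0// scaler0 addr0.
- have m1 : 0%:Z - l%:Z < 0 by lia.
  by rewrite (oexpZ_neg _ _ m1) !oexpZ0 scaler0 addr0.
apply: (@scale_natr_inj n.+1) => //; set k := Posz n.+1.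
pose N := (n.+1 + l).+1.
have kN : k < N%:Z by rewrite /N /k; lia.
rewrite -[n.+1%:R]/(k%:~R) (oexpZ_rec linA commA _ kN).
transitivity (\sum_(1 <= m < N) (X (m%:R *: A m (oexpZ A (k - m%:Z) p))
   + kap *: (m%:R *: A m (oexpZ A (k - l%:Z - m%:Z) p))
   + (if l == m then m%:R * kap else 0) *: oexpZ A (k - m%:Z) p)).
  apply: eq_big_nat => m /andP[m1 _].
  rewrite IH; last by rewrite /k; lia.
  rewrite (linD _ _ (linA m)) AX// (linZ _ _ (linA m)) (linZ _ _ linX) !scalerDr.
  rewrite [k - l%:Z - _]addrAC !scalerA [kap * _]mulrC [RHS]addrAC.
  by case: eqP => _; rewrite ?mulr0.
rewrite !big_split /= -(lin_sum _ _ _ linX) -(oexpZ_rec linA commA _ kN).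
rewrite -scaler_sumr -(oexpZ_rec linA commA); last by move: kN; lia.
rewrite (@sum_delta _ N l (fun m => m%:R * kap)); last by rewrite /N; lia.
rewrite (linZ _ _ linX) scalerDr -addrA; congr (_ + _).
rewrite !scalerA [kap * _]mulrC -scalerDl -mulrDl; congr (_ * _ *: _).
by rewrite intrB subrK.
Qed.

Variables (B : nat -> L -> L) (c : nat -> K).
Hypothesis linB : forall m, lin (B m).
Hypothesis commB : forall (m l : nat) p, B m (B l p) = B l (B m p).
Hypothesis commAB : forall m n p, (0 < m)%N -> (0 < n)%N ->
  A m (B n p) = B n (A m p) + (if m == n then c m else 0) *: p.

(** The coefficient of u^k in the commutator of A m with exp B(u), which is c_m u^m exp B(u). *)
Lemma annih_oexpZ m k p : (0 < m)%N ->
  A m (oexpZ B k p) = oexpZ B k (A m p) + c m *: oexpZ B (k - m%:Z) p.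
Proof.
move=> m0; elim/int_strong_ind: k p => [k k0 p|[|n] IH p].
- have km : k - m%:Z < 0 by lia.
  by rewrite (oexpZ_neg _ _ k0) (oexpZ_neg _ _ k0) (oexpZ_neg _ _ km) lin0// scaler0 addr0.
- have m1 : 0%:Z - m%:Z < 0 by lia.
  by rewrite (oexpZ_neg _ _ m1) !oexpZ0 scaler0 addr0.
apply: (@scale_natr_inj n.+1) => //; set k := Posz n.+1.
pose N := (n.+1 + m).+1.
have kN : k < N%:Z by rewrite /N /k; lia.
rewrite -[n.+1%:R]/(k%:~R) -(linZ _ _ (linA m)) (oexpZ_rec linB commB _ kN) (lin_sum _ _ _ (linA m)).
transitivity (\sum_(1 <= l < N) (l%:R *: B l (oexpZ B (k - l%:Z) (A m p))
   + c m *: (l%:R *: B l (oexpZ B (k - m%:Z - l%:Z) p))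
   + (if m == l then l%:R * c l else 0) *: oexpZ B (k - l%:Z) p)).
  apply: eq_big_nat => l /andP[l1 _].
  rewrite (linZ _ _ (linA m)) commAB// IH; last by rewrite /k; lia.
  rewrite (linD _ _ (linB l)) (linZ _ _ (linB l)) !scalerDr !scalerA [c m * _]mulrC.
  rewrite [k - m%:Z - _]addrAC; congr (_ + _ + _).
  by case: eqP => [->|_]; rewrite ?mulr0.
rewrite !big_split /= -(oexpZ_rec linB commB _ kN).
rewrite -scaler_sumr -(oexpZ_rec linB commB); last by move: kN; lia.
rewrite (@sum_delta _ N m (fun l => l%:R * c l)); last by rewrite /N; lia.
rewrite scalerDr -addrA; congr (_ + _).
rewrite !scalerA [c m * _]mulrC -scalerDl -mulrDl; congr (_ * _ *: _).
by rewrite intrB subrK.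
Qed.

Variable g : int -> K.
Hypotheses (g0 : g 0 = 1) (gneg : forall k, k < 0 -> g k = 0).
Hypothesis grec : forall k (N : nat), k < N%:Z ->
  k%:~R * g k = \sum_(1 <= m < N) m%:R * c m * g (k - m%:Z).

Lemma sum_shift (U : nat -> L) (m N : nat) : (forall i, (N <= i)%N -> U i = 0) ->
  \sum_(0 <= j < N) g j%:Z *: U (j + m)%N = \sum_(0 <= i < N) g (i%:Z - m%:Z) *: U i.
Proof.
elim: m U => [|m IH] U UN.
  by apply: eq_big_nat => i _; rewrite addn0 subr0.
transitivity (\sum_(0 <= j < N) g j%:Z *: U (j + m).+1).
  by apply: eq_big_nat => i _; rewrite addnS.
rewrite (IH (fun i => U i.+1)); last by move=> i iN; apply: UN; lia.
transitivity (\sum_(0 <= i < N.+1) g (i%:Z - m.+1%:Z) *: U i); last first.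
  by rewrite big_nat_recr//= UN// scaler0 addr0.
rewrite big_nat_recl//= gneg; last by lia.
rewrite scale0r add0r; apply: eq_big_nat => i _; congr (g _ *: _); lia.
Qed.

(** The coefficient of t^a u^b in exp A(t) exp B(u) = g(tu) exp B(u) exp A(t), where g is the
    exponential of the sum of the c_m (tu)^m. Induction on a through t d/dt: moving A m across exp
    B(u) creates the terms of t g', and in the j-th summand the factor a appears as (a - j) + j,
    from exp A and from g. *)
Lemma oexpZ_contraction (N : nat) a b p : a < N%:Z ->
  oexpZ A a (oexpZ B b p) =
  \sum_(0 <= j < N) g j%:Z *: oexpZ B (b - j%:Z) (oexpZ A (a - j%:Z) p).
Proof.
elim/int_strong_ind: a N b p => [a a0 N b p|[|n] IH N b p].
- move=> _; rewrite oexpZ_neg// sum_nat_eq0// => j _.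
  by rewrite [oexpZ A _ _]oexpZ_neg; [rewrite lin0 ?scaler0//; exact: lin_oexpZ|lia].
- case: N => // N _; rewrite big_nat_recl//= g0 scale1r.
  have -> : b - 0%:Z = b by lia.
  have e00 : 0%:Z - 0%:Z = 0%:Z by lia.
  rewrite ?e00 !oexpZ0.
  rewrite sum_nat_eq0 ?addr0// => j _.
  by rewrite [oexpZ A _ _]oexpZ_neg; [rewrite lin0 ?scaler0//; exact: lin_oexpZ|lia].
set a := Posz n.+1 => aN; apply: (@scale_natr_inj n.+1) => //.
rewrite -[n.+1%:R]/(a%:~R) (oexpZ_rec linA commA _ aN).
pose U j := oexpZ B (b - j%:Z) (oexpZ A (a - j%:Z) p).
transitivity (\sum_(1 <= m < N) (
   \sum_(0 <= j < N) g j%:Z *: oexpZ B (b - j%:Z) (m%:R *: A m (oexpZ A (a - j%:Z - m%:Z) p))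
   + (m%:R * c m) *: \sum_(0 <= j < N) g j%:Z *: U (j + m)%N)).
  apply: eq_big_nat => m /andP[m1 _].
  rewrite (IH _ _ N); [|by rewrite /a; lia|by move: aN; rewrite /a; lia].
  rewrite (lin_sum _ _ _ (linA m)) !scaler_sumr -big_split; apply: eq_big_nat => j _ /=.
  rewrite (linZ _ _ (linA m)) annih_oexpZ// /U.
  have -> : a - m%:Z - j%:Z = a - j%:Z - m%:Z by lia.
  have -> : a - (j + m)%:Z = a - j%:Z - m%:Z by lia.
  have -> : b - (j + m)%:Z = b - j%:Z - m%:Z by lia.
  rewrite (linZ _ _ (lin_oexpZ linB _)) !scalerDr !scalerA.
  by congr (_ *: _ + _ *: _); ring.
rewrite big_split /=.
have UN i : (N <= i)%N -> U i = 0.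
  move=> Ni; rewrite /U [oexpZ A _ _]oexpZ_neg ?lin0//; first exact: lin_oexpZ.
  by move: aN; lia.
under [X in _ + X]eq_bigr => m _ do rewrite (sum_shift _ UN).
rewrite exchange_big /=.
under [X in _ + X]eq_bigr => m _ do rewrite scaler_sumr.
rewrite [X in _ + X]exchange_big /= scaler_sumr -big_split; apply: eq_big_nat => j /andP[_ jN] /=.
rewrite -scaler_sumr -(lin_sum _ _ _ (lin_oexpZ linB _)).
rewrite -(oexpZ_rec linA commA); last by move: aN; lia.
under [X in _ + X]eq_bigr => m _ do rewrite scalerA.
rewrite -scaler_suml -grec; last by lia.
rewrite (linZ _ _ (lin_oexpZ linB _)) -/(U j) !scalerA -scalerDl; congr (_ *: _).
by rewrite mulrC -mulrDl -intrD subrK.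
Qed.

End Heisenberg.

(** * Annihilation operators as derivations *)

Section Leibniz.
Variables (K : numFieldType) (L : comAlgType K) (I : Type) (x : I -> L).
Implicit Types (D : L -> L) (p : L) (kap : I -> K).

(** Such a D is a first order differential operator with constant coefficients: it kills 1 and its
    commutator with multiplication by [x i] is the scalar [kap i]. Constancy is what makes two of
    them commute. *)
Definition leib D kap :=
  [/\ lin D, D 1 = 0 & forall i p, D (x i * p) = x i * D p + kap i *: p].

Lemma leib_sum (T : Type) (s : seq T) (c : T -> K) (D : T -> L -> L) (kap : T -> I -> K) :
  (forall t, leib (D t) (kap t)) ->
  leib (fun p => \sum_(t <- s) c t *: D t p) (fun i => \sum_(t <- s) c t * kap t i).
Proof.
move=> DP; split.
- by apply: lin_bigsum => t; apply: linS; case: (DP t).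
- by rewrite big1// => t _; case: (DP t) => _ -> _; rewrite scaler0.
move=> i p; rewrite mulr_sumr scaler_suml -big_split; apply: eq_bigr => t _ /=.
by case: (DP t) => _ _ ->; rewrite scalerDr scalerA scalerAr.
Qed.

Lemma leib0 : leib (fun=> 0) (fun=> 0).
Proof.
split=> // [c p q|i p]; first by rewrite scaler0 addr0.
by rewrite mulr0 scale0r addr0.
Qed.

Hypothesis ind : forall Q : L -> Prop, Q 1 ->
  (forall p q, Q p -> Q q -> Q (p + q)) ->
  (forall (c : K) p, Q p -> Q (c *: p)) ->
  (forall i p, Q p -> Q (x i * p)) -> forall p, Q p.

Lemma leib_comm D kap D' kap' p : leib D kap -> leib D' kap' -> D (D' p) = D' (D p).
Proof.
move=> [lD D1 DX] [lD' D'1 D'X]; elim/ind: p => [|p q IHp IHq|c p IH|i p IH].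
- by rewrite D1 D'1 !lin0.
- by rewrite !(linD _ _ lD') !(linD _ _ lD) !(linD _ _ lD') IHp IHq.
- by rewrite !(linZ _ _ lD') !(linZ _ _ lD) !(linZ _ _ lD') IH.
rewrite D'X DX (linD _ _ lD) (linD _ _ lD') D'X DX IH (linZ _ _ lD) (linZ _ _ lD').
by rewrite -!addrA; congr (_ + _); rewrite addrC.
Qed.

Lemma leib_mul_sum (T : Type) (s : seq T) (c : T -> K) (e : T -> I) D kap p : leib D kap ->
  D ((\sum_(t <- s) c t *: x (e t)) * p) =
  (\sum_(t <- s) c t *: x (e t)) * D p + (\sum_(t <- s) c t * kap (e t)) *: p.
Proof.
move=> [lD D1 DX]; rewrite !mulr_suml (lin_sum _ _ _ lD) scaler_suml -big_split.
apply: eq_bigr => t _ /=.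
by rewrite -!scalerAl (linZ _ _ lD) DX scalerDr scalerA.
Qed.

(** exp A(t) p is a polynomial in t: it is constant for p = 1, and by [oexpZ_shift] multiplication
    of p by [x i] raises the degree by at most [deg i]. This makes the sums over annihilation
    degrees finite. *)
Lemma annih_nilpotent (A : nat -> L -> L) (deg : I -> nat) (kap : nat -> I -> K) p :
  (forall m, leib (A m) (fun i => if deg i == m then kap m i else 0)) ->
  (forall i, (0 < deg i)%N) ->
  (forall m l p, A m (A l p) = A l (A m p)) ->
  exists N, forall k : int, N%:Z <= k -> oexpZ A k p = 0.
Proof.
move=> AP deg0 commA; have linA m : lin (A m) by case: (AP m).
elim/ind: p => [|p q [N NP] [M MP]|c p [N NP]|i p [N NP]].
- exists 1%N => k k1; apply: (@scalerI _ _ k%:~R); first by rewrite intr_eq0; lia.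
  case: k k1 => // n n1.
  have nn : Posz n < n.+1%:Z by lia.
  rewrite scaler0 (oexpZ_rec linA commA _ nn) sum_nat_eq0// => m /andP[m0 mn].
  have [_ A1 _] := AP m.
  (* The exponential fixes 1, as every A m kills it. *)
  suff A0 k : oexpZ A k 1 = if k == 0 then 1 else 0.
    by rewrite A0; case: (_ == 0); rewrite ?A1 ?(lin0 (linA m)) scaler0.
  elim/int_strong_ind: k => [k k0|[|l] IH].
  - by rewrite oexpZ_neg//; case: eqP => // e; move: k0; rewrite e.
  - by rewrite oexpZ0.
  apply: (@scale_natr_inj _ _ l.+1) => //; rewrite -[l.+1%:R]/(l.+1%:Z%:~R).
  have ll : Posz l.+1 < l.+2%:Z by lia.
  rewrite (oexpZ_rec linA commA _ ll) scaler0; apply: sum_nat_eq0 => j /andP[j0 jl].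
  have [_ Aj1 _] := AP j.
  rewrite IH; last by lia.
  case: (_ == 0); rewrite ?Aj1 ?(lin0 (linA j)) scaler0 //.
- exists (maxn N M) => k kN; rewrite (linD _ _ (lin_oexpZ linA k)) NP ?MP ?addr0//; lia.
- by exists N => k kN; rewrite (linZ _ _ (lin_oexpZ linA k)) NP// scaler0.
exists (N + deg i)%N => k kN.
have lx : lin (fun q => x i * q) by move=> c q r; rewrite mulrDr scalerAr.
rewrite (oexpZ_shift linA commA (X := fun q => x i * q) (l := deg i) (kap := kap (deg i) i))//.
- rewrite !NP ?mulr0 ?scaler0 ?addr0//; first by lia.
  by move: kN; lia.
move=> m q m0; have [_ _ ->] := AP m.
by case: eqP => [->|].
Qed.

End Leibniz.

Local Arguments oexpZ : simpl never.

Section BosonicExponentials.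
Variables (R : realType) (P : params R).
Local Notation C := (complex R).
Local Notation bfock := (bfock R).
Local Arguments bcomm : simpl never.
Implicit Types (V W : vop R) (p q : bfock).

Lemma leib_ext (K : numFieldType) (L : comAlgType K) (I : Type) (x : I -> L) D (kap kap' : I -> K) :
  leib x D kap -> (forall i, kap i = kap' i) -> leib x D kap'.
Proof. by case=> lD D1 DX kk; split=> // i p; rewrite -kk DX addrC addrC. Qed.

Lemma leib_bderiv (j : bvar) : leib (@bgen R) (bderiv j) (fun i => (i == j)%:R).
Proof.
split.
- move=> c p q; exact: (etrans (bderivD j _ _) (congr1 (fun t => t + _) (bderivZ j c p))).
- exact: bderiv1.
by move=> i p; exact: (etrans (bderiv_gen j i p) (addrC _ _)).
Qed.

Definition bannih V m p : bfock := \sum_a vpos V a m *: bosc P a m%:Z p.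
Definition bcreat V m p : bfock := \sum_a vneg V a m *: bosc P a (- m%:Z) p.

Lemma leib_bosc a (m : nat) : leib (@bgen R) (bosc P a m%:Z)
  (fun i => if i.2.+1 == m then bcomm P a i.1 m else 0).
Proof.
case: m => [|n].
  by apply: (leib_ext (leib0 _)) => i.
apply: (leib_ext (leib_sum _ _ (fun b => leib_bderiv (b, n)))) => -[b l] /=.
rewrite eqSS; case: eqP => [->|ln] /=; last first.
  by rewrite big1// => d _; case: eqP => [[_ /ln]|]//; rewrite mulr0.
rewrite (bigD1 b)//= eqxx mulr1 big1 ?addr0// => d db.
by case: eqP => [[bd]|]; rewrite ?mulr0//; rewrite bd eqxx in db.
Qed.

Lemma leib_bannih V (m : nat) : leib (@bgen R) (bannih V m)
  (fun i => if i.2.+1 == m then \sum_a vpos V a m * bcomm P a i.1 m else 0).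
Proof.
apply: (leib_ext (leib_sum _ _ (fun a => leib_bosc a m))) => i /=.
by case: eqP => // _; rewrite big1// => a _; rewrite mulr0.
Qed.

Lemma bcreatE V (m : nat) p : (0 < m)%N ->
  bcreat V m p = (\sum_a vneg V a m *: bgen R (a, m.-1)) * p.
Proof.
case: m => // n _; apply: (etrans _ (esym (mulr_suml _ _ _ _))).
by apply: eq_bigr => a _; exact: scalerAl.
Qed.

Lemma lin_bcreat V m : lin (bcreat V m).
Proof.
case: m => [|n].
  apply: lin_bigsum => a; apply: linS => c p q.
  by rewrite /= scaler0 addr0.
apply: lin_bigsum => a; apply: linS => c p q.
exact: (etrans (mulrDr _ _ _) (congr1 (fun t => t + _) (esym (scalerAr _ _ _)))).
Qed.

Lemma lin_bannih V m : lin (bannih V m).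
Proof. by case: (leib_bannih V m). Qed.

Lemma comm_bannih V W m l p : bannih V m (bannih W l p) = bannih W l (bannih V m p).
Proof. exact: (leib_comm (@bfock_ind R) p (leib_bannih V m) (leib_bannih W l)). Qed.

Lemma comm_bcreat V W m l p : bcreat V m (bcreat W l p) = bcreat W l (bcreat V m p).
Proof.
have c0 V' q : bcreat V' 0 q = 0.
  by rewrite /bcreat big1// => a _; exact: scaler0.
case: m => [|m]; first by rewrite !c0 (lin0 (lin_bcreat _ _)).
case: l => [|l]; first by rewrite !c0 (lin0 (lin_bcreat _ _)).
have e V' m' q : bcreat V' m'.+1 q = _ := @bcreatE V' m'.+1 q isT.
rewrite (e V) (e W) (e W) (e V).
exact: mulrCA.
Qed.

(** This is where [contr] enters: it is the commutator of the two exponents in one mode, and a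
    scalar. *)
Lemma comm_bannih_bcreat V W m n p : (0 < n)%N ->
  bannih V m (bcreat W n p) =
  bcreat W n (bannih V m p) + (if m == n then contr P V W m else 0) *: p.
Proof.
move=> n0; rewrite !(bcreatE _ _ n0).
apply: (etrans (leib_mul_sum _ _ (fun a => (a, n.-1)) p (leib_bannih V m))).
apply: (congr1 (fun t : C => _ + t *: p)).
transitivity (\sum_b vneg W b n *
    (if n == m then \sum_a vpos V a m * bcomm P a b m else 0)).
  by apply: eq_bigr => b _ /=; rewrite (prednK n0).
rewrite eq_sym; case: eqP => [->|_]; last first.
  by apply: big1 => a _; apply: mulr0.
rewrite /contr exchange_big; apply: eq_bigr => a _.
rewrite mulr_sumr; apply: eq_bigr => b _ /=.
by rewrite mulrA [vneg W a n * _]mulrC.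
Qed.

Lemma bannih_nilpotent V p :
  exists N : nat, forall k : int, N%:Z <= k -> oexpZ (bannih V) k p = 0.
Proof.
pose kap m (i : bvar) := \sum_a vpos V a m * bcomm P a i.1 m.
exact: (@annih_nilpotent _ bfock bvar (@bgen R) (@bfock_ind R) (bannih V)
  (fun i => i.2.+1) kap p (leib_bannih V) (fun=> isT) (@comm_bannih V V)).
Qed.

Lemma fpowE (A : nat -> bfock -> bfock) j n p : fpow A j n p = opow A j n p.
Proof.
elim: j n => [|j IH] n; first exact: erefl.
change (\sum_(1 <= m < n.+1) A m (fpow A j (n - m) p) =
  \sum_(1 <= m < n.+1) A m (opow A j (n - m) p)).
by apply: eq_bigr => m _; exact: congr1.
Qed.

Lemma fexpE (A : nat -> bfock -> bfock) (n : nat) p : fexp A n p = oexpZ A n p.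
Proof. by apply: eq_bigr => j _; exact: (congr1 (fun t => _ *: t) (fpowE A j n p)). Qed.

Lemma annihE V (n : nat) p : annih P V n p = oexpZ (bannih V) n p.
Proof. exact: fexpE. Qed.

Lemma creatE V (n : nat) p : creat P V n p = oexpZ (bcreat V) n p.
Proof. exact: fexpE. Qed.

End BosonicExponentials.

Local Arguments oexpZ : simpl never.

(** * Coefficients of operator products as finite sums *)

Lemma fsum_image (V : nmodType) (T I : choiceType) (A : set T) (F : T -> V)
    (h : I -> T) (s : seq I) (G : I -> V) :
  uniq s -> injective h ->
  (forall i, A (h i) -> F (h i) = G i) -> (forall i, ~ A (h i) -> G i = 0) ->
  (forall t, A t -> (forall i, i \in s -> h i <> t) -> F t = 0) ->
  \sum_(t \in A) F t = \sum_(i <- s) G i.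
Proof.
move=> us hI FG G0 F0.
rewrite (@fsbigE _ _ _ _ _ [seq h i | i <- s & `[< A (h i) >]]).
- rewrite big_map big_filter_cond big_mkcond /=; apply: eq_bigr => i _.
  case: asboolP => [Ai|/G0->//] /=.
  by rewrite mem_set// FG.
- by rewrite map_inj_uniq// filter_uniq.
- by move=> t ts; have [j] := elimT mapP ts; rewrite mem_filter => /andP[/asboolP Aj _] ->.
move=> t At /mapP ts; apply: F0 => // i si hit; apply: ts.
by exists i; rewrite // mem_filter si andbT; apply/asboolP; rewrite hit.
Qed.

Lemma intr_inj (K : numDomainType) : injective (fun d : int => d%:~R : K).
Proof. by move=> a b /eqP; rewrite eqr_int => /eqP. Qed.

Lemma shift_eq (K : numDomainType) (e0 : K) (d : int) (a b : nat) :
  e0 + a%:R - b%:R = e0 + d%:~R <-> a%:Z = d + b%:Z.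
Proof.
rewrite -addrA; split=> [/addrI|ad].
  rewrite -[a%:R]/(a%:Z%:~R) -[b%:R]/(b%:Z%:~R) -intrB => /intr_inj <-; lia.
by rewrite -[a%:R]/(a%:Z%:~R) ad intrD addrK.
Qed.

(** Degrees of creation and annihilation differing by d are indexed by the annihilation degree n,
    below a bound of nilpotency. If d + n < 0 the pair of |d + n| and n falls outside the index set,
    and S (d + n) vanishes accordingly. *)
Lemma vform (K : numFieldType) (L : lmodType K) (S T : int -> L -> L) (e0 e : K) (d : int) (N : nat) p :
  (forall (k : int) q, k < 0 -> S k q = 0) -> (forall k, lin (S k)) -> e = e0 + d%:~R ->
  (forall k : int, N%:Z <= k -> T k p = 0) ->
  \sum_(t \in [set t : nat * nat | e0 + t.1%:R - t.2%:R = e])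
     S t.1%:Z (T t.2%:Z p) =
  \sum_(0 <= n < N) S (d + n%:Z) (T n%:Z p).
Proof.
move=> S0 linS ->; set A := [set t | _] => TN.
have AE t : A t <-> t.1%:Z = d + t.2%:Z.
  exact: shift_eq.
refine (@fsum_image _ _ nat A _ (fun n : nat => (absz (d + n%:Z), n)) (index_iota 0 N) _ _ _ _ _ _) => /=.
- exact: iota_uniq.
- by move=> m n [].
- by move=> n /AE /= <-.
- move=> n /AE /= nA; rewrite S0//; move: nA; lia.
move=> [t1 t2] /AE /= tE tN; rewrite TN ?(lin0 (linS _))//.
rewrite lez_nat leqNgt; apply/negP => t2N; apply: (tN t2).
  by rewrite mem_index_iota.
by rewrite -tE.
Qed.

Section Forms.
Variables (K : numFieldType) (L : lmodType K).
Variables (SV SW TV TW : int -> L -> L).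
Hypotheses (SV0 : forall (k : int) p, k < 0 -> SV k p = 0) (SW0 : forall (k : int) p, k < 0 -> SW k p = 0).
Hypotheses (linSV : forall k, lin (SV k)) (linSW : forall k, lin (SW k)).
Hypotheses (TV0 : forall (k : int) p, k < 0 -> TV k p = 0).
Hypotheses (linTV : forall k, lin (TV k)).

Lemma nform (e10 e1 e20 e2 : K) (d1 d2 : int) (N N' : nat) p :
  e1 = e10 + d1%:~R -> e2 = e20 + d2%:~R ->
  (forall k l : int, N%:Z <= k -> TV k (TW l p) = 0) ->
  (forall k : int, N'%:Z <= k -> TW k p = 0) ->
  \sum_(t \in [set t : (nat * nat) * (nat * nat) |
      e10 + t.1.1%:R - t.1.2%:R = e1 /\ e20 + t.2.1%:R - t.2.2%:R = e2])
     SV t.1.1%:Z (SW t.2.1%:Z (TV t.1.2%:Z (TW t.2.2%:Z p))) =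
  \sum_(0 <= n < N) \sum_(0 <= n' < N')
    SV (d1 + n%:Z) (SW (d2 + n'%:Z) (TV n%:Z (TW n'%:Z p))).
Proof.
move=> -> ->; set A := [set t | _] => TN TN'.
have E := @shift_eq K.
transitivity (\sum_(z <- [seq (n, n') | n <- index_iota 0 N, n' <- index_iota 0 N'])
  SV (d1 + z.1%:Z) (SW (d2 + z.2%:Z) (TV z.1%:Z (TW z.2%:Z p)))); last first.
  by rewrite big_allpairs.
apply: (@fsum_image _ _ _ _ _
  (fun z : nat * nat => ((absz (d1 + z.1%:Z), z.1), (absz (d2 + z.2%:Z), z.2)))) => /=.
- by apply: allpairs_uniq; rewrite ?iota_uniq// => -[a b] [a' b'].
- by move=> [m m'] [n n'] /= [_ -> _ ->].
- by move=> [n n'] [/E /= <- /E /= <-].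
- move=> [n n'] /= nA.
  have [d1n|] := ltrP (d1 + n%:Z) 0; first by rewrite SV0.
  have [d2n|] := ltrP (d2 + n'%:Z) 0; first by rewrite SW0// lin0.
  by move=> *; case: nA; split; apply/E => /=; lia.
move=> [[t1 t2] [t3 t4]] [/E /= t1E /E /= t3E] tN.
have [t2N|t2N] := leqP N t2; first by rewrite TN ?(lin0 (linSW _)) ?(lin0 (linSV _)).
have [t4N|t4N] := leqP N' t4.
  by rewrite (TN' t4) ?(lin0 (linTV _)) ?(lin0 (linSW _)) ?(lin0 (linSV _)).
exfalso; apply: (tN (t2, t4)) => /=; last by rewrite -t1E -t3E.
by apply: allpairs_f; rewrite mem_index_iota.
Qed.

Lemma vform0 (e0 e : K) p : (forall d : int, e <> e0 + d%:~R) ->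
  \sum_(t \in [set t : nat * nat | e0 + t.1%:R - t.2%:R = e])
     SV t.1%:Z (TV t.2%:Z p) = 0.
Proof.
move=> eN; apply: fsbig1 => t /= et; case: (eN (t.1%:Z - t.2%:Z)).
by rewrite -et intrB addrA.
Qed.

Lemma nform0 (e10 e1 e20 e2 : K) p :
  (forall d : int, e1 <> e10 + d%:~R) \/ (forall d : int, e2 <> e20 + d%:~R) ->
  \sum_(t \in [set t : (nat * nat) * (nat * nat) |
      e10 + t.1.1%:R - t.1.2%:R = e1 /\ e20 + t.2.1%:R - t.2.2%:R = e2])
     SV t.1.1%:Z (SW t.2.1%:Z (TV t.1.2%:Z (TW t.2.2%:Z p))) = 0.
Proof.
move=> eN; apply: fsbig1 => t /= [et1 et2].
case: eN => eN; [case: (eN (t.1.1%:Z - t.1.2%:Z))|case: (eN (t.2.1%:Z - t.2.2%:Z))].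
  by rewrite -et1 intrB addrA.
by rewrite -et2 intrB addrA.
Qed.

Variable g : int -> K.
Hypothesis TVSW : forall (N : nat) a b p, a < N%:Z ->
  TV a (SW b p) = \sum_(0 <= j < N) g j%:Z *: SW (b - j%:Z) (TV (a - j%:Z) p).

(** Moving TV across SW lowers both degrees by j. For j >= J the creation degree d2 - j + n' is
    negative, and for M >= N + J the lowered degree n - j still runs over all of [0, N), outside of
    which the terms vanish. *)
Lemma contraction_form (J M N N' : nat) (d1 d2 : int) p :
  (forall k l : int, N%:Z <= k -> TV k (TW l p) = 0) ->
  d2 + N'%:Z <= J%:Z -> (N + J <= M)%N ->
  \sum_(0 <= n < M) SV (d1 + n%:Z) (TV n%:Z
    (\sum_(0 <= n' < N') SW (d2 + n'%:Z) (TW n'%:Z p))) =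
  \sum_(0 <= j < J) g j%:Z *: \sum_(0 <= n < N) \sum_(0 <= n' < N')
    SV (d1 + j%:Z + n%:Z) (SW (d2 - j%:Z + n'%:Z) (TV n%:Z (TW n'%:Z p))).
Proof.
move=> TN dJ NM.
pose f (j : nat) (n : int) (n' : nat) :=
  SV (d1 + j%:Z + n) (SW (d2 - j%:Z + n'%:Z) (TV n (TW n'%:Z p))).
have fE (n n' : nat) : (n' < N')%N ->
    SV (d1 + n%:Z) (TV n%:Z (SW (d2 + n'%:Z) (TW n'%:Z p))) =
    \sum_(0 <= j < J) g j%:Z *: f j (n%:Z - j%:Z) n'.
  move=> nN'; pose Q := (n.+1 + J)%N.
  have nQ : n%:Z < Q%:Z by rewrite /Q; lia.
  rewrite (TVSW _ _ nQ) (lin_sum _ _ _ (linSV _)).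
  rewrite (@big_cat_nat _ _ _ J 0 Q)//=; last by rewrite /Q; lia.
  rewrite [X in _ + X]sum_nat_eq0 ?addr0; last first.
    by move=> j /andP[Jj _]; rewrite SW0 ?scaler0 ?(lin0 (linSV _))//; lia.
  apply: eq_bigr => j _; rewrite (linZ _ _ (linSV _)); congr (_ *: _).
  by rewrite /f; congr (SV _ (SW _ _)); lia.
have f0 j n n' : n < 0 \/ N%:Z <= n -> f j n n' = 0.
  rewrite /f => -[n0|nN]; rewrite ?(TV0 _ n0) ?(TN _ _ nN) (lin0 (linSW _)).
    exact: lin0.
  exact: lin0.
transitivity (\sum_(0 <= n < M) \sum_(0 <= n' < N') \sum_(0 <= j < J)
    g j%:Z *: f j (n%:Z - j%:Z) n').
  apply: eq_bigr => n _; rewrite (lin_sum _ _ _ (linTV _)) (lin_sum _ _ _ (linSV _)).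
  by apply: eq_big_nat => n' /andP[_ nN']; exact: fE.
transitivity (\sum_(0 <= j < J) \sum_(0 <= n' < N') \sum_(0 <= n < M)
    g j%:Z *: f j (n%:Z - j%:Z) n').
  rewrite exchange_big /= [RHS]exchange_big /=; apply: eq_bigr => n' _.
  exact: exchange_big.
apply: eq_big_nat => j /andP[_ jJ].
rewrite [in RHS]exchange_big scaler_sumr; apply: eq_bigr => n' _.
rewrite -scaler_sumr; congr (_ *: _).
rewrite (@big_cat_nat _ _ _ j 0 M)//=; last by lia.
rewrite sum_nat_eq0 ?add0r; last by move=> n nj; apply: f0; lia.
rewrite -[j in LHS]add0n big_addn (@big_cat_nat _ _ _ N 0 (M - j))//=; last by lia.
rewrite [X in _ + X]sum_nat_eq0 ?addr0; last by move=> n nN; apply: f0; lia.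
by apply: eq_bigr => n _; congr (f _ _ _); lia.
Qed.

Hypothesis commT : forall k l p, TV k (TW l p) = TW l (TV k p).
Hypothesis linTW : forall k, lin (TW k).
Hypotheses (nilV : forall p, exists N : nat, forall k : int, N%:Z <= k -> TV k p = 0)
           (nilW : forall p, exists N : nat, forall k : int, N%:Z <= k -> TW k p = 0).

Let nsum (e10 e1 e20 e2 : K) p := \sum_(t \in [set t : (nat * nat) * (nat * nat) |
      e10 + t.1.1%:R - t.1.2%:R = e1 /\ e20 + t.2.1%:R - t.2.2%:R = e2])
     SV t.1.1%:Z (SW t.2.1%:Z (TV t.1.2%:Z (TW t.2.2%:Z p))).

(** The bound J is returned together with the vanishing of the later normally ordered coefficients,
    so that the sum may afterwards be compared with the bilateral sum of a delta function. *)
Lemma product_form (e10 e1 e20 e2 c : K) p : exists J : nat,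
  (forall j : nat, (J < j)%N -> nsum e10 (e1 + j%:Z%:~R) e20 (e2 - j%:Z%:~R) p = 0) /\
  \sum_(t \in [set t : nat * nat | e10 + t.1%:R - t.2%:R = e1])
     SV t.1%:Z (TV t.2%:Z (c *: \sum_(t \in [set t : nat * nat | e20 + t.1%:R - t.2%:R = e2])
     SW t.1%:Z (TW t.2%:Z p))) =
  c *: \sum_(0 <= j < J.+1) g j%:Z *: nsum e10 (e1 + j%:Z%:~R) e20 (e2 - j%:Z%:~R) p.
Proof.
(* Exponents are complex numbers: unless e1 is in e10 + Z and e2 in e20 + Z, both sides vanish. *)
have [[d1 e1E]|/forallNP e1N] := pselect (exists d : int, e1 = e10 + d%:~R); last first.
  have nN (j : nat) : nsum e10 (e1 + j%:Z%:~R) e20 (e2 - j%:Z%:~R) p = 0.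
    apply: nform0; left=> d e; apply: (e1N (d - j%:Z)).
    by rewrite intrB addrA -e addrK.
  exists 0%N; split=> [j _|]; first exact: nN.
  by rewrite big_nat1 nN !scaler0 vform0.
have [[d2 e2E]|/forallNP e2N] := pselect (exists d : int, e2 = e20 + d%:~R); last first.
  have nN (j : nat) : nsum e10 (e1 + j%:Z%:~R) e20 (e2 - j%:Z%:~R) p = 0.
    apply: nform0; right=> d e; apply: (e2N (d + j%:Z)).
    by rewrite intrD addrA -e subrK.
  exists 0%N; split=> [j _|]; first exact: nN.
  rewrite big_nat1 nN !scaler0 [X in c *: X]fsbig1 ?scaler0; last first.
    move=> t /= et; case: (e2N (t.1%:Z - t.2%:Z)).
    by rewrite -et intrB addrA.
  by apply: fsbig1 => t _; rewrite (lin0 (linTV _)) (lin0 (linSV _)).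
have [N TN] := nilV p; have [N' TN'] := nilW p.
have TN2 (k l : int) : N%:Z <= k -> TV k (TW l p) = 0.
  by move=> kN; rewrite commT TN// (lin0 (linTW _)).
(* For n' < N' and j > J the creation degree d2 - j + n' is negative. *)
pose J := absz (d2 + N'%:Z); exists J.
have nE (j : nat) : nsum e10 (e1 + j%:Z%:~R) e20 (e2 - j%:Z%:~R) p =
    \sum_(0 <= n < N) \sum_(0 <= n' < N')
    SV (d1 + j%:Z + n%:Z) (SW (d2 - j%:Z + n'%:Z) (TV n%:Z (TW n'%:Z p))).
  by apply: (nform _ _ TN2 TN'); rewrite ?e1E ?e2E ?intrB ?intrD !addrA.
split=> [j Jj|].
  rewrite nE; apply: sum_nat_eq0 => n _; apply: sum_nat_eq0 => n' /andP[_ nN'].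
  by rewrite SW0 ?(lin0 (linSV _))//; move: Jj; rewrite /J; lia.
pose w := \sum_(t \in [set t : nat * nat | e20 + t.1%:R - t.2%:R = e2])
     SW t.1%:Z (TW t.2%:Z p).
rewrite -/w.
have wE : w = \sum_(0 <= n < N') SW (d2 + n%:Z) (TW n%:Z p).
  exact: (vform SW0 linSW e2E TN').
have [M1 TM] := nilV (c *: w); pose M := (M1 + (N + J.+1))%N.
rewrite (@vform _ _ SV TV e10 e1 d1 M)//; last by move=> k kM; apply: TM; move: kM; rewrite /M; lia.
rewrite wE.
transitivity (c *: \sum_(0 <= n < M) SV (d1 + n%:Z) (TV n%:Z
    (\sum_(0 <= n < N') SW (d2 + n%:Z) (TW n%:Z p)))).
  rewrite [RHS]scaler_sumr; apply: eq_bigr => n _.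
  by rewrite (linZ _ _ (linTV _)) (linZ _ _ (linSV _)).
rewrite (@contraction_form J.+1 M N N')//; [|by rewrite /J; lia|by rewrite /M; lia].
by congr (_ *: _); apply: eq_bigr => j _; rewrite nE.
Qed.

End Forms.

Local Arguments oexpZ : simpl never.

Section Coefficients.
Variables (R : realType) (P : params R).
Local Notation C := (complex R).
Local Notation bfock := (bfock R).
Implicit Types (V W : vop R) (p : bfock) (v : fock R) (q : qcharge R).
Local Notation xpow := (xpow P).

Definition SZ V (n : int) : bfock -> bfock := oexpZ (bcreat P V) n.
Definition TZ V (n : int) : bfock -> bfock := oexpZ (bannih P V) n.

Definition vsum V (e0 e : C) p : bfock :=
  \sum_(t \in [set t : nat * nat | e0 + t.1%:R - t.2%:R = e])
     SZ V t.1%:Z (TZ V t.2%:Z p).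

Definition nsum V W (e10 e1 e20 e2 : C) p : bfock :=
  \sum_(t \in [set t : (nat * nat) * (nat * nat) |
      e10 + t.1.1%:R - t.1.2%:R = e1 /\ e20 + t.2.1%:R - t.2.2%:R = e2])
     SZ V t.1.1%:Z (SZ W t.2.1%:Z (TZ V t.1.2%:Z (TZ W t.2.2%:Z p))).

Lemma vcoefE V e v q : vcoef P V e v q =
  xpow (vx V (q - vshift V)) *: vsum V (vz V (q - vshift V)) e (v (q - vshift V)).
Proof.
apply: (congr1 (fun t => _ *: t)); apply: eq_fsbigr => t _.
by apply: (etrans (creatE _ _ _ _)); apply: congr1; exact: annihE.
Qed.

Lemma ncoefE V W e1 e2 v q : ncoef P V W e1 e2 v q =
  let q0 := q - (vshift V + vshift W) in
  xpow (vx V q0 + vx W q0) *: nsum V W (vz V q0) e1 (vz W q0) e2 (v q0).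
Proof.
apply: (congr1 (fun t => _ *: t)); apply: eq_fsbigr => t _.
apply: (etrans (creatE _ _ _ _)); apply: (congr1 (SZ V t.1.1)).
apply: (etrans (creatE _ _ _ _)); apply: (congr1 (SZ W t.2.1)).
by apply: (etrans (annihE _ _ _ _)); apply: congr1; exact: annihE.
Qed.

Lemma lin_SZ V n : lin (SZ V n).
Proof. exact: (lin_oexpZ (lin_bcreat P V)). Qed.

Lemma lin_TZ V n : lin (TZ V n).
Proof. exact: (lin_oexpZ (lin_bannih P V)). Qed.

Lemma comm_SZ V W m n p : SZ V m (SZ W n p) = SZ W n (SZ V m p).
Proof.
apply: (comm_oexpZ _ _ (lin_SZ V m)) => l q; apply: esym.
by apply: (comm_oexpZ _ _ (lin_bcreat P W l)) => l' q'; exact: comm_bcreat.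
Qed.

Lemma comm_TZ V W m n p : TZ V m (TZ W n p) = TZ W n (TZ V m p).
Proof.
apply: (comm_oexpZ _ _ (lin_TZ V m)) => l q; apply: esym.
by apply: (comm_oexpZ _ _ (lin_bannih P W l)) => l' q'; exact: comm_bannih.
Qed.

Lemma set_bij_swap (T U : Type) (A : set (T * U)) (B : set (U * T)) :
  (forall t, A t <-> B (t.2, t.1)) -> set_bij A B (fun t => (t.2, t.1)).
Proof.
move=> AB; split=> [t /AB//|[a b] [c d] _ _ [-> ->]//|[a b] Bt].
by exists (b, a) => //; apply/AB.
Qed.

Lemma ncoef_sym V W e1 e2 v q : ncoef P V W e1 e2 v q = ncoef P W V e2 e1 v q.
Proof.
apply: (etrans (ncoefE V W e1 e2 v q)); apply: (etrans _ (esym (ncoefE W V e2 e1 v q))).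
rewrite [vshift W + _]addrC; move: (q - _) => q0 /=.
rewrite [vx W q0 + _]addrC; apply: congr1.
apply: etrans (esym (reindex_fsbig (fun t => (t.2, t.1)) [set t : (nat * nat) * (nat * nat) |
      vz V q0 + t.1.1%:R - t.1.2%:R = e1 /\ vz W q0 + t.2.1%:R - t.2.2%:R = e2] _ _ _)).
  apply: eq_fsbigr => t _ /=.
  by apply: (etrans (comm_SZ _ _ _ _ _)); do 2 apply: congr1; exact: comm_TZ.
by apply: set_bij_swap => t /=; split=> -[].
Qed.

Lemma eval2_sym V W u1 u2 v q mu :
  eval2 P (ncoef P V W) u1 u2 v q mu = eval2 P (ncoef P W V) u2 u1 v q mu.
Proof.
apply: (etrans _ (esym (reindex_fsbig (fun t => (t.2, t.1)) setT _ _ _))).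
  apply: eq_fsbigr => t _ /=; rewrite [X in xpow X]addrC.
  by apply: congr1; apply: congr1; exact: ncoef_sym.
by apply: set_bij_swap => t.
Qed.

End Coefficients.

(** * Exchange relations *)


Lemma branch_sum_swap (F : comPzRingType) (a b : F) (f g : branch -> branch -> F) :
  (forall c d, a * f c d = b * g d c) ->
  a * (\sum_c \sum_d f c d) = b * (\sum_d \sum_c g d c).
Proof.
move=> fg; rewrite !mulr_sumr; transitivity (\sum_c \sum_d a * f c d).
  by apply: eq_bigr => c _; rewrite mulr_sumr.
rewrite exchange_big; apply: eq_bigr => d _.
by rewrite mulr_sumr; apply: eq_bigr => c _.
Qed.

Lemma mulr_congr (F : comPzRingType) (t t' a a' e e' : F) : e = e' ->
  t * a = t' * a' -> t * (a * e) = t' * (a' * e').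
Proof. by move=> <- ta; rewrite !mulrA ta. Qed.

Section Exchange.
Variables (R : realType) (P : params R).
Local Notation C := (complex R).
Local Notation normc := ComplexField.Normc.normc.
Local Arguments normc : simpl never.
Local Notation r := (pr P).
Local Notation rs := (prs P).
Local Notation s := (ps P).
Local Notation k := (pk P).
Local Notation xpow := (xpow P).
Local Notation x := (xx P).

Definition ratpart (ds es : seq C) (w : C) :=
  \prod_(d <- ds) (1 - d * w) * (\prod_(e <- es) (1 - e * w))^-1.

Definition contr_form (V W : vop R) (rho al be : C) (ds es : seq C) :=
  forall n, (0 < n)%N -> contr P V W n = n%:R^-1 *
    ((- xpow al ^+ n - xpow be ^+ n + (xpow (2 * rho) / xpow al) ^+ n
      + (xpow (2 * rho) / xpow be) ^+ n) / (1 - xpow (2 * rho) ^+ n)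
     - \sum_(d <- ds) d ^+ n + \sum_(e <- es) e ^+ n).

(** [nu] is the exponent of z that the zero modes contribute in either order, and E the exponent of
    x in the product of brackets. The condition on E says that these powers, taken at u1 - u2 with
    z_1 and at u2 - u1 with z_2, differ by exactly w^2; this is the factor w^2 of [contrG_exchange],
    which leaves a rational identity for each pair of branches. *)
Lemma exchange_intro (t : C -> C) (X Y : current R) (rho al be nu : C) (E : C -> C)
    (ds es ds' es' : branch -> branch -> seq C) (f f' : branch -> branch -> C) :
  normc (xpow (2 * rho)) < 1 ->
  (forall c d, contr_form (X c).2 (Y d).2 rho al be (ds c d) (es c d)) ->
  (forall c d, contr_form (Y c).2 (X d).2 rho al be (ds' c d) (es' c d)) ->
  (forall c d u, zcontr P (X c).2 (Y d).2 u = xpow (f c d) * xpow (2 * u * nu)) ->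
  (forall c d u, zcontr P (Y c).2 (X d).2 u = xpow (f' c d) * xpow (2 * u * nu)) ->
  (forall u, t u = xpow (E u) * (Theta (xpow (2 * rho)) (xpow al * xpow (2 * u))
     * Theta (xpow (2 * rho)) (xpow be * xpow (2 * u)))) ->
  (forall u, E u + 2 * u * nu = E (- u) - 4 * u) ->
  (forall c d w, w != 0 -> \prod_(e <- es c d) (1 - e * w) != 0 ->
     \prod_(e <- es' d c) (1 - e * w^-1) != 0 ->
     xpow (f c d) * w ^+ 2 * ratpart (ds c d) (es c d) w =
     xpow (f' d c) * ratpart (ds' d c) (es' d c) w^-1) ->
  exchange P t X Y.
Proof.
move=> p1 cXY cYX zXY zYX tE EE rat.
set p := xpow (2 * rho) in p1 tE.
exists (fun c d => contrG p (xpow al) (xpow be) (ds c d) (es c d)).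
exists (fun c d => contrG p (xpow al) (xpow be) (ds' c d) (es' c d)).
split=> [c d|c d|K L v _ u1 u2 hG hG' q mu].
- exact: (contrG_continuation p1 (cXY c d)).
- exact: (contrG_continuation p1 (cYX c d)).
(* The branches c, d of X Y are matched with d, c of Y X; their normally ordered operators coincide
   by [eval2_sym]. *)
suff key c d : t (u1 - u2) * ((X c).1 * (Y d).1
     * (zcontr P (X c).2 (Y d).2 u1 * contrG p (xpow al) (xpow be) (ds c d) (es c d) (xpow (2 * (u2 - u1))))
     * eval2 P (ncoef P (X c).2 (Y d).2) u1 u2 v q mu) =
   t (u2 - u1) * ((Y d).1 * (X c).1
     * (zcontr P (Y d).2 (X c).2 u2 * contrG p (xpow al) (xpow be) (ds' d c) (es' d c) (xpow (2 * (u1 - u2))))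
     * eval2 P (ncoef P (Y d).2 (X c).2) u2 u1 v q mu).
  exact: branch_sum_swap.
apply: (mulr_congr (eval2_sym P (X c).2 (Y d).2 u1 u2 v q mu)).
rewrite (zXY c d).
rewrite (zYX d c).
rewrite (tE (u1 - u2)).
rewrite (tE (u2 - u1)).
set w := xpow (2 * (u2 - u1)).
have wV : xpow (2 * (u1 - u2)) = w^-1 by rewrite -xpowN; congr xpow; ring.
have w0 : w != 0 := xpow_neq0 P _.
rewrite wV.
have hGi : holomorphic_at (contrG p (xpow al) (xpow be) (ds' d c) (es' d c)) w^-1.
  by rewrite -wV; exact: hG'.
have ex := contrG_exchange p1 (xpow_neq0 P al) (xpow_neq0 P be) w0
  (rat c d) (hG c d) hGi.
have scal : xpow (E (u1 - u2)) * xpow (2 * u1 * nu) =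
    w ^+ 2 * (xpow (E (u2 - u1)) * xpow (2 * u2 * nu)).
  rewrite -!xpowD -[w ^+ 2]xpow_double -xpowD; congr xpow.
  have := EE (u1 - u2); rewrite opprB => e.
  have -> : E (u1 - u2) = E (u2 - u1) - 4 * (u1 - u2) - 2 * (u1 - u2) * nu by rewrite -e addrK.
  ring.
transitivity ((X c).1 * (Y d).1 * (xpow (E (u1 - u2)) * xpow (2 * u1 * nu)) *
  (xpow (f c d) * (Theta p (xpow al / w) * Theta p (xpow be / w)) *
   contrG p (xpow al) (xpow be) (ds c d) (es c d) w)); first by ring.
rewrite scal.
transitivity ((X c).1 * (Y d).1 * (xpow (E (u2 - u1)) * xpow (2 * u2 * nu)) *
  (xpow (f c d) * w ^+ 2 * (Theta p (xpow al / w) * Theta p (xpow be / w)) *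
   contrG p (xpow al) (xpow be) (ds c d) (es c d) w)); first by ring.
by rewrite ex; ring.
Qed.

End Exchange.

(** * Rational identities for pairs of branches *)

Section RationalIdentities.
Variable R : realType.
Local Notation F := (complex R).
Variables (A Y w : F).
Hypotheses (A0 : A != 0) (Y0 : Y != 0) (w0 : w != 0).

Lemma subr_div_neq0 (a b : F) : b != 0 -> 1 - a / b != 0 -> (b - a != 0) && (a - b != 0).
Proof.
move=> b0 ab; rewrite -[a - b]opprB oppr_eq0 andbb.
by have -> : b - a = b * (1 - a / b) by [field]; rewrite mulf_neq0.
Qed.

(** Y stands for x^2. The leading Y or 1 is the part of the power of x from the zero modes that
    depends on the branch; the common part is divided out by [ratio_common]. *)
Lemma rat_same c d :
  \prod_(e <- [:: Y, Y^-1 & offdiag 1 1 c d]) (1 - e * w) != 0 ->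
  \prod_(e <- [:: Y, Y^-1 & offdiag 1 1 d c]) (1 - e * w^-1) != 0 ->
  (if c is CI then Y else 1) * w ^+ 2
    * ratpart (offdiag Y Y^-1 c d) [:: Y, Y^-1 & offdiag 1 1 c d] w =
  (if d is CI then Y else 1)
    * ratpart (offdiag Y Y^-1 d c) [:: Y, Y^-1 & offdiag 1 1 d c] w^-1.
Proof.
have h1 : 1 - Y * w != 0 -> (1 - Y * w != 0) && (Y * w - 1 != 0).
  by move=> h; apply: subr_div_neq0; rewrite ?divr1 ?oner_neq0.
have h2 : 1 - Y^-1 * w != 0 -> (Y - w != 0) && (w - Y != 0).
  by move=> h; apply: subr_div_neq0; rewrite ?[w / Y]mulrC.
have h3 : 1 - 1 * w != 0 -> (1 - w != 0) && (w - 1 != 0).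
  by move=> h; apply: subr_div_neq0; rewrite ?divr1 ?oner_neq0// -[w]mul1r.
rewrite /ratpart; case: c; case: d;
  rewrite /= !big_cons ?big_nil ?mulr1 ?mul1r !mulf_eq0 !negb_or.
- case/andP=> /h1/andP[n1 n2] /h2/andP[n3 n4] _.
  by field; rewrite w0 Y0 n1 n2 n3 n4.
- case/and3P=> /h1/andP[n1 n2] /h2/andP[n3 n4] n5 _.
  have n6 : w - 1 != 0 by rewrite -opprB oppr_eq0.
  by field; rewrite w0 Y0 n1 n2 n3 n4 n5 n6.
- case/and3P=> /h1/andP[n1 n2] /h2/andP[n3 n4] n5 _.
  have n6 : w - 1 != 0 by rewrite -opprB oppr_eq0.
  by field; rewrite w0 Y0 n1 n2 n3 n4 n5 n6.
- case/andP=> /h1/andP[n1 n2] /h2/andP[n3 n4] _.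
  by field; rewrite w0 Y0 n1 n2 n3 n4.
Qed.

(** A stands for x^s and Y for x^2. The leading factors are the powers of x from the zero modes,
    x^(2s-2), x^(4-2s) and the like, after division by the common x^-1. *)
Lemma rat_diff c d :
  \prod_(e <- [:: A / Y, A / Y & offdiag A A^-1 c d]) (1 - e * w) != 0 ->
  \prod_(e <- [:: Y / A, Y / A & offdiag A A^-1 d c]) (1 - e * w^-1) != 0 ->
  (if c is CI then 1 else A ^+ 2 / Y) * w ^+ 2
    * ratpart (offdiag (Y / A) (A / Y) c d) [:: A / Y, A / Y & offdiag A A^-1 c d] w =
  (if d is CI then Y ^+ 2 / A ^+ 2 else Y)
    * ratpart (offdiag (Y / A) (A / Y) d c) [:: Y / A, Y / A & offdiag A A^-1 d c] w^-1.
Proof.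
have h1 : 1 - A / Y * w != 0 -> (Y - A * w != 0) && (A * w - Y != 0).
  by move=> h; apply: subr_div_neq0; rewrite // mulrAC.
have h2 : 1 - A * w != 0 -> (1 - A * w != 0) && (A * w - 1 != 0).
  by move=> h; apply: subr_div_neq0; rewrite ?divr1 ?oner_neq0.
have h3 : 1 - A^-1 * w != 0 -> (A - w != 0) && (w - A != 0).
  by move=> h; apply: subr_div_neq0; rewrite ?[w / A]mulrC.
rewrite /ratpart; case: c; case: d;
  rewrite /= !big_cons ?big_nil ?mulr1 ?mul1r !mulf_eq0 !negb_or.
- case/andP=> /h1/andP[n1 n2] _ _.
  by field; rewrite w0 Y0 A0 n1 n2.
- case/and3P=> /h1/andP[n1 n2] _ /h3/andP[n3 n4] _.
  by field; rewrite w0 Y0 A0 n1 n2 n3 n4.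
- case/and3P=> /h1/andP[n1 n2] _ /h2/andP[n3 n4] _.
  by field; rewrite w0 Y0 A0 n1 n2 n3 n4.
- case/andP=> /h1/andP[n1 n2] _ _.
  by field; rewrite w0 Y0 A0 n1 n2.
Qed.

(** Interchanging I and II turns the rational identities for E E into those for F F, since the lists
    of zeros and poles of the two mixed pairs are exchanged. *)
Definition swap_branch c := if c is CI then CII else CI.

Lemma offdiag_swap (u v : F) c d : offdiag u v c d = offdiag v u (swap_branch c) (swap_branch d).
Proof. by case: c; case: d. Qed.

End RationalIdentities.

(** * Zero-mode exponents for E E and F F *)

Section Vertex.
Variables (R : realType) (P : params R).
Local Notation C := (complex R).
Local Notation r := (pr P).
Local Notation rs := (prs P).
Local Notation k := (pk P).
Local Notation s := (ps P).

Hypotheses (r0 : r != 0) (rs0 : rs != 0) (k0 : k != 0).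
Hypotheses (hsE : sqE P ^+ 2 = 2 * r / (k * rs)) (hsF : sqF P ^+ 2 = 2 * rs / (k * r))
  (hsEF : sqE P * sqF P = 2 / k).

Lemma vxE_same j d : vx (EV P j CI) (vshift (EV P j d)) = 2 + vx (EV P j CII) (vshift (EV P j d)).
Proof. by case: j; case: d; rewrite /= /zh /zh0 /zh1 /zh2 /= !add0r; field. Qed.

Lemma vxF_same j d : vx (FV P j CII) (vshift (FV P j d)) = 2 + vx (FV P j CI) (vshift (FV P j d)).
Proof. by case: j; case: d; rewrite /= /zh /zh0 /zh1 /zh2 /= !add0r; field. Qed.

Lemma vxE_12 c d : vx (EV P N1 c) (vshift (EV P N2 d)) = -1 + (if c is CI then 0 else 2 * s - 2).
Proof. by case: c; case: d; rewrite /= /zh /zh0 /zh1 /zh2 /= !add0r; field. Qed.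

Lemma vxE_21 c d : vx (EV P N2 c) (vshift (EV P N1 d)) = -1 + (if c is CI then 4 - 2 * s else 2).
Proof. by case: c; case: d; rewrite /= /zh /zh0 /zh1 /zh2 /= !add0r; field. Qed.

Lemma vxF_12 c d : vx (FV P N1 c) (vshift (FV P N2 d)) = -1 + (if c is CI then 2 * s - 2 else 0).
Proof. by case: c; case: d; rewrite /= /zh /zh0 /zh1 /zh2 /= !add0r; field. Qed.

Lemma vxF_21 c d : vx (FV P N2 c) (vshift (FV P N1 d)) = -1 + (if c is CI then 2 else 4 - 2 * s).
Proof. by case: c; case: d; rewrite /= /zh /zh0 /zh1 /zh2 /= !add0r; field. Qed.

(** As r = rs + k, the momentum P_0 contributes 2r / (k rs) = 2/k + 2/rs. The term in h removes 2/k,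
    and only the part depending on rs remains to be balanced by the brackets. *)
Let sEE : sqE P * sqE P = 2 / k + 2 / rs.
Proof. by rewrite -expr2 hsE /pk; field; rewrite rs0 -/(pk P) k0. Qed.

Let sFF : sqF P * sqF P = 2 / k - 2 / r.
Proof. by rewrite -expr2 hsF /pk; field; rewrite r0 -/(pk P) k0. Qed.

Lemma vzE_same j c d : vz (EV P j c) (vshift (EV P j d)) = 2 / rs.
Proof.
transitivity (sqE P * sqE P - 2 / k); last by rewrite sEE addrC addKr.
by case: j; case: c; case: d; rewrite /= /zP0 /zh /= !add0r !addr0; field.
Qed.

Lemma vzF_same j c d : vz (FV P j c) (vshift (FV P j d)) = - (2 / r).
Proof.
transitivity (sqF P * sqF P - 2 / k); last by rewrite sFF addrC addKr.
by case: j; case: c; case: d; rewrite /= /zP0 /zh /= !add0r !addr0; field.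
Qed.

Lemma vzE_diff i j c d : i != j -> vz (EV P i c) (vshift (EV P j d)) = - (2 / rs).
Proof.
move=> ij; transitivity (- (sqE P * sqE P) + 2 / k); last by rewrite sEE opprD addrAC addNr add0r.
by case: i ij; case: j => //= _; case: c; case: d; rewrite /= /zP0 /zh /= !add0r !addr0; field.
Qed.

Lemma vzF_diff i j c d : i != j -> vz (FV P i c) (vshift (FV P j d)) = 2 / r.
Proof.
move=> ij; transitivity (- (sqF P * sqF P) + 2 / k); last by rewrite sFF opprB subrK.
by case: i ij; case: j => //= _; case: c; case: d; rewrite /= /zP0 /zh /= !add0r !addr0; field.
Qed.

End Vertex.

Lemma ratio_common (F : comPzRingType) (b f f' g g' w2 t t' : F) :
  f = b * g -> f' = b * g' -> g * w2 * t = g' * t' -> f * w2 * t = f' * t'.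
Proof. by move=> -> -> e; rewrite -!mulrA [g * _]mulrA e. Qed.

Section ExchangeRelations.
Variables (R : realType) (P : params R).
Local Notation C := (complex R).
Local Notation normc := ComplexField.Normc.normc.
Local Arguments normc : simpl never.
Local Notation r := (pr P).
Local Notation rs := (prs P).
Local Notation k := (pk P).
Local Notation s := (ps P).
Local Notation x := (xx P).
Local Notation xpow := (xpow P).

Hypotheses (r0 : r != 0) (rs0 : rs != 0) (k0 : k != 0).
Hypotheses (hsE : sqE P ^+ 2 = 2 * r / (k * rs)) (hsF : sqF P ^+ 2 = 2 * rs / (k * r)).
Hypotheses (hx1 : normc x < 1) (hpr : normc (xpow (2 * r)) < 1)
  (hprs : normc (xpow (2 * rs)) < 1)
  (hkm : forall n, (0 < n)%N -> qint P (k * n%:R) != 0).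

Lemma zcontrE (V W : vop R) nu u : vz V (vshift W) = nu ->
  zcontr P V W u = xpow (vx V (vshift W)) * xpow (2 * u * nu).
Proof. by rewrite /zcontr => ->. Qed.

Definition bracket_exp (rho a b u : C) : C :=
  ((u + a) ^+ 2 / rho - (u + a)) + ((u + b) ^+ 2 / rho - (u + b)).

Lemma bracketM rho a b al be u : al = 2 * a -> be = 2 * b ->
  bracket P rho (u + a) * bracket P rho (u + b) =
  xpow (bracket_exp rho a b u) * (Theta (xpow (2 * rho)) (xpow al * xpow (2 * u))
     * Theta (xpow (2 * rho)) (xpow be * xpow (2 * u))).
Proof.
move=> -> ->; have t c : xpow (2 * c) * xpow (2 * u) = xpow (2 * (u + c)).
  by rewrite -xpowD -mulrDr addrC.
rewrite (t a) (t b) [xpow (bracket_exp _ _ _ _)]xpowD.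
exact: mulrACA.
Qed.

Lemma vshiftE j c d : vshift (EV P j c) = vshift (EV P j d).
Proof. by case: j; case: c; case: d; reflexivity. Qed.

Lemma vshiftF j c d : vshift (FV P j c) = vshift (FV P j d).
Proof. by case: j; case: c; case: d; reflexivity. Qed.

Lemma xpow_vxE_same j c d : xpow (vx (EV P j c) (vshift (EV P j d))) =
  xpow (vx (EV P j CII) (vshift (EV P j CI))) * (if c is CI then xpow 2 else 1).
Proof.
rewrite (vshiftE j d CI); case: c; last by rewrite mulr1.
by rewrite vxE_same xpowD mulrC.
Qed.

Lemma xpow_vxF_same j c d : xpow (vx (FV P j c) (vshift (FV P j d))) =
  xpow (vx (FV P j CI) (vshift (FV P j CI))) * (if swap_branch c is CI then xpow 2 else 1).
Proof.
rewrite (vshiftF j d CI); case: c; first by rewrite mulr1.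
by rewrite vxF_same xpowD mulrC.
Qed.

(** The odd part: the values at u and at - u differ by 4 u (a + b) / rho - 4 u. The relation between
    nu and the shifts a, b makes 2 u nu cancel the first term. *)
Lemma bracket_exp_odd rho a b nu u : rho != 0 -> rho * nu = - (2 * (a + b)) ->
  bracket_exp rho a b u + 2 * u * nu = bracket_exp rho a b (- u) - 4 * u.
Proof.
move=> rho0 e; have -> : nu = - (2 * (a + b)) / rho by rewrite -e mulrAC mulfV// mul1r.
by rewrite /bracket_exp; field.
Qed.

Let x20 := xpow_neq0 P 2.
Let xs0 := xpow_neq0 P s.

(** The shifts of the brackets are half the exponents of the q-products: shifts 0 and -1 match x^0
    and x^-2 in [contrE_same]. The three other exchange relations follow the same pattern. *)
Lemma exchange_E_same j :
  exchange P (fun u => bracket P rs u * bracket P rs (u - 1)) (curE P j) (curE P j).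
Proof.
apply: (@exchange_intro R P _ _ _ rs 0 (- 2) (2 / rs) (bracket_exp rs 0 (- 1))
  (offdiag (xpow 2) (xpow (- 2)))
  (fun c d => [:: xpow 2, xpow (- 2) & offdiag (xpow 0) (xpow 0) c d])
  (offdiag (xpow 2) (xpow (- 2)))
  (fun c d => [:: xpow 2, xpow (- 2) & offdiag (xpow 0) (xpow 0) c d])
  (fun c d => vx (EV P j c) (vshift (EV P j d)))
  (fun c d => vx (EV P j c) (vshift (EV P j d)))) => //.
- by move=> c d n n0; exact: contrE_same.
- by move=> c d n n0; exact: contrE_same.
- by move=> c d u; apply: zcontrE; exact: vzE_same.
- by move=> c d u; apply: zcontrE; exact: vzE_same.
- by move=> u; rewrite -{1}[u]addr0; apply: bracketM; ring.
- by move=> u; apply: bracket_exp_odd => //; field.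
- rewrite (xpow0 P) (xpowN P 2) => c d w w0 h1 h2.
  exact: (ratio_common (xpow_vxE_same j c d) (xpow_vxE_same j d c) (rat_same x20 w0 h1 h2)).
Qed.

Lemma exchange_F_same j :
  exchange P (fun u => bracket P r u * bracket P r (u + 1)) (curF P j) (curF P j).
Proof.
apply: (@exchange_intro R P _ _ _ r 0 2 (- (2 / r)) (bracket_exp r 0 1)
  (offdiag (xpow (- 2)) (xpow 2))
  (fun c d => [:: xpow 2, xpow (- 2) & offdiag (xpow 0) (xpow 0) c d])
  (offdiag (xpow (- 2)) (xpow 2))
  (fun c d => [:: xpow 2, xpow (- 2) & offdiag (xpow 0) (xpow 0) c d])
  (fun c d => vx (FV P j c) (vshift (FV P j d)))
  (fun c d => vx (FV P j c) (vshift (FV P j d)))) => //.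
- by move=> c d n n0; exact: contrF_same.
- by move=> c d n n0; exact: contrF_same.
- by move=> c d u; apply: zcontrE; exact: vzF_same.
- by move=> c d u; apply: zcontrE; exact: vzF_same.
- by move=> u; rewrite -{1}[u]addr0; apply: bracketM; ring.
- by move=> u; apply: bracket_exp_odd => //; field.
- rewrite (xpow0 P) (xpowN P 2) => c d w w0.
  rewrite !(offdiag_swap _ _ c d) !(offdiag_swap _ _ d c) => h1 h2.
  exact: (ratio_common (xpow_vxF_same j c d) (xpow_vxF_same j d c) (rat_same x20 w0 h1 h2)).
Qed.

Lemma xpow_s2 : xpow (s - 2) = xpow s / xpow 2. Proof. exact: xpowB. Qed.
Lemma xpow_2s : xpow (2 - s) = xpow 2 / xpow s. Proof. exact: xpowB. Qed.

Lemma xpow_2s2 : xpow (2 * s - 2) = xpow s ^+ 2 / xpow 2.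
Proof. by rewrite xpowB xpow_double. Qed.

Lemma xpow_42s : xpow (4 - 2 * s) = xpow 2 ^+ 2 / xpow s ^+ 2.
Proof.
by rewrite xpowB xpow_double -[xpow 2 ^+ 2]xpow_double; congr (xpow _ / _); ring.
Qed.

Lemma xpow_vxE_12 c d : xpow (vx (EV P N1 c) (vshift (EV P N2 d))) =
  xpow (- 1) * (if c is CI then 1 else xpow s ^+ 2 / xpow 2).
Proof. by rewrite vxE_12 xpowD; case: c; rewrite ?xpow0 ?xpow_2s2. Qed.

Lemma xpow_vxE_21 c d : xpow (vx (EV P N2 c) (vshift (EV P N1 d))) =
  xpow (- 1) * (if c is CI then xpow 2 ^+ 2 / xpow s ^+ 2 else xpow 2).
Proof. by rewrite vxE_21 xpowD; case: c; rewrite ?xpow_42s. Qed.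

Lemma xpow_vxF_12 c d : xpow (vx (FV P N1 c) (vshift (FV P N2 d))) =
  xpow (- 1) * (if swap_branch c is CI then 1 else xpow s ^+ 2 / xpow 2).
Proof. by rewrite vxF_12 xpowD; case: c; rewrite ?xpow0 ?xpow_2s2. Qed.

Lemma xpow_vxF_21 c d : xpow (vx (FV P N2 c) (vshift (FV P N1 d))) =
  xpow (- 1) * (if swap_branch c is CI then xpow 2 ^+ 2 / xpow s ^+ 2 else xpow 2).
Proof. by rewrite vxF_21 xpowD; case: c; rewrite ?xpow_42s. Qed.

Lemma exchange_E_12 :
  exchange P (fun u => bracket P rs (u + s / 2) * bracket P rs (u - s / 2 + 1))
    (curE P N1) (curE P N2).
Proof.
apply: (@exchange_intro R P _ _ _ rs s (2 - s) (- (2 / rs)) (bracket_exp rs (s / 2) (1 - s / 2))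
  (offdiag (xpow (2 - s)) (xpow (s - 2)))
  (fun c d => [:: xpow (s - 2), xpow (s - 2) & offdiag (xpow s) (xpow (- s)) c d])
  (offdiag (xpow (2 - s)) (xpow (s - 2)))
  (fun c d => [:: xpow (2 - s), xpow (2 - s) & offdiag (xpow s) (xpow (- s)) c d])
  (fun c d => vx (EV P N1 c) (vshift (EV P N2 d)))
  (fun c d => vx (EV P N2 c) (vshift (EV P N1 d)))) => //.
- by move=> c d n n0; exact: contrE_12.
- by move=> c d n n0; exact: contrE_21.
- by move=> c d u; apply: zcontrE; exact: vzE_diff.
- by move=> c d u; apply: zcontrE; exact: vzE_diff.
- move=> u; have -> : u - s / 2 + 1 = u + (1 - s / 2) by ring.
  by apply: bracketM; field.
- by move=> u; apply: bracket_exp_odd => //; field.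
- rewrite xpow_s2 xpow_2s (xpowN P s) => c d w w0 h1 h2.
  exact: (ratio_common (xpow_vxE_12 c d) (xpow_vxE_21 d c) (rat_diff xs0 x20 w0 h1 h2)).
Qed.

Lemma exchange_F_12 :
  exchange P (fun u => bracket P r (u - s / 2) * bracket P r (u + s / 2 - 1))
    (curF P N1) (curF P N2).
Proof.
apply: (@exchange_intro R P _ _ _ r (- s) (s - 2) (2 / r) (bracket_exp r (- (s / 2)) (s / 2 - 1))
  (offdiag (xpow (s - 2)) (xpow (2 - s)))
  (fun c d => [:: xpow (s - 2), xpow (s - 2) & offdiag (xpow (- s)) (xpow s) c d])
  (offdiag (xpow (s - 2)) (xpow (2 - s)))
  (fun c d => [:: xpow (2 - s), xpow (2 - s) & offdiag (xpow (- s)) (xpow s) c d])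
  (fun c d => vx (FV P N1 c) (vshift (FV P N2 d)))
  (fun c d => vx (FV P N2 c) (vshift (FV P N1 d)))) => //.
- by move=> c d n n0; exact: contrF_12.
- by move=> c d n n0; exact: contrF_21.
- by move=> c d u; apply: zcontrE; exact: vzF_diff.
- by move=> c d u; apply: zcontrE; exact: vzF_diff.
- move=> u; have -> : u + s / 2 - 1 = u + (s / 2 - 1) by ring.
  by apply: bracketM; field.
- by move=> u; apply: bracket_exp_odd => //; field.
- rewrite xpow_s2 xpow_2s (xpowN P s) => c d w w0.
  rewrite !(offdiag_swap _ _ c d) !(offdiag_swap _ _ d c) => h1 h2.
  exact: (ratio_common (xpow_vxF_12 c d) (xpow_vxF_21 d c) (rat_diff xs0 x20 w0 h1 h2)).
Qed.

End ExchangeRelations.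

(** * The commutator of E and F *)

Local Arguments oexpZ : simpl never.

Lemma scale_regroup (K : comNzRingType) (L : lmodType K) (a b c g X Y : K) (w : L) :
  X = a * b -> Y = a * c -> X * c *: (g *: w) = b *: (g *: (Y *: w)).
Proof. by move=> -> ->; rewrite !scalerA; congr (_ *: _); ring. Qed.

Section Products.
Variables (R : realType) (P : params R).
Local Notation C := (complex R).
Local Notation bfock := (bfock R).
Implicit Types (V W : vop R) (p : bfock) (v : fock R) (q : qcharge R).
Local Notation xpow := (xpow P).

Lemma comm_bannih_bcreat0 V W m n p : (0 < m)%N -> (0 < n)%N ->
  bannih P V m (bcreat P W n p) =
  bcreat P W n (bannih P V m p) + (if m == n then contr P V W m else 0) *: p.
Proof. by move=> _; exact: comm_bannih_bcreat. Qed.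

(* [g] lists the coefficients of exp (\sum_(m > 0) contr P V W m t^m), which are
   determined by the logarithmic derivative. *)
Definition contr_coef V W (g : int -> C) :=
  [/\ g 0 = 1, (forall k : int, k < 0 -> g k = 0) &
   forall (k : int) (N : nat), k < N%:Z ->
     k%:~R * g k = \sum_(1 <= m < N) m%:R * contr P V W m * g (k - m%:Z)].

Lemma TZ_SZ V W g : contr_coef V W g -> forall (N : nat) a b p, a < N%:Z ->
  TZ P V a (SZ P W b p) =
  \sum_(0 <= j < N) g j%:Z *: SZ P W (b - j%:Z) (TZ P V (a - j%:Z) p).
Proof.
move=> [g0 gneg grec] N a b p.
exact: (@oexpZ_contraction C bfock (bannih P V) (lin_bannih P V) (@comm_bannih R P V V)
  (bcreat P W) (contr P V W) (lin_bcreat P W) (@comm_bcreat R P W W)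
  (@comm_bannih_bcreat0 V W) g g0 gneg grec N a b p).
Qed.

Lemma SZ0 V (n : int) p : n < 0 -> SZ P V n p = 0. Proof. exact: oexpZ_neg. Qed.
Lemma TZ0 V (n : int) p : n < 0 -> TZ P V n p = 0. Proof. exact: oexpZ_neg. Qed.

(** The zero modes of V act after the charge has been shifted by W. This gives the factor x^(vx V
    (vshift W)) but, as vz V vanishes on that shift, no power of z_1: exponents move only through
    the bosonic contraction, by integers. *)
Lemma vcoef_vcoef V W g e1 e2 v q : contr_coef V W g ->
  (forall a b, vx V (a + b) = vx V a + vx V b) ->
  (forall a b, vz V (a + b) = vz V a + vz V b) ->
  vz V (vshift W) = 0 ->
  exists J : nat,
    (forall j : nat, (J < j)%N -> ncoef P V W (e1 + j%:Z%:~R) (e2 - j%:Z%:~R) v q = 0) /\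
    vcoef P V e1 (vcoef P W e2 v) q = xpow (vx V (vshift W)) *:
      \sum_(0 <= j < J.+1) g j%:Z *: ncoef P V W (e1 + j%:Z%:~R) (e2 - j%:Z%:~R) v q.
Proof.
move=> gP vxD vzD vz0; set q2 := q - (vshift V + vshift W).
have q1E : q - vshift V = q2 + vshift W by rewrite /q2 opprD addrA subrK.
have q2E : q - vshift V - vshift W = q2 by rewrite q1E addrK.
have vz1 : vz V (q - vshift V) = vz V q2 by rewrite q1E vzD vz0 addr0.
have vx1 : vx V (q - vshift V) = vx V q2 + vx V (vshift W) by rewrite q1E vxD.
pose p : bfock := v q2.
have wE : vcoef P W e2 v (q - vshift V) =
    xpow (vx W q2) *: vsum P W (vz W q2) e2 p.
  by rewrite (vcoefE P W e2 v (q - vshift V)) q2E.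
have VE : vcoef P V e1 (vcoef P W e2 v) q = xpow (vx V q2 + vx V (vshift W)) *:
    vsum P V (vz V q2) e1 (xpow (vx W q2) *: vsum P W (vz W q2) e2 p).
  apply: (etrans (vcoefE P V e1 (vcoef P W e2 v) q)).
  exact (f_equal3 (fun a b w => xpow a *: vsum P V b e1 w) vx1 vz1 wE).
have nE (f1 f2 : C) : ncoef P V W f1 f2 v q =
    xpow (vx V q2 + vx W q2) *: nsum P V W (vz V q2) f1 (vz W q2) f2 p.
  exact (ncoefE P V W f1 f2 v q).
have [J [N0 NE]] := @product_form C bfock (SZ P V) (SZ P W) (TZ P V) (TZ P W)
  (@SZ0 V) (@SZ0 W) (lin_SZ P V) (lin_SZ P W) (@TZ0 V) (lin_TZ P V) g (TZ_SZ gP)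
  (@comm_TZ R P V W) (lin_TZ P W) (bannih_nilpotent P V) (bannih_nilpotent P W)
  (vz V q2) e1 (vz W q2) e2 (xpow (vx W q2)) p.
exists J; split=> [j Jj|].
  apply: (etrans (nE _ _)); apply: (etrans (congr1 _ (N0 j Jj))); exact: scaler0.
apply: (etrans VE); apply: (etrans (congr1 _ NE)).
apply: (etrans (scalerA _ _ _)); apply: (etrans (scaler_sumr _ _ _ _)).
apply: (etrans _ (esym (scaler_sumr _ _ _ _))); apply: eq_bigr => j _.
apply: (etrans (scale_regroup _ _ (xpowD P _ _) (xpowD P _ _))).
apply: congr1; apply: congr1; apply: esym; exact: nE.
Qed.

End Products.


Section VertexEF.
Variables (R : realType) (P : params R).
Local Notation C := (complex R).
Local Notation k := (pk P).
Local Notation s := (ps P).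
Hypotheses (k0 : k != 0) (hsEF : sqE P * sqF P = 2 / k).


Lemma zeromodeD (a b : qcharge R) :
  [/\ zP0 (a + b) = zP0 a + zP0 b, zh (a + b) = zh a + zh b,
   zh0 P (a + b) = zh0 P a + zh0 P b, zh1 P (a + b) = zh1 P a + zh1 P b &
   zh2 P (a + b) = zh2 P a + zh2 P b].
Proof. by rewrite /zP0 /zh /zh0 /zh1 /zh2 /= !intrD !mulrDr. Qed.

Lemma vxED j c a b : vx (EV P j c) (a + b) = vx (EV P j c) a + vx (EV P j c) b.
Proof.
have [_ hD h0D h1D h2D] := zeromodeD a b.
by case: j; case: c => /=; rewrite hD h0D ?h1D ?h2D; ring.
Qed.

Lemma vxFD j c a b : vx (FV P j c) (a + b) = vx (FV P j c) a + vx (FV P j c) b.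
Proof.
have [_ hD h0D h1D h2D] := zeromodeD a b.
by case: j; case: c => /=; rewrite hD h0D ?h1D ?h2D; ring.
Qed.

Lemma vzED j c a b : vz (EV P j c) (a + b) = vz (EV P j c) a + vz (EV P j c) b.
Proof.
have [_ hD _ _ _] := zeromodeD a b.
by case: j; case: c => /=; rewrite hD; ring.
Qed.

Lemma vzFD j c a b : vz (FV P j c) (a + b) = vz (FV P j c) a + vz (FV P j c) b.
Proof.
have [_ hD _ _ _] := zeromodeD a b.
by case: j; case: c => /=; rewrite hD; ring.
Qed.

(** The choice of the square roots enters here: with sqE sqF = 2/k the contribution of P_0 cancels
    that of h. *)
Lemma vzEF j c d : vz (EV P j c) (vshift (FV P j d)) = 0.
Proof.
transitivity (- (sqE P * sqF P) + 2 / k); last by rewrite hsEF addNr.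
by case: j; case: c; case: d; rewrite /= /zP0 /zh /= !add0r !addr0; field.
Qed.

Lemma vzFE j c d : vz (FV P j c) (vshift (EV P j d)) = 0.
Proof.
transitivity (- (sqE P * sqF P) + 2 / k); last by rewrite hsEF addNr.
by case: j; case: c; case: d; rewrite /= /zP0 /zh /= !add0r !addr0; field.
Qed.

(** F_j shifts along alpha_j, which commutes with h_j; only h and h_0 contribute, h giving -1 or 1
    by the branch of E_j and h_0 giving s - 2 or 2 - s by the node. *)
Lemma vxEF j c d : vx (EV P j c) (vshift (FV P j d)) =
  (if c is CI then -1 else 1) + (- 1) ^+ (node_nat j).-1 * (s - 2).
Proof.
case: j; case: c; case: d;
  by rewrite /= ?expr0 ?expr1 /zh /zh0 /zh1 /zh2 /= !add0r; field.
Qed.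

Lemma vxFE j c d : vx (FV P j c) (vshift (EV P j d)) =
  (if c is CI then 1 else -1) + (- 1) ^+ (node_nat j).-1 * (s - 2).
Proof.
case: j; case: c; case: d;
  by rewrite /= ?expr0 ?expr1 /zh /zh0 /zh1 /zh2 /= !add0r; field.
Qed.

End VertexEF.

(** * Rational contractions and the delta function *)

Section ContractionCoefficients.
Variable K : numFieldType.

(* Coefficients of (1 - a y t) / (1 - y t). *)
Definition geom_coef (a y : K) (n : int) : K :=
  match n with Posz 0 => 1 | Posz m.+1 => y ^+ m.+1 * (1 - a) | Negz _ => 0 end.

Lemma geom_coef_neg a y n : n < 0 -> geom_coef a y n = 0. Proof. by case: n. Qed.

(** The logarithm of (1 - a y t) / (1 - y t) is the sum of the y^m (1 - a^m) t^m / m, so this is the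
    recursion by the logarithmic derivative. *)
Lemma geom_coef_rec a y (c : nat -> K) (n : int) (N : nat) :
  (forall m, (0 < m)%N -> m%:R * c m = y ^+ m * (1 - a ^+ m)) -> n < N%:Z ->
  n%:~R * geom_coef a y n = \sum_(1 <= m < N) m%:R * c m * geom_coef a y (n - m%:Z).
Proof.
move=> cE nN; case: n nN => [[|n]|n] nN.
- rewrite mul0r sum_nat_eq0// => m /andP[m1 _].
  by rewrite geom_coef_neg ?mulr0//; lia.
- rewrite (@big_cat_nat _ _ _ n.+2 1 N)//= [X in _ = _ + X]sum_nat_eq0 ?addr0; last first.
    by move=> m /andP[nm _]; rewrite geom_coef_neg ?mulr0//; lia.
  rewrite big_nat_recr//= subrr mulr1 cE//.
  transitivity (\sum_(1 <= m < n.+1) y ^+ n.+1 * ((1 - a) * (1 - a ^+ m)) +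
    y ^+ n.+1 * (1 - a ^+ n.+1)).
    rewrite -mulr_sumr -mulr_sumr -mulrDr -[_%:~R]/(n.+1%:R) mulrCA; congr (_ * _).
    elim: n {nN} => [|n IH].
      by rewrite big_geq// mulr0 add0r mul1r expr1.
    rewrite big_nat_recr//= -natr1 mulrDl IH [a ^+ n.+2]exprS; ring.
  congr (_ + _); apply: eq_big_nat => m /andP[m1 mn].
  rewrite cE//; have -> : Posz n.+1 - m%:Z = Posz (n - m).+1 by lia.
  have -> : n.+1 = (m + (n - m).+1)%N by lia.
  by rewrite /= exprD; ring.
rewrite mulr0 sum_nat_eq0// => m /andP[m1 _].
by rewrite geom_coef_neg ?mulr0//; lia.
Qed.

End ContractionCoefficients.


Section BilateralSum.
Variables (K : numFieldType) (L : lmodType K).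

Lemma fsum_int (F : int -> L) (J J' : nat) :
  (forall j : nat, (J < j)%N -> F j%:Z = 0) -> (forall j : nat, (J' < j)%N -> F (- j%:Z) = 0) ->
  \sum_(n \in [set: int]) F n =
  F 0 + \sum_(0 <= j < J) F j.+1%:Z + \sum_(0 <= j < J') F (- j.+1%:Z).
Proof.
move=> FJ FJ'.
rewrite (@fsbigE _ _ _ _ _ ([seq j%:Z | j <- index_iota 0 J.+1] ++
  [seq Negz j | j <- index_iota 0 J'])); first last.
- move=> [n|n] _ nN.
    apply: FJ; rewrite ltnNge; apply: contra nN => nJ.
    by rewrite mem_cat map_f// mem_index_iota.
  rewrite NegzE; apply: FJ'; rewrite ltnNge; apply: contra nN => nJ.
  by rewrite mem_cat orbC map_f// mem_index_iota.
- by [].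
- rewrite cat_uniq !map_inj_uniq ?iota_uniq ?andbT/=; try by move=> ? ? [].
  by apply/hasPn => _ /mapP[n _ ->]; apply/mapP => -[].
rewrite (eq_bigl xpredT); last by move=> n; rewrite in_setT.
rewrite big_cat !big_map big_nat_recl//=; congr (_ + _ + _).
Qed.

(** A and B are the zero-mode factors of the two orders, and the three hypotheses on them compare
    the coefficients of index 0, positive and negative. For a different from 1 they force B = a A:
    both sums expand the rational function A (1 - a y t) / (1 - y t), in t and in 1/t. For a = 1
    they give c = 0. *)
Lemma bilateral_sum (N : int -> L) (a y A B c : K) (J J' : nat) :
  (forall j : nat, (J < j)%N -> N j%:Z = 0) -> (forall j : nat, (J' < j)%N -> N (- j%:Z) = 0) ->
  A - B = c -> A * (1 - a) = c -> B * (1 - a^-1) = - c ->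
  A *: (\sum_(0 <= j < J.+1) geom_coef a y j%:Z *: N j%:Z)
  - B *: (\sum_(0 <= j < J'.+1) geom_coef a^-1 y^-1 j%:Z *: N (- j%:Z)) =
  c *: \sum_(n \in [set: int]) (y ^ n) *: N n.
Proof.
move=> NJ NJ' AB Aa Ba.
rewrite (@fsum_int _ J J'); last 2 first.
- by move=> j /NJ ->; rewrite scaler0.
- by move=> j /NJ' ->; rewrite scaler0.
rewrite !big_nat_recl//= oppr0 !scale1r !scalerDr opprD addrACA -scalerBl AB -addrA.
congr (_ + (_ + _)).
  rewrite !scaler_sumr; apply: eq_bigr => j _.
  by rewrite !scalerA -Aa; congr (_ *: _); rewrite mulrA mulrAC.
rewrite !scaler_sumr -sumrN; apply: eq_bigr => j _.
rewrite !scalerA -scaleNr; congr (_ *: _).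
rewrite -[y ^ _]exprVn -[c]opprK -Ba; ring.
Qed.

End BilateralSum.

(** Sums over infinite index sets are additive only under control of the supports; a common bound of
    nilpotency for p and q reduces both to the same finite range. *)
Lemma lin_vform (K : numFieldType) (L : lmodType K) (S T : int -> L -> L) (e0 e : K) :
  (forall (k : int) q, k < 0 -> S k q = 0) -> (forall k, lin (S k)) -> (forall k, lin (T k)) ->
  (forall p, exists N : nat, forall k : int, N%:Z <= k -> T k p = 0) ->
  lin (fun p => \sum_(t \in [set t : nat * nat | e0 + t.1%:R - t.2%:R = e])
     S t.1%:Z (T t.2%:Z p)).
Proof.
move=> S0 linS linT nilT c p q.
have [[d eE]|/forallNP eN] := pselect (exists d : int, e = e0 + d%:~R); last first.
  by rewrite !(@vform0 K L S T)// scaler0 addr0.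
have [N1 TN1] := nilT p; have [N2 TN2] := nilT q.
pose N := maxn N1 N2.
have TN1' k : N%:Z <= k -> T k p = 0 by move=> kN; apply: TN1; move: kN; rewrite /N; lia.
have TN2' k : N%:Z <= k -> T k q = 0 by move=> kN; apply: TN2; move: kN; rewrite /N; lia.
rewrite !(@vform _ _ S T _ _ d N)//; last by move=> k kN; rewrite linT TN1'// TN2'// scaler0 addr0.
rewrite scaler_sumr -big_split; apply: eq_bigr => n _ /=.
by rewrite linT linS.
Qed.

Section CommutatorEF.
Variables (R : realType) (P : params R).
Local Notation C := (complex R).
Local Notation normc := ComplexField.Normc.normc.
Local Arguments normc : simpl never.
Local Arguments bcomm : simpl never.
Local Notation k := (pk P).
Local Notation s := (ps P).
Local Notation xpow := (xpow P).
Local Notation x := (xx P).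
Hypotheses (k0 : k != 0) (hsEF : sqE P * sqF P = 2 / k).
Hypotheses (hx1 : normc x < 1)
  (hkm : forall n, (0 < n)%N -> qint P (k * n%:R) != 0).

(* With a = ratioEF c d and y = poleEF c, the contraction of the branches c of
   E_j(z_1) and d of F_j(z_2) is (1 - a y w) / (1 - y w), w = z_2 / z_1. *)
Definition ratioEF c d : C :=
  match c, d with CI, CI => x ^+ 2 | CII, CII => x ^- 2 | _, _ => 1 end.

Definition poleEF c : C := xpow (if c is CI then k else - k).

(** Hence the pairs of different branches, whose gamma coefficient is -1, have zero contraction. *)
Lemma bcomm_alpha_talpha j n :
  bcomm P (Kalpha, j) (Ktalpha, j) n = - bcomm P (Kgamma, j) (Kgamma, j) n /\
  bcomm P (Ktalpha, j) (Kalpha, j) n = - bcomm P (Kgamma, j) (Kgamma, j) n.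
Proof. by rewrite /bcomm eqxx mulNr. Qed.

Section FixedMode.
Variable n : nat.
Hypothesis n0 : (0 < n)%N.
Local Notation m := (n%:R : C).
Local Notation X := (xpow m).
Local Notation K := (xpow (k * m / 2)).
Local Notation br := (qbr (x - x^-1)).
Local Notation cf := ((K ^+ 2 * X + (K ^+ 2 * X)^-1) / (X + X^-1)).
Local Notation gam := (m^-1 * (br (X ^+ 2) / br (K ^+ 2))).

Let ratio_expr c d : ratioEF c d ^+ n =
  match c, d with CI, CI => X ^+ 2 | CII, CII => X ^- 2 | _, _ => 1 end.
Proof.
by case: c; case: d; rewrite /= ?expr1n// ?exprVn -exprM mulnC exprM xpow_nat.
Qed.

Let pole_expr c : poleEF c ^+ n = if c is CI then K ^+ 2 else K ^- 2.
Proof.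
have kE : xpow k ^+ n = K ^+ 2 by exact: (etrans (esym (xpowMn P k n)) (xpow_km P n)).
by case: c; rewrite /poleEF ?xpowN ?exprVn kE.
Qed.

Let cancelI : gam + - (K ^+ 2 * cf) * gam = m^-1 * (K ^+ 2 * (1 - X ^+ 2)).
Proof.
have e := contrEF_I (q_neq0 hx1) (xpow_neq0 P m) (xpow_neq0 P (k * m / 2)) (m_neq0 _ n0)
  (plus_neq0 hx1 n0) (brK_neq0 hkm n0).
by rewrite mulNr -[X in _ - X]mulrA e [_ * (1 - _)]mulrBr mulr1.
Qed.

Let cancelII : gam + - (K ^- 2 * cf) * gam = m^-1 * (K ^- 2 * (1 - X ^- 2)).
Proof.
have e := contrEF_II (q_neq0 hx1) (xpow_neq0 P m) (xpow_neq0 P (k * m / 2)) (m_neq0 _ n0)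
  (plus_neq0 hx1 n0) (brK_neq0 hkm n0).
by rewrite mulNr -[X in _ - X]mulrA e [_ * (1 - _)]mulrBr mulr1.
Qed.

Lemma contrEF_mode j c d :
  m * contr P (EV P j c) (FV P j d) n = poleEF c ^+ n * (1 - ratioEF c d ^+ n).
Proof.
rewrite (contr_EF hx1 hkm n0) (bcomm_alpha_talpha j n).1 opprK.
rewrite ratio_expr pole_expr bcomm_gamma eqxx.
have mm (t : C) : m * (m^-1 * t) = t by exact: (mulVKf (m_neq0 _ n0)).
case: c; case: d; rewrite /coefEF ?mulN1r ?subrr ?mulr0//.
  by rewrite cancelI mm.
by rewrite cancelII mm.
Qed.

Lemma contrFE_mode j c d :
  m * contr P (FV P j d) (EV P j c) n = (poleEF c)^-1 ^+ n * (1 - (ratioEF c d)^-1 ^+ n).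
Proof.
rewrite (contr_FE hx1 hkm n0) (bcomm_alpha_talpha j n).2 opprK.
rewrite !exprVn ratio_expr pole_expr bcomm_gamma eqxx.
have mm (t : C) : m * (m^-1 * t) = t by exact: (mulVKf (m_neq0 _ n0)).
case: c; case: d; rewrite /coefFE ?mulN1r ?invr1 ?subrr ?mulr0//.
  by rewrite cancelII mm.
by rewrite cancelI mm !invrK.
Qed.

End FixedMode.

Lemma contr_coefEF j c d :
  contr_coef P (EV P j c) (FV P j d) (geom_coef (ratioEF c d) (poleEF c)).
Proof.
split=> // [l l0|l N lN]; first exact: geom_coef_neg.
by apply: geom_coef_rec => // n n0; exact: contrEF_mode.
Qed.

Lemma contr_coefFE j c d :
  contr_coef P (FV P j d) (EV P j c) (geom_coef (ratioEF c d)^-1 (poleEF c)^-1).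
Proof.
split=> // [l l0|l N lN]; first exact: geom_coef_neg.
by apply: geom_coef_rec => // n n0; exact: contrFE_mode.
Qed.

End CommutatorEF.


Section CommutatorSum.
Variables (R : realType) (P : params R).
Local Notation C := (complex R).
Local Notation normc := ComplexField.Normc.normc.
Local Arguments normc : simpl never.
Local Notation k := (pk P).
Local Notation s := (ps P).
Local Notation xpow := (xpow P).
Local Notation x := (xx P).
Local Notation bfock := (bfock R).
Hypotheses (k0 : k != 0) (hsEF : sqE P * sqF P = 2 / k).
Hypotheses (hx1 : normc x < 1)
  (hkm : forall n, (0 < n)%N -> qint P (k * n%:R) != 0).

Definition jumpEF c d : C :=
  match c, d with CI, CI => x^-1 - x | CII, CII => x - x^-1 | _, _ => 0 end.

(** The three hypotheses of [bilateral_sum], for the powers of x computed in [vxEF] and [vxFE]. The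
    jump vanishes for different branches, which therefore commute. *)
Lemma jump_ident c d (a : C) :
  [/\ xpow ((if c is CI then -1 else 1) + a) - xpow ((if d is CI then 1 else -1) + a) = jumpEF c d * xpow a,
   xpow ((if c is CI then -1 else 1) + a) * (1 - ratioEF P c d) = jumpEF c d * xpow a &
   xpow ((if d is CI then 1 else -1) + a) * (1 - (ratioEF P c d)^-1) = - (jumpEF c d * xpow a)].
Proof.
have xE : xpow 1 = x by [].
have x0 : x != 0 by exact: xpow_neq0.
case: c; case: d; rewrite /= ?xpowD ?xpowN ?xE; move: (xpow a) (x) x0 => t y y0;
  by split; field.
Qed.

Lemma branch_commutator j c d e1 e2 v q :
  vcoef P (EV P j c) e1 (vcoef P (FV P j d) e2 v) q
  - vcoef P (FV P j d) e2 (vcoef P (EV P j c) e1 v) q =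
  (jumpEF c d * xpow ((- 1) ^+ (node_nat j).-1 * (s - 2))) *:
    \sum_(n \in [set: int]) (poleEF P c ^ n) *:
      ncoef P (EV P j c) (FV P j d) (e1 + n%:~R) (e2 - n%:~R) v q.
Proof.
have [J [NJ ->]] := vcoef_vcoef e1 e2 v q (contr_coefEF hx1 hkm j c d)
  (vxED P j c) (vzED P j c) (vzEF k0 hsEF j c d).
have [J' [NJ' ->]] := vcoef_vcoef e2 e1 v q (contr_coefFE hx1 hkm j c d)
  (vxFD P j d) (vzFD P j d) (vzFE k0 hsEF j d c).
rewrite (vxEF P) (vxFE P).
pose N n := ncoef P (EV P j c) (FV P j d) (e1 + n%:~R) (e2 - n%:~R) v q.
(* The contraction of F E shifts the two exponents in the opposite direction, so that its index n
   corresponds to - n in [N]. *)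
have NE n : ncoef P (FV P j d) (EV P j c) (e2 + n%:~R) (e1 - n%:~R) v q = N (- n).
  by apply: (etrans (ncoef_sym P _ _ _ _ v q)); rewrite /N intrN opprK.
have [j1 j2 j3] := jump_ident c d ((- 1) ^+ (node_nat j).-1 * (s - 2)).
have NJ'' i : (J' < i)%N -> N (- i%:Z) = 0.
  by move=> iJ; apply: (etrans (esym (NE _))); exact: NJ'.
apply: (etrans _ (bilateral_sum (poleEF P c) NJ NJ'' j1 j2 j3)).
apply: congr1; apply: congr1; apply: congr1; apply: eq_bigr => i _.
by apply: congr1; exact: NE.
Qed.

Lemma vcoef_sum V e (I : finType) (a : I -> C) (w : I -> fock R) q :
  vcoef P V e (fun q => \sum_i a i *: w i q) q = \sum_i a i *: vcoef P V e (w i) q.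
Proof.
have lv := lin_vform (vz V (q - vshift V)) e (@SZ0 R P V) (lin_SZ P V)
  (lin_TZ P V) (bannih_nilpotent P V).
have lv' := linS (xpow (vx V (q - vshift V))) lv.
apply: (etrans (vcoefE P V e _ q)); apply: (etrans (lin_sum _ _ _ lv')).
apply: eq_bigr => i _; apply: (etrans (linZ _ _ lv')).
by apply: congr1; apply: esym; exact: vcoefE.
Qed.

Lemma sum_commutator (L : lmodType C) (I J : finType) (a : I -> C) (b : J -> C)
    (X Y : I -> J -> L) :
  \sum_i a i *: (\sum_j b j *: X i j) - \sum_j b j *: (\sum_i a i *: Y i j) =
  \sum_i \sum_j (a i * b j) *: (X i j - Y i j).
Proof.
transitivity (\sum_i \sum_j (a i * b j) *: X i j - \sum_i \sum_j (a i * b j) *: Y i j).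
  congr (_ - _).
    by apply: eq_bigr => i _; rewrite scaler_sumr; apply: eq_bigr => j _; rewrite scalerA.
  rewrite exchange_big; apply: eq_bigr => j _.
  by rewrite scaler_sumr; apply: eq_bigr => i _; rewrite scalerA mulrC.
rewrite -sumrB; apply: eq_bigr => i _; rewrite -sumrB; apply: eq_bigr => j _.
by rewrite scalerBr.
Qed.

Lemma sum_branch (V : nmodType) (F : branch -> V) : \sum_c F c = F CI + F CII.
Proof.
rewrite (bigD1 CI)//= (bigD1 CII)//= big_pred0 ?addr0//.
by case.
Qed.

(** The two surviving pairs have the same coefficient - 1 / (y - y^-1)^2, and the opposite signs of
    their jumps produce the difference of the two delta functions. *)
Lemma combine_branches (L : lmodType C) (y a : C) (D : branch -> branch -> L) (S1 S2 : L) :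
  y != 0 -> y ^+ 2 - 1 != 0 ->
  (forall c d, D c d = 0 \/ c = d) ->
  D CI CI = ((y^-1 - y) * a) *: S1 -> D CII CII = ((y - y^-1) * a) *: S2 ->
  \sum_c \sum_d ((if c is CI then 1 else -1) / (y - y^-1)
     * ((if d is CI then -1 else 1) / (y - y^-1))) *: D c d =
  (a / (y - y^-1)) *: (S1 - S2).
Proof.
move=> y0 y2 Dcd D1 D2; rewrite !sum_branch.
have -> : D CI CII = 0 by case: (Dcd CI CII).
have -> : D CII CI = 0 by case: (Dcd CII CI).
rewrite D1 D2 !scaler0 addr0 add0r !scalerA scalerBr -scaleNr.
by congr (_ *: _ + _ *: _); field; rewrite y0 y2.
Qed.

Lemma fcommutator_EF j e1 e2 v q :
  fcommutator P (curE P j) (curF P j) e1 e2 v q =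
  (xpow ((- 1) ^+ (node_nat j).-1 * (s - 2)) / (x - x^-1)) *:
    (delta_mul (xpow k) (normEF P j CI) e1 e2 v q
     - delta_mul (xpow (- k)) (normEF P j CII) e1 e2 v q).
Proof.
have x0 : x != 0 by exact: xpow_neq0.
have x2 : x ^+ 2 - 1 != 0.
  by rewrite -opprB oppr_eq0; exact: onem_expr_neq0.
have E1 : ccoef P (curE P j) e1 (ccoef P (curF P j) e2 v) q =
    \sum_c (curE P j c).1 *: \sum_d (curF P j d).1 *:
      vcoef P (EV P j c) e1 (vcoef P (FV P j d) e2 v) q.
  by apply: eq_bigr => c _; apply: congr1; exact: vcoef_sum.
have E2 : ccoef P (curF P j) e2 (ccoef P (curE P j) e1 v) q =
    \sum_d (curF P j d).1 *: \sum_c (curE P j c).1 *: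
      vcoef P (FV P j d) e2 (vcoef P (EV P j c) e1 v) q.
  by apply: eq_bigr => d _; apply: congr1; exact: vcoef_sum.
apply: (etrans (f_equal2 (fun a b => a - b) E1 E2)).
apply: (etrans (sum_commutator _ _ _ _)).
pose D c d := vcoef P (EV P j c) e1 (vcoef P (FV P j d) e2 v) q
  - vcoef P (FV P j d) e2 (vcoef P (EV P j c) e1 v) q.
have D0 c d : jumpEF c d = 0 -> D c d = 0.
  move=> J0; apply: (etrans (branch_commutator j c d e1 e2 v q)); rewrite J0 mul0r.
  exact: scale0r.
have D12 c d : D c d = 0 \/ c = d.
  case: c; case: d; [by right|left|left|by right]; exact: D0.
exact (combine_branches x0 x2 D12 (branch_commutator j CI CI e1 e2 v q)
  (branch_commutator j CII CII e1 e2 v q)).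
Qed.

End CommutatorSum.

(* The exponent of the prefactor in the last relation is (-1)^(j-1) (s - 2), so
   s - 2 for j = 1: with [h_0, alpha_0] = 2 - s, which the first two relations
   require, moving x^(h_0) in E_1(z_1) through e^(- alpha_0) in F_1(z_2) yields
   x^(s - 2). *)
Theorem proposition2p2 (R : realType)
  (x lx r rs s sE sF sL sK : complex R)
  (P := Params lx r rs s sE sF sL sK)
  (hlx : cexp lx = x)
  (hx : 0 < `|x| < 1)
  (hr : 0 < complex.Re r)
  (hrs : 0 < complex.Re rs)
  (hs : s != 2)
  (hk0 : r - rs != 0)
  (hk2 : r - rs != - 2)
  (hsE : sE ^+ 2 = 2 * r / ((r - rs) * rs))
  (hsF : sF ^+ 2 = 2 * rs / ((r - rs) * r))
  (hsEF : sE * sF = 2 / (r - rs))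
  (hsL : sL ^+ 2 = 2 * r / rs)
  (hsK : sK ^+ 2 = 2 * rs / r)
  (* convergence of the infinite products in [u]_r and [u]_{r^*} *)
  (hpr : `|xpow P (2 * r)| < 1)
  (hprs : `|xpow P (2 * rs)| < 1)
  (* the denominators [km] do not vanish *)
  (hkm : forall m : nat, (0 < m)%N -> qint P ((r - rs) * m%:R) != 0) :
  [/\ (forall j : node,
         exchange P (fun u => bracket P rs u * bracket P rs (u - 1))
           (curE P j) (curE P j)),
      exchange P (fun u => bracket P rs (u + s / 2) * bracket P rs (u - s / 2 + 1))
        (curE P N1) (curE P N2),
      (forall j : node,
         exchange P (fun u => bracket P r u * bracket P r (u + 1))
           (curF P j) (curF P j)),
      exchange P (fun u => bracket P r (u - s / 2) * bracket P r (u + s / 2 - 1))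
        (curF P N1) (curF P N2) &
      forall (j : node) (K L : int) (v : fock R), Fock P K L v ->
      forall (e1 e2 : complex R) (q : qcharge R),
        fcommutator P (curE P j) (curF P j) e1 e2 v q =
        (xpow P ((- 1) ^+ (node_nat j).-1 * (s - 2)) / (x - x^-1)) *:
          (delta_mul (xpow P (r - rs)) (normEF P j CI) e1 e2 v q
           - delta_mul (xpow P (- (r - rs))) (normEF P j CII) e1 e2 v q)].
Proof.
have pos_neq0 (z : complex R) : 0 < complex.Re z -> z != 0.
  by move=> z0; apply: contraTneq z0 => ->; rewrite ltxx.
have r0 : pr P != 0 := pos_neq0 _ hr.
have rs0 : prs P != 0 := pos_neq0 _ hrs.
have k0 : pk P != 0 := hk0.
have xE : xx P = x by rewrite -hlx /xx /xpow mul1r.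
have x1 : ComplexField.Normc.normc (xx P) < 1.
  by rewrite xE -ltcR -normr_normc; case/andP: hx.
have pr1 : ComplexField.Normc.normc (xpow P (2 * pr P)) < 1.
  by rewrite -ltcR -normr_normc.
have prs1 : ComplexField.Normc.normc (xpow P (2 * prs P)) < 1.
  by rewrite -ltcR -normr_normc.
split=> [j||j||j K L v _ e1 e2 q].
- exact: (exchange_E_same rs0 k0 hsE x1 prs1 hkm j).
- exact: (exchange_E_12 rs0 k0 hsE x1 prs1 hkm).
- exact: (exchange_F_same r0 k0 hsF x1 pr1 hkm j).
- exact: (exchange_F_12 r0 k0 hsF x1 pr1 hkm).
by have := fcommutator_EF k0 hsEF x1 hkm j e1 e2 v q; rewrite xE.
Qed.
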